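(* The category $\mathcal O_{sh}^{\mathbb Z}$ decomposes as a direct sum of abelian categories $$\mathcal O_{sh}^{\mathbb Z}=\bigoplus_{\tau\in\mathcal P}{}_\tau\mathcal O_{sh}^{\mathbb Z},\qquad\mathcal P=\mathcal B/\Gamma,$$ where ${}_\tau\mathcal O_{sh}^{\mathbb Z}$ is the Serre subcategory generated by the simple objects $L(\psi)$ whose highest $\ell$-weight $\psi$ lies in the coset $\tau\in\mathcal P=\mathcal B/\Gamma$.
   Context: **Lie data.** $\mathfrak g$ is a simply-laced simple Lie algebra over $\mathbb C$ with Cartan subalgebra $\mathfrak h$, Dynkin diagram $I$ ($i\sim j$ means adjacent), Cartan matrix $(c_{ij})$, simple roots $\alpha_i$, simple coroots $\alpha_i^\vee$, fundamental coweights $\varpi_i^\vee$ ($\langle\varpi_i^\vee,\alpha_j\rangle=\delta_{ij}$), $P^\vee=\bigoplus_i\mathbb Z\varpi_i^\vee$, $Q_+=\bigoplus_i\mathbb Z_{\ge0}\alpha_i$; $\omega\le\omega'$ in $\mathfrak h^*$ means $\omega'-\omega\in Q_+$. A bipartition of $I$ into even and odd vertices is fixed; $\bar i$ is the parity of $i$, and $I\times_2\mathbb Z=\{(i,a)\in I\times\mathbb Z: a\equiv\bar i \bmod 2\}$. **Shifted Yangians and category $\mathcal O$.** For $\mu\in P^\vee$, $Y_\mu$ is the $\mathbb C$-algebra generated by $e_{i,q},f_{i,q},h_{i,p}$ ($i\in I$, $q\in\mathbb Z_{>0}$, $p\in\mathbb Z$) with relations: $[h_{i,p},h_{j,p'}]=0$;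 $[e_{i,q},f_{j,q'}]=2\delta_{ij}h_{i,q+q'-1}$; $[h_{i,p+1},e_{j,q}]-[h_{i,p},e_{j,q+1}]=c_{ij}(h_{i,p}e_{j,q}+e_{j,q}h_{i,p})$; $[h_{i,p+1},f_{j,q}]-[h_{i,p},f_{j,q+1}]=-c_{ij}(h_{i,p}f_{j,q}+f_{j,q}h_{i,p})$; $[e_{i,q+1},e_{j,q'}]-[e_{i,q},e_{j,q'+1}]=c_{ij}(e_{i,q}e_{j,q'}+e_{j,q'}e_{i,q})$; $[f_{i,q+1},f_{j,q'}]-[f_{i,q},f_{j,q'+1}]=-c_{ij}(f_{i,q}f_{j,q'}+f_{j,q'}f_{i,q})$; for $i\ne j$, $N=1-c_{ij}$, the symmetrizations over $q_1,\dots,q_N$ of $[e_{i,q_1},[e_{i,q_2},\cdots[e_{i,q_N},e_{j,q'}]\cdots]]$ and of the same expression in the $f$'s vanish; and $h_{i,p}=0$ for $p<-\langle\mu,\alpha_i\rangle$, $h_{i,-\langle\mu,\alpha_i\rangle}=1$. Set $e_i(u)=\sum_{q\ge1}e_{i,q}u^{-q}$, $h_i(u)=\sum_ph_{i,p}u^{-p}$. For a $Y_\mu$-module $V$ and $\omega\in\mathfrak h^*$, $V_\omega=\{v:\exists p,\ (h_{i,1-\langle\mu,\alpha_i\rangle}-2\langle\alpha_i^\vee,\omega\rangle)^pv=0\ \forall i\}$. $\mathcal O_\mu$ is the full subcategory of $Y_\mu$-modules with $V=\bigoplus_\omega V_\omega$, all $V_\omega$ finite-dimensional, and finitely many $\omega_1,\dots,\omega_N$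 such that $V_\omega\ne0$ implies $\omega\le\omega_k$ for some $k$; $\mathcal O_{sh}=\bigoplus_{\mu\in P^\vee}\mathcal O_\mu$. The simple objects of $\mathcal O_{sh}$ are the $L(\psi)$ with $\psi=(\psi_i(u))_{i\in I}$ an $I$-tuple of ratios of monic polynomials (the highest $\ell$-weight): $L(\psi)$ lies in $\mathcal O_\mu$ with $\langle\mu,\alpha_i\rangle=\deg\psi_i$ and is generated by $v$ with $e_i(u)v=0$, $h_i(u)v=\psi_i(u)v$ (expanded at $\infty$). $\psi$ is integral if the zeros and poles of each $\psi_i$ lie in $\bar i+2\mathbb Z$. $\mathcal O_{sh}^{\mathbb Z}$ is the full subcategory of $\mathcal O_{sh}$ of finite-length objects all of whose simple constituents have integral highest $\ell$-weight. **The group $\mathcal B/\Gamma$.** $\mathcal B$ is the group of Laurent monomials in variables $y_{i,a}$, $(i,a)\in I\times_2\mathbb Z$, identified with the group of integral highest $\ell$-weights by $y_{i,a}\mapsto\mathsf\Psi_{i,a}$ ($i$-th component $u-a$, other components $1$). $\Gamma\subset\mathcal B$ is the subgroup generated by $z_{i,a}=\dfrac{y_{i,a}y_{i,a+2}}{\prod_{j\sim i}y_{j,a+1}}$, $(i,a)\in I\times_2\mathbb Z$. *)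

(* Defs.v *)
From HB Require Import structures.
From mathcomp Require Import all_boot all_order all_algebra perm generic_quotient.
From mathcomp Require Import boolp classical_sets cardinality reals.
From mathcomp Require Import complex.
From mathcomp Require Import freeg.

Set Implicit Arguments.
Unset Strict Implicit.
Unset Printing Implicit Defensive.

Import Order.TTheory GRing.Theory Num.Theory.
Local Open Scope ring_scope.
Local Open Scope quotient_scope.

Record category := Category {
  ob :> Type;
  hom : ob -> ob -> Type;
  idc : forall X, hom X X;
  comp : forall X Y Z, hom Y Z -> hom X Y -> hom X Z;
  compA : forall X Y Z T (h : hom Z T) (g : hom Y Z) (f : hom X Y),
    comp h (comp g f) = comp (comp h g) f;
  comp1l : forall X Y (f : hom X Y), comp (idc Y) f = f;
  comp1r : forall X Y (f : hom X Y), comp f (idc X) = f }.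

Arguments hom {c} _ _.
Arguments idc {c} _.
Arguments comp {c X Y Z} _ _.

Notation "g \oc f" := (comp g f) (at level 40, left associativity).

Section CategoryNotions.
Variable C : category.
Implicit Types X Y Z K : C.

Definition zero_object Z :=
  forall X, (exists! f : hom X Z, True) /\ (exists! f : hom Z X, True).

Definition zero_morphism X Y (f : hom X Y) :=
  exists (Z : C) (g : hom X Z) (h : hom Z Y), zero_object Z /\ f = h \oc g.

Definition monomorphism X Y (f : hom X Y) :=
  forall Z (g h : hom Z X), f \oc g = f \oc h -> g = h.

Definition epimorphism X Y (f : hom X Y) :=
  forall Z (g h : hom Y Z), g \oc f = h \oc f -> g = h.

Definition isomorphism X Y (f : hom X Y) :=
  exists g : hom Y X, g \oc f = idc X /\ f \oc g = idc Y.

Definition is_kernel X Y (f : hom X Y) K (k : hom K X) :=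
  zero_morphism (f \oc k) /\
  forall Z (g : hom Z X), zero_morphism (f \oc g) ->
    exists! h : hom Z K, k \oc h = g.

Definition is_cokernel X Y (f : hom X Y) K (k : hom Y K) :=
  zero_morphism (k \oc f) /\
  forall Z (g : hom Y Z), zero_morphism (g \oc f) ->
    exists! h : hom K Z, h \oc k = g.

Definition is_product X Y P (p : hom P X) (q : hom P Y) :=
  forall Z (f : hom Z X) (g : hom Z Y),
    exists! h : hom Z P, p \oc h = f /\ q \oc h = g.

Definition is_coproduct (K : Type) (F : K -> C) X (i : forall k, hom (F k) X) :=
  forall Z (g : forall k, hom (F k) Z),
    exists! h : hom X Z, forall k, h \oc i k = g k.

(* Freyd's axioms; the additive structure on the hom-sets is a consequence. *)
Definition abelian :=
  [/\ exists Z, zero_object Z,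
      forall X Y, exists P (p : hom P X) (q : hom P Y), is_product p q,
      forall F : bool -> C, exists X (i : forall b, hom (F b) X), is_coproduct i,
      forall X Y (f : hom X Y),
        (exists K (k : hom K X), is_kernel f k) /\
        (exists K (k : hom Y K), is_cokernel f k)
    & forall X Y (f : hom X Y),
        (monomorphism f -> exists Z (g : hom Y Z), is_kernel g f) /\
        (epimorphism f -> exists Z (g : hom Z X), is_cokernel g f)].

Definition short_exact X Y Z (f : hom X Y) (g : hom Y Z) :=
  is_kernel g f /\ is_cokernel f g.

Definition simple X :=
  ~ zero_object X /\
  forall Y (f : hom Y X), monomorphism f -> zero_object Y \/ isomorphism f.

(* The list records the successive simple quotients, from the top down. *)
Inductive composition_series : C -> seq C -> Prop :=
| composition_series_nil X : zero_object X -> composition_series X [::]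
| composition_series_cons X Y S s (f : hom X Y) (g : hom Y S) :
    short_exact f g -> simple S -> composition_series X s ->
    composition_series Y (S :: s).

Definition finite_length X := exists s, composition_series X s.

Definition simple_constituent X S :=
  exists s t, composition_series X (s ++ S :: t).

Definition serre (P : C -> Prop) :=
  (forall Z, zero_object Z -> P Z) /\
  (forall X Y Z (f : hom X Y) (g : hom Y Z),
     short_exact f g -> (P Y <-> P X /\ P Z)).

Definition serre_generated (G : C -> Prop) X :=
  forall P, serre P -> (forall Y, G Y -> P Y) -> P X.

End CategoryNotions.

Section FullSubcategory.
Variables (C : category) (P : C -> Prop).

Definition full_subcategory : category :=
  @Category {X : C | P X} (fun X Y => hom (sval X) (sval Y))
    (fun X => idc (sval X)) (fun _ _ _ g f => g \oc f)
    (fun _ _ _ _ h g f => compA h g f)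
    (fun _ _ f => comp1l f) (fun _ _ f => comp1r f).

End FullSubcategory.

Section DirectSum.
Variables (K : Type) (C : K -> category).

Let dsum_ob := {X : forall k, C k | finite_set [set k | ~ zero_object (X k)]}.
Let dsum_hom (X Y : dsum_ob) := forall k, hom (sval X k) (sval Y k).

(* The external direct sum of categories: finitely supported families. *)
Definition dsum_category : category.
Proof.
refine (@Category dsum_ob dsum_hom (fun X k => idc (sval X k))
  (fun _ _ _ g f k => g k \oc f k) _ _ _).
- by move=> X Y Z T h g f; apply: functional_extensionality_dep => k; exact: compA.
- by move=> X Y f; apply: functional_extensionality_dep => k; exact: comp1l.
- by move=> X Y f; apply: functional_extensionality_dep => k; exact: comp1r.
Defined.

End DirectSum.

(* [C] is the direct sum of its full subcategories [P k]: no nonzero morphisms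
   between distinct summands, and every object is the direct sum of a finitely
   supported family with [k]-th member in [P k].  In an abelian category this
   says that the functor [(X_k)_k |-> \bigoplus_k X_k] from the external direct
   sum to [C] is an equivalence. *)
Definition direct_sum_decomposition (C : category) (K : Type)
    (P : K -> C -> Prop) :=
  (forall k l (X Y : C) (f : hom X Y),
     k <> l -> P k X -> P l Y -> zero_morphism f) /\
  (forall X : C,
     exists (F : dsum_category (fun k => full_subcategory (P k)))
            (i : forall k, hom (sval (sval F k)) X), is_coproduct i).

Lemma linear_ext (A : pzRingType) (V W : lmodType A) (f g : {linear V -> W}) :
  (forall x, f x = g x) -> f = g.
Proof.
case: f g => [f [[f1] [f2]]] [g [[g1] [g2]]] /= /funext fg.
case: g / fg in g1 g2 *.
by rewrite (Prop_irrelevance f1 g1) (Prop_irrelevance f2 g2).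
Qed.

Definition module_category (A : pzRingType) : category.
Proof.
refine (@Category (lmodType A) (fun V W => {linear V -> W})
  (fun V => idfun) (fun _ _ _ g f => (g \o f)%FUN) _ _ _).
- by move=> *; apply: linear_ext.
- by move=> *; apply: linear_ext.
- by move=> *; apply: linear_ext.
Defined.

(* The unital algebra over [K] with generators [G] and relations [rel], as the
   quotient of the formal expressions in the generators by the congruence
   generated by the axioms of algebras and by [rel].  It is only given a
   [pzRingType] structure, with a ring morphism from [K] onto central elements,
   since [algType] requires [1 != 0]. *)
Inductive alg_term (K G : Type) :=
| TGen of G
| TCst of K
| TAdd of alg_term K G & alg_term K G
| TMul of alg_term K G & alg_term K G.

Arguments TGen {K G} _.
Arguments TCst {K G} _.

Declare Scope alg_term_scope.
Delimit Scope alg_term_scope with AT.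
Bind Scope alg_term_scope with alg_term.
Notation "0" := (TCst 0) : alg_term_scope.
Notation "1" := (TCst 1) : alg_term_scope.
Infix "+" := TAdd : alg_term_scope.
Infix "*" := TMul : alg_term_scope.
Notation "c *: x" := (TMul (TCst c%R) x) : alg_term_scope.
Notation "x - y" := (TAdd x (TMul (TCst (-1)) y)) : alg_term_scope.
Notation "[< x , y >]" := (TAdd (TMul x y) (TMul (TCst (-1)) (TMul y x)))
  (at level 0, x, y at level 99) : alg_term_scope.

Definition tsum (K : pzRingType) (G : Type) (s : seq (alg_term K G)) :=
  foldr (@TAdd K G) (TCst 0) s.

Section PresentedAlgebra.
Variables (K : comPzRingType) (G : Type).
Local Notation term := (alg_term K G).
Variable rel : term -> term -> Prop.

Inductive pres_eq : term -> term -> Prop :=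
| pres_rel x y : rel x y -> pres_eq x y
| pres_refl x : pres_eq x x
| pres_sym x y : pres_eq x y -> pres_eq y x
| pres_trans x y z : pres_eq x y -> pres_eq y z -> pres_eq x z
| pres_congD x x' y y' :
    pres_eq x x' -> pres_eq y y' -> pres_eq (x + y)%AT (x' + y')%AT
| pres_congM x x' y y' :
    pres_eq x x' -> pres_eq y y' -> pres_eq (x * y)%AT (x' * y')%AT
| pres_addA x y z : pres_eq (x + (y + z))%AT ((x + y) + z)%AT
| pres_addC x y : pres_eq (x + y)%AT (y + x)%AT
| pres_add0 x : pres_eq (0 + x)%AT x
| pres_addN x : pres_eq ((-1) *: x + x)%AT 0%AT
| pres_mulA x y z : pres_eq (x * (y * z))%AT ((x * y) * z)%AT
| pres_mul1 x : pres_eq (1 * x)%AT x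
| pres_mulDl x y z : pres_eq ((x + y) * z)%AT (x * z + y * z)%AT
| pres_mulDr x y z : pres_eq (x * (y + z))%AT (x * y + x * z)%AT
| pres_cstD a b : pres_eq (TCst (a + b)) (TCst a + TCst b)%AT
| pres_cstM a b : pres_eq (TCst (a * b)) (TCst a * TCst b)%AT
| pres_cstC a x : pres_eq (TCst a * x)%AT (x * TCst a)%AT.

HB.instance Definition _ := gen_eqMixin term.
HB.instance Definition _ := gen_choiceMixin term.

Definition pres_eqb (x y : term) : bool := `[< pres_eq x y >].

Lemma pres_eqb_refl : reflexive pres_eqb.
Proof. by move=> x; apply/asboolP; exact: pres_refl. Qed.
Lemma pres_eqb_sym : symmetric pres_eqb.
Proof. by move=> x y; apply/asboolP/asboolP; exact: pres_sym. Qed.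
Lemma pres_eqb_trans : transitive pres_eqb.
Proof. by move=> y x z /asboolP xy /asboolP yz; apply/asboolP; exact: pres_trans yz. Qed.

Canonical pres_equiv := EquivRel pres_eqb pres_eqb_refl pres_eqb_sym pres_eqb_trans.

Definition presented : Type := {eq_quot pres_equiv}.
HB.instance Definition _ := Choice.on presented.
HB.instance Definition _ := EqQuotient.on presented.

Definition pres_pi (x : term) : presented := \pi_presented x.

Lemma pres_piP x y : pres_pi x = pres_pi y <-> pres_eq x y.
Proof. by split=> [/eqmodP/asboolP|xy] //; apply/eqmodP/asboolP. Qed.

Lemma pres_reprK (a : presented) : pres_pi (repr a) = a.
Proof. exact: reprK. Qed.

Lemma pres_repr_pi x : pres_eq (repr (pres_pi x)) x.
Proof. by apply/pres_piP; rewrite pres_reprK. Qed.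

Definition pres_add (a b : presented) := pres_pi (repr a + repr b)%AT.
Definition pres_mul (a b : presented) := pres_pi (repr a * repr b)%AT.
Definition pres_opp (a : presented) := pres_pi ((-1) *: repr a)%AT.

Lemma pres_piD x y : pres_pi (x + y)%AT = pres_add (pres_pi x) (pres_pi y).
Proof. by apply/pres_piP/pres_sym/pres_congD; exact: pres_repr_pi. Qed.
Lemma pres_piM x y : pres_pi (x * y)%AT = pres_mul (pres_pi x) (pres_pi y).
Proof. by apply/pres_piP/pres_sym/pres_congM; exact: pres_repr_pi. Qed.
Lemma pres_piN x : pres_pi ((-1) *: x)%AT = pres_opp (pres_pi x).
Proof.
apply/pres_piP/pres_sym/pres_congM; [exact: pres_refl | exact: pres_repr_pi].
Qed.

Lemma pres_ind (P : presented -> Prop) :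
  (forall x, P (pres_pi x)) -> forall a, P a.
Proof. by move=> Px a; rewrite -(pres_reprK a). Qed.

Let addA : associative pres_add.
Proof.
elim/pres_ind=> x; elim/pres_ind=> y; elim/pres_ind=> z.
by rewrite -!pres_piD; apply/pres_piP/pres_addA.
Qed.
Let addC : commutative pres_add.
Proof.
by elim/pres_ind=> x; elim/pres_ind=> y; rewrite -!pres_piD; apply/pres_piP/pres_addC.
Qed.
Let add0 : left_id (pres_pi 0%AT) pres_add.
Proof. by elim/pres_ind=> x; rewrite -!pres_piD; apply/pres_piP/pres_add0. Qed.
Let addN : left_inverse (pres_pi 0%AT) pres_opp pres_add.
Proof.
by elim/pres_ind=> x; rewrite -pres_piN -pres_piD; apply/pres_piP/pres_addN.
Qed.

HB.instance Definition _ := GRing.isZmodule.Build presented addA addC add0 addN.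

Let mulA : associative pres_mul.
Proof.
elim/pres_ind=> x; elim/pres_ind=> y; elim/pres_ind=> z.
by rewrite -!pres_piM; apply/pres_piP/pres_mulA.
Qed.
Let mul1 : left_id (pres_pi 1%AT) pres_mul.
Proof. by elim/pres_ind=> x; rewrite -!pres_piM; apply/pres_piP/pres_mul1. Qed.
Let mulr1 : right_id (pres_pi 1%AT) pres_mul.
Proof.
elim/pres_ind=> x; rewrite -!pres_piM; apply/pres_piP.
exact: pres_trans (pres_sym (pres_cstC _ _)) (pres_mul1 _).
Qed.
Let mulDl : left_distributive pres_mul +%R.
Proof.
elim/pres_ind=> x; elim/pres_ind=> y; elim/pres_ind=> z.
rewrite -[(_ + _)%R]pres_piD -!pres_piM -[RHS]pres_piD.
exact/pres_piP/pres_mulDl.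
Qed.
Let mulDr : right_distributive pres_mul +%R.
Proof.
elim/pres_ind=> x; elim/pres_ind=> y; elim/pres_ind=> z.
rewrite -[(_ + _)%R]pres_piD -!pres_piM -[RHS]pres_piD.
exact/pres_piP/pres_mulDr.
Qed.

HB.instance Definition _ :=
  GRing.Zmodule_isPzRing.Build presented mulA mul1 mulr1 mulDl mulDr.

Definition pres_cst (c : K) : presented := pres_pi (TCst c).

Let cst_additive : nmod_morphism pres_cst.
Proof. by split=> // a b; rewrite /pres_cst -[RHS]pres_piD; exact/pres_piP/pres_cstD. Qed.
Let cst_multiplicative : monoid_morphism pres_cst.
Proof. by split=> // a b; rewrite /pres_cst -[RHS]pres_piM; exact/pres_piP/pres_cstM. Qed.

HB.instance Definition _ := GRing.isNmodMorphism.Build K presented pres_cst cst_additive.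
HB.instance Definition _ := GRing.isMonoidMorphism.Build K presented pres_cst cst_multiplicative.

End PresentedAlgebra.

(* A simply-laced simple Lie algebra over the complex numbers, given by its
   Dynkin diagram: by the Cartan-Killing classification these are the nonempty
   connected simple graphs whose Cartan matrix is of finite type, i.e. positive
   definite (over the rationals or, equivalently, over the reals).  The
   bipartition is [parity], with value [true] on odd vertices. *)
Record lie_datum := LieDatum {
  vertex :> finType;
  adj : rel vertex;
  cartan (i j : vertex) : int := if i == j then 2 else if adj i j then -1 else 0;
  adj_sym : symmetric adj;
  adj_irr : irreflexive adj;
  vertex_gt0 : (0 < #|vertex|)%N;
  adj_connected : forall i j, connect adj i j;
  cartan_posdef : forall x : {ffun vertex -> rat}, x != 0 ->
    0 < \sum_i \sum_j x i * (cartan i j)%:~R * x j;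
  parity : vertex -> bool;
  parity_adj : forall i j, adj i j -> parity i != parity j }.

Section ShiftedYangian.
Variables (R : realType) (D : lie_datum).
Local Notation C := R[i].
Local Notation c := (@cartan D).
Local Notation "x %:F" := (@FracField.tofrac {poly R[i]} x).

(* A coweight [mu = \sum_i mu_i varpi_i^vee] is given by its coordinates
   [mu_i = <mu, alpha_i>]. *)
Definition coweight := {ffun D -> int}.

(* [Ye i q] and [Yf i q] stand for e_{i,q+1} and f_{i,q+1}, so that [q] ranges
   over all natural numbers. *)
Inductive ygen := Ye of D & nat | Yf of D & nat | Yh of D & int.

Local Notation e i q := (TGen (Ye i q%N) : alg_term C ygen).
Local Notation f i q := (TGen (Yf i q%N) : alg_term C ygen).
Local Notation h i p := (TGen (Yh i p%R) : alg_term C ygen).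

Inductive yangian_rel (mu : coweight) : alg_term C ygen -> alg_term C ygen -> Prop :=
| yrel_hh i j p p' : yangian_rel mu [< h i p, h j p' >]%AT 0%AT
| yrel_ef i j (q q' : nat) :
    yangian_rel mu [< e i q, f j q' >]%AT
      ((if i == j then 2 else 0) *: h i (q + q' + 1)%N%:Z)%AT
| yrel_he i j p q :
    yangian_rel mu ([< h i (p + 1), e j q >] - [< h i p, e j q.+1 >])%AT
      ((c i j)%:~R *: (h i p * e j q + e j q * h i p))%AT
| yrel_hf i j p q :
    yangian_rel mu ([< h i (p + 1), f j q >] - [< h i p, f j q.+1 >])%AT
      ((- c i j)%:~R *: (h i p * f j q + f j q * h i p))%AT
| yrel_ee i j q q' :
    yangian_rel mu ([< e i q.+1, e j q' >] - [< e i q, e j q'.+1 >])%AT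
      ((c i j)%:~R *: (e i q * e j q' + e j q' * e i q))%AT
| yrel_ff i j q q' :
    yangian_rel mu ([< f i q.+1, f j q' >] - [< f i q, f j q'.+1 >])%AT
      ((- c i j)%:~R *: (f i q * f j q' + f j q' * f i q))%AT
| yrel_serre_e i j (N : nat) (q : 'I_N -> nat) q' : i != j -> N%:Z = 1 - c i j ->
    yangian_rel mu
      (tsum [seq foldr (fun k x => [< e i (q (s k)), x >]%AT) (e j q') (enum 'I_N)
            | s : 'S_N]) 0%AT
| yrel_serre_f i j (N : nat) (q : 'I_N -> nat) q' : i != j -> N%:Z = 1 - c i j ->
    yangian_rel mu
      (tsum [seq foldr (fun k x => [< f i (q (s k)), x >]%AT) (f j q') (enum 'I_N)
            | s : 'S_N]) 0%AT
| yrel_h0 i p : p < - mu i -> yangian_rel mu (h i p) 0%AT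
| yrel_h1 i : yangian_rel mu (h i (- mu i)) 1%AT.

Definition yangian (mu : coweight) : pzRingType := presented (yangian_rel mu).

Definition y_gen mu (g : ygen) : yangian mu := pres_pi _ (TGen g).
Definition y_e mu i q : yangian mu := y_gen mu (Ye i q).
Definition y_f mu i q : yangian mu := y_gen mu (Yf i q).
Definition y_h mu i p : yangian mu := y_gen mu (Yh i p).
Definition y_cst mu (a : C) : yangian mu := pres_cst (yangian_rel mu) a.

(* A weight [omega = \sum_j omega_j alpha_j] is given by its coordinates in the
   basis of simple roots. *)
Definition weight := {ffun D -> C}.

Definition coroot_pairing (i : D) (w : weight) : C := \sum_j (c i j)%:~R * w j.

Definition weight_le (w w' : weight) : Prop :=
  exists n : D -> nat, forall j, w' j - w j = (n j)%:R.

Section CategoryO.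
Variables (mu : coweight) (V : lmodType (yangian mu)).

Definition weight_space (w : weight) : set V := [set v | exists p : nat, forall i,
  (y_h mu i (1 - mu i) - y_cst mu (2 * coroot_pairing i w)) ^+ p *: v = 0].

Definition weight_decomposition :=
  (forall v : V, exists (s : seq weight) (x : weight -> V),
     (forall w, weight_space w (x w)) /\ v = \sum_(w <- s) x w) /\
  (forall (s : seq weight) (x : weight -> V), uniq s ->
     (forall w, weight_space w (x w)) -> \sum_(w <- s) x w = 0 ->
     forall w, w \in s -> x w = 0).

Definition fin_dim (U : set V) := exists (n : nat) (b : 'I_n -> V),
  (forall k, U (b k)) /\
  (forall v, U v -> exists a : 'I_n -> C, v = \sum_k y_cst mu (a k) *: b k).

Definition in_O : Prop :=
  [/\ weight_decomposition,
      forall w, fin_dim (weight_space w)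
    & exists s : seq weight, forall w v, weight_space w v -> v <> 0 ->
        exists2 w', w' \in s & weight_le w w'].

End CategoryO.

Definition O_cat (mu : coweight) : category :=
  full_subcategory (C := module_category (yangian mu)) (@in_O mu).

Definition O_sh : category := dsum_category O_cat.

Definition component (X : O_sh) (mu : coweight) : lmodType (yangian mu) :=
  sval (sval X mu).

Definition monic_ratio (r : {fraction {poly C}}) (P Q : {poly C}) :=
  [/\ P \is monic, Q \is monic & r = P%:F / Q%:F].

(* [s p] is the coefficient of u^{-p} in the expansion at infinity of the
   rational function [r = P / Q]: the Laurent series [s] in u^{-1} satisfies
   [Q * s = P], whose coefficients of u^{-m} are compared. *)
Definition expansion_at_infinity (r : {fraction {poly C}}) (s : int -> C) :=
  (exists n0, forall n, n < n0 -> s n = 0) /\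
  (exists P Q, monic_ratio r P Q /\
     forall m : int, \sum_(k < size Q) Q`_k * s (m + k%:Z)
       = if m <= 0 then P`_(`|m|%N) else 0).

Definition l_weight := D -> {fraction {poly C}}.

Definition is_zero_of (r : {fraction {poly C}}) (a : C) :=
  exists P Q, [/\ monic_ratio r P Q, coprimep P Q & root P a].
Definition is_pole_of (r : {fraction {poly C}}) (a : C) :=
  exists P Q, [/\ monic_ratio r P Q, coprimep P Q & root Q a].

Definition is_L (psi : l_weight) (X : O_sh) :=
  (forall i, exists P Q, monic_ratio (psi i) P Q) /\ simple X /\
  exists mu : coweight,
    [/\ forall i, exists P Q, monic_ratio (psi i) P Q /\
          mu i = (size P)%:Z - (size Q)%:Z,
        forall nu, nu <> mu -> forall x : component X nu, x = 0
      & exists v : component X mu,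
          [/\ forall x, exists y : yangian mu, x = y *: v,
              forall i q, y_e mu i q *: v = 0
            & forall i, exists s, expansion_at_infinity (psi i) s /\
                forall p, y_h mu i p *: v = y_cst mu (s p) *: v]].

Definition integral_l_weight (psi : l_weight) :=
  forall i a, is_zero_of (psi i) a \/ is_pole_of (psi i) a ->
    exists k : int, a = ((parity i : nat)%:Z + 2 * k)%:~R.

Definition O_shZ : category := full_subcategory (C := O_sh)
  (fun X => finite_length X /\ forall S, simple_constituent X S ->
     exists psi, integral_l_weight psi /\ is_L psi S).

(* [I \times_2 \mathbb Z] *)
Definition ivertex :=
  {x : D * int | (x.2 == (parity x.1 : nat)%:Z %[mod 2])%Z}.

Lemma ivertex_shift2 (x : ivertex) :
  ((val x).2 + 2 == (parity (val x).1 : nat)%:Z %[mod 2])%Z.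
Proof. by rewrite modzDr (valP x). Qed.

Lemma ivertex_shift1 (x : ivertex) (j : {j | adj (val x).1 j}) :
  ((val x).2 + 1 == (parity (val j) : nat)%:Z %[mod 2])%Z.
Proof.
have := parity_adj (valP j); have := valP x.
rewrite -modzDml => /eqP ->.
by case: (parity _); case: (parity _).
Qed.

Definition shift2 (x : ivertex) : ivertex :=
  exist _ ((val x).1, (val x).2 + 2) (ivertex_shift2 x).
Definition shift1 (x : ivertex) (j : {j | adj (val x).1 j}) : ivertex :=
  exist _ (val j, (val x).2 + 1) (ivertex_shift1 j).

(* The group of Laurent monomials in the y_{i,a}, written additively. *)
Definition monomial := {freeg ivertex / int}.

Definition y_mono (x : ivertex) : monomial := << x >>.
Definition z_mono (x : ivertex) : monomial :=
  y_mono x + y_mono (shift2 x) - \sum_(j : {j | adj (val x).1 j}) y_mono (shift1 j).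

Definition Gamma : set monomial :=
  [set m | exists n : {freeg ivertex / int},
     m = \sum_(x <- dom n) z_mono x *~ coeff x n].

(* The quotient by [Gamma]: the cosets of [Gamma]. *)
Definition coset :=
  {tau : set monomial | exists m : monomial, tau = [set m' : monomial | Gamma (m' - m)]%classic}.

Definition Psi (m : monomial) : l_weight := fun i =>
  \prod_(x <- dom m | (val x).1 == i) ('X - ((val x).2%:~R)%:P)%:F ^ coeff x m.

Definition tau_O_shZ (tau : coset) : O_shZ -> Prop :=
  serre_generated (fun X : O_shZ => exists2 m, sval tau m & is_L (Psi m) (sval X)).

End ShiftedYangian.

(* Main.v *)
(** Idea.  Decompose an object of category O into the joint generalized
    eigenspaces V_lam of the commuting elements h_{i,p}, where lam = (lam_{i,p})
    is read as an I-tuple of Laurent series in u^{-1}.  The relations between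
    h_i(u) and e_j(u) force e_{j,q} to map V_lam into the sum of the V_lam' with
    lam'_i = lam_i * (u - a + c_ij) / (u - a - c_ij) for some a, and f_{j,q} acts
    by the inverse factors.  When (j,a) is integral, this factor A_{j,a} is
    z_{j,a-2} / z_{j,a}; otherwise it has no integral zero or pole.  Hence the sum
    of the V_lam with lam in the coset tau, up to products of the A_{j,a}, is a
    submodule, these submodules are in direct sum, and comparing orders of
    vanishing at integral points shows that distinct cosets stay distinct.  An
    object of finite length with integral constituents involves finitely many
    cosets only. *)

From Stdlib Require List.
From HB Require Import structures.
From mathcomp Require Import all_boot all_order all_algebra reals.
From mathcomp Require Import zify ring boolp classical_sets cardinality complex freeg.
Require Import Defs.

Set Implicit Arguments.
Unset Strict Implicit.
Unset Printing Implicit Defensive.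

Import Order.TTheory GRing.Theory Num.Theory.
Local Open Scope ring_scope.

(** * Commuting operators and generalized eigenvectors *)

(** Category O constrains only the operators [h_{i,1-mu_i}]. Their weight spaces are
    finite-dimensional and stable under all the commuting [h_{i,p}], so this infinite family acts
    locally finitely; that is what makes the joint generalized eigenspaces available. The relations
    between [h_i(u)] and [e_j(u)] couple [e_{j,q}] with [e_{j,q+1}], so they do not constrain
    eigenvalues directly. Since [c_jj] is nonzero, the relations for [i = j] give
    [e_{j,q+1} = t e_{j,q} - e_{j,q} s] with [t], [s] polynomials in the [h_{j,p}]; the number [a]
    is the eigenvalue of [t] on the target minus that of [s] on the source. As only generalized
    eigenvectors are at hand, the computation is made after a projection, by induction on dimension.
    Nothing in it forces [a] to be integral, so the set attached to a coset has to admit factors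
    [A_{j,a}] for every complex [a]. A generated Serre subcategory is an intersection of Serre
    classes, which is hard to handle; it is identified with a condition on the eigenvalues occurring
    in an object. To state such conditions, kernels, exactness and simplicity are first translated
    into statements about elements. *)

Inductive fsum (V : nmodType) (Q : V -> Prop) : V -> Prop :=
| fsum0 : fsum Q 0
| fsumS x y : Q x -> fsum Q y -> fsum Q (x + y).

Lemma fsum1 (V : nmodType) (Q : V -> Prop) v : Q v -> fsum Q v.
Proof. by move=> Qv; rewrite -[v]addr0; apply: fsumS => //; exact: fsum0. Qed.

Lemma fsumD (V : nmodType) (Q : V -> Prop) v w : fsum Q v -> fsum Q w -> fsum Q (v + w).
Proof.
by move=> Qv Qw; elim: Qv => [|x y Qx _ IH]; rewrite ?add0r // -addrA; exact: fsumS.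
Qed.

Lemma fsum_big (V : nmodType) (Q : V -> Prop) I (s : seq I) (x : I -> V) :
  (forall i, Q (x i)) -> fsum Q (\sum_(i <- s) x i).
Proof. by move=> Qx; elim/big_rec: _ => [|i y _]; [exact: fsum0 | exact: fsumS]. Qed.

Lemma fsum_map (V W : nmodType) (Q : V -> Prop) (Q' : W -> Prop) (f : {additive V -> W}) v :
  (forall x, Q x -> fsum Q' (f x)) -> fsum Q v -> fsum Q' (f v).
Proof.
move=> QQ'; elim=> [|x y Qx _ IH]; first by rewrite raddf0; exact: fsum0.
by rewrite raddfD; apply: fsumD => //; exact: QQ'.
Qed.

Lemma fsum_bind (V : nmodType) (Q Q' : V -> Prop) v : (forall x, Q x -> fsum Q' x) -> fsum Q v -> fsum Q' v.
Proof. exact: (@fsum_map _ _ _ _ idfun). Qed.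

Lemma fsum_sub (V : nmodType) (Q Q' : V -> Prop) v : (forall x, Q x -> Q' x) -> fsum Q v -> fsum Q' v.
Proof. by move=> QQ'; apply: fsum_bind => x /QQ'/fsum1. Qed.

Section CommutingOperators.
Variables (F : fieldType) (A : pzRingType) (cst : {rmorphism F -> A}).
Hypothesis cstC : forall c x, cst c * x = x * cst c.
Variables (J : Type) (h : J -> A).
Hypothesis hC : forall j k, h j * h k = h k * h j.

(** The subalgebra generated by the scalars and the [h j]. Separating operators are always taken
    from it, because its elements commute with every [h j] and so preserve all joint generalized
    eigenspaces. *)
Inductive hpoly : A -> Prop :=
| hpoly_cst c : hpoly (cst c)
| hpoly_h j : hpoly (h j)
| hpolyD x y : hpoly x -> hpoly y -> hpoly (x + y)
| hpolyM x y : hpoly x -> hpoly y -> hpoly (x * y).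

Lemma hpoly1 : hpoly 1. Proof. by rewrite -(rmorph1 cst); exact: hpoly_cst. Qed.

Lemma hpolyN x : hpoly x -> hpoly (- x).
Proof.
move=> Hx; rewrite -mulN1r -(rmorphN1 cst); apply: hpolyM => //; exact: hpoly_cst.
Qed.

Lemma hpolyB x y : hpoly x -> hpoly y -> hpoly (x - y).
Proof. by move=> Hx Hy; apply: hpolyD => //; exact: hpolyN. Qed.

Lemma hpolyX x n : hpoly x -> hpoly (x ^+ n).
Proof.
by move=> Hx; elim: n => [|n IH]; rewrite ?exprS; [exact: hpoly1 | exact: hpolyM].
Qed.

Lemma hpolyBc j c : hpoly (h j - cst c).
Proof. by apply: hpolyB; [exact: hpoly_h | exact: hpoly_cst]. Qed.

Lemma hpolyC x y : hpoly x -> hpoly y -> x * y = y * x.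
Proof.
suff hpC : forall z, (forall j, h j * z = z * h j) -> forall x, hpoly x -> x * z = z * x.
  move=> Hx Hy; apply: (hpC) Hx => j; symmetry; apply: (hpC) Hy => k; exact: hC.
move=> z hz {}x; elim=> [c|j|a b _ IHa _ IHb|a b _ IHa _ IHb] //.
- by rewrite mulrDl mulrDr IHa IHb.
- by rewrite -mulrA IHb mulrA IHa mulrA.
Qed.

Section Module.
Variable V : lmodType A.
Implicit Types (v w : V) (x z : A) (lam : J -> F).

Lemma hpolyCA x z v : hpoly x -> hpoly z -> x *: (z *: v) = z *: (x *: v).
Proof. by move=> Hx Hz; rewrite !scalerA (hpolyC Hx Hz). Qed.

Lemma nilp_le x v p q : x ^+ p *: v = 0 -> (p <= q)%N -> x ^+ q *: v = 0.
Proof. by move=> xp /subnK <-; rewrite exprD -scalerA xp scaler0. Qed.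

Definition geig x a v := exists p, (x - cst a) ^+ p *: v = 0.

Definition gws lam v := forall j, geig (h j) (lam j) v.

Lemma geig0 x a : geig x a 0. Proof. by exists 0%N; rewrite scaler0. Qed.

Lemma geigD x a v w : geig x a v -> geig x a w -> geig x a (v + w).
Proof.
move=> [p vp] [q wq]; exists (p + q)%N; rewrite scalerDr.
by rewrite (nilp_le vp) ?leq_addr // (nilp_le wq) ?leq_addl // addr0.
Qed.

Lemma geig_hpoly x a v z : hpoly x -> hpoly z -> geig x a v -> geig x a (z *: v).
Proof.
move=> Hx Hz [p vp]; exists p; rewrite hpolyCA ?vp ?scaler0 //.
by apply: hpolyX; apply: hpolyB => //; exact: hpoly_cst.
Qed.

Lemma gws0 lam : gws lam 0. Proof. by move=> j; exact: geig0. Qed.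

Lemma gwsD lam v w : gws lam v -> gws lam w -> gws lam (v + w).
Proof. by move=> Hv Hw j; exact: geigD. Qed.

Lemma gws_hpoly lam z v : hpoly z -> gws lam v -> gws lam (z *: v).
Proof. by move=> Hz Hv j; apply: geig_hpoly => //; exact: hpoly_h. Qed.

(* A geometric series in the nilpotent part [x - a] inverts [x - b]. *)
Lemma geig_inv x a b v : hpoly x -> a != b -> geig x a v ->
  exists2 z, hpoly z & z *: ((x - cst b) *: v) = v.
Proof.
move=> Hx ab [p]; elim: p v => [|p IH] v.
  by rewrite expr0 scale1r => ->; exists 1; [exact: hpoly1 | rewrite !scaler0].
have Ha c : hpoly (x - cst c) by apply: hpolyB => //; exact: hpoly_cst.
rewrite exprSr -scalerA => /IH[z Hz zv].
exists (cst (a - b)^-1 * (1 - z * (x - cst a))).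
  apply: hpolyM; first exact: hpoly_cst.
  by apply: hpolyB; [exact: hpoly1 | exact: hpolyM].
rewrite -!scalerA (scalerBl 1) scale1r -scalerA (hpolyCA _ (Ha a) (Ha b)) zv -scalerBl.
have -> : x - cst b - (x - cst a) = cst (a - b).
  by rewrite rmorphB opprB addrC addrA addrNK.
by rewrite scalerA -rmorphM mulVf ?subr_eq0 // rmorph1 scale1r.
Qed.

(** At an index [j] where [lam] and [mu] differ, [h j - mu j] is nilpotent on [w] and inverted on
    [v] by some [z]; a power of [z (h j - mu j)] then does both jobs. *)
Lemma gws_sep1 lam mu v w : lam <> mu -> gws lam v -> gws mu w ->
  exists z, [/\ hpoly z, z *: v = v & z *: w = 0].
Proof.
move=> lm lv mw; have [j lmj] : exists j, lam j != mu j.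
  apply: contra_notP lm => lm; apply/funext => j; apply/eqP/negPn/negP => ljm.
  by apply: lm; exists j.
have [z Hz zv] := geig_inv (hpoly_h j) lmj (lv j); have [p wp] := mw j.
have Hx := hpolyBc j (mu j).
exists ((z * (h j - cst (mu j))) ^+ p); split.
- exact/hpolyX/hpolyM.
- elim: p {wp} => [|p IH]; first by rewrite expr0 scale1r.
  by rewrite exprSr -scalerA -[_ *: v]scalerA zv.
- by rewrite exprMn_comm -?scalerA ?wp ?scaler0 //; exact: hpolyC.
Qed.

Definition gws_in (S : (J -> F) -> Prop) v := exists2 lam, S lam & gws lam v.

Definition gsum S := fsum (gws_in S).

Lemma gsum_hpoly S z v : hpoly z -> gsum S v -> gsum S (z *: v).
Proof.
move=> Hz; apply: (fsum_map (f := ( *:%R z))) => x [lam Sl lx]; apply: fsum1.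
by exists lam => //; exact: gws_hpoly.
Qed.

Lemma gsum_sub (S S' : (J -> F) -> Prop) v :
  (forall lam, S lam -> S' lam) -> gsum S v -> gsum S' v.
Proof. by move=> SS'; apply: fsum_sub => x [lam /SS' Sl lx]; exists lam. Qed.

Lemma gsum_sep (S S' : (J -> F) -> Prop) v w :
  (forall lam, S lam -> ~ S' lam) -> gsum S v -> gsum S' w ->
  exists z, [/\ hpoly z, z *: v = v & z *: w = 0].
Proof.
move=> SS' Sv S'w; elim: Sv => [|x y [lam Sl lx] _ [z [Hz zy zw]]].
  exists 0; split; rewrite ?scaler0 ?scale0r //.
  by rewrite -(rmorph0 cst); exact: hpoly_cst.
suff [t [Ht tx tw]] : exists t, [/\ hpoly t, t *: x = x & t *: w = 0].
  (* This is [1 - (1 - z)(1 - t)]: it fixes what either [z] or [t] fixes, and kills what both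
     kill. *)
  exists (z + t - z * t); split.
  - by apply: hpolyB; [exact: hpolyD | exact: hpolyM].
  - rewrite scalerBl scalerDl -scalerA !scalerDr tx zy (hpolyCA y Hz Ht) zy.
    by rewrite [z *: x + y]addrC addrACA addrK addrC.
  - by rewrite scalerBl scalerDl -scalerA zw tw scaler0 subr0 addr0.
elim: S'w {Hz zw} => [|u s [mu Sm mux] _ [t [Ht tx ts]]].
  by exists 1; split; [exact: hpoly1 | rewrite scale1r | rewrite scaler0].
have lm : lam <> mu by move=> lm; apply: (SS' lam) => //; rewrite lm.
have [r [Hr rx ru]] := gws_sep1 lm lx mux.
exists (t * r); split; first exact: hpolyM.
- by rewrite -scalerA rx.
- by rewrite -scalerA scalerDr ru add0r hpolyCA // ts scaler0.
Qed.

Lemma gsum_disjoint (S S' : (J -> F) -> Prop) v :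
  (forall lam, S lam -> ~ S' lam) -> gsum S v -> gsum S' v -> v = 0.
Proof. by move=> SS' Sv S'v; have [z [_ zv z0]] := gsum_sep SS' Sv S'v; rewrite -[LHS]zv. Qed.

End Module.

Lemma geig_lin (V W : lmodType A) (f : {linear V -> W}) x a v :
  geig x a v -> geig x a (f v).
Proof. by move=> [p vp]; exists p; rewrite -linearZ vp linear0. Qed.

Lemma gws_lin (V W : lmodType A) (f : {linear V -> W}) lam v :
  gws lam v -> gws lam (f v).
Proof. by move=> lv j; exact: geig_lin. Qed.

Lemma gsum_lin (V W : lmodType A) (f : {linear V -> W}) S v :
  gsum S v -> gsum S (f v).
Proof.
apply: fsum_map => x [lam Sl lx]; apply: fsum1; exists lam => //; exact: gws_lin.
Qed.

End CommutingOperators.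

(** Take [M] of maximal rank among the matrices whose row space lies in [S]: a vector of [S] outside
    this row space could be adjoined and would raise the rank. *)
Lemma row_space_pred (F : fieldType) n (S : 'rV[F]_n -> Prop) :
  S 0 -> (forall a u v, S u -> S v -> S (a *: u + v)) ->
  exists M : 'M[F]_n, forall u, S u <-> (u <= M)%MS.
Proof.
move=> S0 Slin.
pose P r := `[< exists M : 'M[F]_n, (forall u, (u <= M)%MS -> S u) /\ \rank M = r >].
have exP : exists r, P r.
  exists 0%N; apply/asboolP; exists 0; rewrite mxrank0; split=> // u.
  by rewrite submx0 => /eqP->.
have leP r : P r -> (r <= n)%N by move=> /asboolP[M [_ <-]]; exact: rank_leq_row.
case: (ex_maxnP exP leP) => r /asboolP[M [MS rM]] rmax.
exists M => u; split=> [Su|]; last exact: MS.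
apply/negPn/negP => uM.
have Mu : (M < M + u)%MS.
  by rewrite ltmxE addsmxSl /=; apply: contra uM; apply: submx_trans; exact: addsmxSr.
have /rmax : P (\rank (M + u)%MS).
  apply/asboolP; exists (M + u)%MS; split=> // v /sub_addsmxP[[w1 w2] /= ->].
  rewrite addrC [w2]mx11_scalar mul_scalar_mx; apply: Slin => //.
  by apply: MS; exact: submxMl.
by rewrite leqNgt -rM (rank_ltmx Mu).
Qed.

(** * Finite-dimensional subspaces and annihilating polynomials *)

Section FiniteDimension.
Variables (F : fieldType) (A : pzRingType) (cst : {rmorphism F -> A}).
Hypothesis cstC : forall c x, cst c * x = x * cst c.
Variable V : lmodType A.
Implicit Types (U : V -> Prop) (x : A).

(** [V] is given as a module over [A]; its structure of vector space over [F] is the action through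
    [cst]. *)
Definition subspace U := U 0 /\ forall a u v, U u -> U v -> U (cst a *: u + v).

Definition spans n (b : 'I_n -> V) U :=
  forall v, U v -> exists a : 'I_n -> F, v = \sum_k cst (a k) *: b k.

Definition lcomb n (b : 'I_n -> V) (a : 'rV[F]_n) := \sum_k cst (a 0 k) *: b k.

Lemma lcomb_lin n (b : 'I_n -> V) c u v :
  lcomb b (c *: u + v) = cst c *: lcomb b u + lcomb b v.
Proof.
rewrite /lcomb scaler_sumr -big_split; apply: eq_bigr => k _.
by rewrite !mxE rmorphD rmorphM scalerDl scalerA.
Qed.

Lemma lcomb0 n (b : 'I_n -> V) : lcomb b 0 = 0.
Proof. by apply: big1 => k _; rewrite mxE rmorph0 scale0r. Qed.

Lemma lcomb_mul m n (b : 'I_n -> V) (B : 'M_(m, n)) w :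
  lcomb b (w *m B) = \sum_l cst (w 0 l) *: lcomb b (row l B).
Proof.
rewrite /lcomb; under eq_bigr do rewrite mxE rmorph_sum scaler_suml.
rewrite exchange_big; apply: eq_bigr => l _; rewrite scaler_sumr.
by apply: eq_bigr => k _; rewrite mxE rmorphM scalerA.
Qed.

Lemma spansP n (b : 'I_n -> V) U v : spans b U -> U v -> exists a, v = lcomb b a.
Proof.
move=> bU /bU[a ->]; exists (\row_k a k).
by apply: eq_bigr => k _; rewrite mxE.
Qed.

Lemma subspaceD U u v : subspace U -> U u -> U v -> U (u + v).
Proof. by move=> [_ UD] Uu Uv; rewrite -[u]scale1r -(rmorph1 cst); exact: UD. Qed.

Lemma subspaceZ U a u : subspace U -> U u -> U (cst a *: u).
Proof. by move=> [U0 UD] Uu; rewrite -[_ *: _]addr0; exact: UD. Qed.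

(** The coefficient vectors of elements of [U'] form a row space, and a basis of it gives [b']. The
    length of a spanning family acts as a dimension bound; by the last clause it drops strictly on a
    proper subspace, which drives the inductions on dimension. *)
Lemma spans_sub n (b : 'I_n -> V) U U' :
    subspace U' -> (forall v, U' v -> U v) -> spans b U ->
  exists m (b' : 'I_m -> V), [/\ (m <= n)%N, forall k, U' (b' k), spans b' U'
    & m = n -> forall v, U v -> U' v].
Proof.
move=> [U0 UD] sU bU.
have [||M MP] := @row_space_pred F n (fun a => U' (lcomb b a)).
- by rewrite lcomb0.
- by move=> a u v Uu Uv; rewrite lcomb_lin; exact: UD.
exists (\rank M), (fun k => lcomb b (row k (row_base M))); split.
- exact: rank_leq_row.
- by move=> k; apply/MP; rewrite (submx_trans (row_sub _ _)) // eq_row_base.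
- move=> v U'v; have [a va] := spansP bU (sU _ U'v).
  have : (a <= row_base M)%MS by rewrite eq_row_base; apply/MP; rewrite -va.
  by case/submxP=> w aw; exists (w 0); rewrite va aw lcomb_mul.
- move=> rM v Uv; have [a ->] := spansP bU Uv; apply/MP.
  by apply: submx_full; rewrite /row_full rM.
Qed.

Definition peval x (p : {poly F}) : A := \sum_(i < size p) cst p`_i * x ^+ i.

Lemma peval_widen x (p : {poly F}) n : (size p <= n)%N ->
  peval x p = \sum_(i < n) cst p`_i * x ^+ i.
Proof.
move=> pn; rewrite /peval -(big_mkord xpredT (fun i => cst p`_i * x ^+ i)).
rewrite -(big_mkord xpredT (fun i => cst p`_i * x ^+ i)).
rewrite (big_cat_nat (n := size p) (p := n)) //= [X in _ + X]big1_seq ?addr0 // => i.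
rewrite mem_index_iota => /andP[_ /andP[pi _]].
by rewrite nth_default // rmorph0 mul0r.
Qed.

Lemma pevalD x (p q : {poly F}) : peval x (p + q) = peval x p + peval x q.
Proof.
have s := size_polyD p q; have [sp sq] := (leq_maxl (size p) (size q), leq_maxr (size p) (size q)).
rewrite (peval_widen _ s) (peval_widen _ sp) (peval_widen _ sq) -big_split /=.
by apply: eq_bigr => i _; rewrite coefD rmorphD mulrDl.
Qed.

Lemma pevalZ x c (p : {poly F}) : peval x (c *: p) = cst c * peval x p.
Proof.
rewrite (peval_widen _ (size_scale_leq c p)) mulr_sumr.
by apply: eq_bigr => i _; rewrite coefZ rmorphM mulrA.
Qed.

Lemma pevalMX x (p : {poly F}) : peval x (p * 'X) = peval x p * x.
Proof.
have s : (size (p * 'X)%R <= (size p).+1)%N.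
  by rewrite (leq_trans (size_polyMleq _ _)) // size_polyX addn2.
rewrite (peval_widen _ s) big_ord_recl coefMX /= rmorph0 mul0r add0r mulr_suml.
by apply: eq_bigr => i _; rewrite coefMX /= exprSr mulrA.
Qed.

Lemma peval_prod x (s : seq F) :
  peval x (\prod_(a <- s) ('X - a%:P)) = \prod_(a <- s) (x - cst a).
Proof.
elim: s => [|a s IH].
  by rewrite !big_nil /peval size_poly1 big_ord1 coef1 rmorph1 mul1r.
rewrite !big_cons mulrC mulrBr [_ * a%:P]mulrC mul_polyC -scaleNr.
rewrite pevalD pevalMX pevalZ IH rmorphN mulNr -mulrN !(mulrBl, mulrN).
congr (_ - _); elim: s {IH} => [|b s IH]; first by rewrite big_nil mul1r mulr1.
by rewrite big_cons -mulrA IH !mulrA mulrBl mulrBr cstC.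
Qed.

Lemma spans_annihilator n (b : 'I_n -> V) U x v :
    spans b U -> U v -> (forall u, U u -> U (x *: u)) ->
  exists2 p : {poly F}, p != 0 & peval x p *: v = 0.
Proof.
move=> bU Uv Ux.
have UX i : U (x ^+ i *: v).
  by elim: i => [|i IH]; rewrite ?scale1r // exprS -scalerA; exact: Ux.
have /choice[a aE] : forall i : 'I_n.+1, exists a, x ^+ i *: v = lcomb b a.
  by move=> i; exact: spansP bU (UX i).
pose M := \matrix_(i < n.+1) a i.
(* There are [n + 1] powers of [x] and only [n] coordinates, so the rows of [M] are linearly
   dependent; the dependency gives the coefficients of the polynomial. *)
have : (kermx M != 0).
  rewrite -mxrank_eq0 mxrank_ker subn_eq0 -ltnNge ltnS; exact: rank_leq_col.
case/rowV0Pn => w /sub_kermxP wM w0.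
exists (\poly_(i < n.+1) w 0 (inord i)).
  apply: contra w0 => /eqP p0; apply/eqP/rowP => i.
  have := congr1 (fun p : {poly F} => p`_i) p0.
  by rewrite coef_poly ltn_ord coef0 inord_val mxE.
rewrite (peval_widen _ (size_poly _ _)) scaler_suml.
rewrite -[RHS](lcomb0 b) -wM lcomb_mul; apply: eq_bigr => i _.
by rewrite coef_poly ltn_ord inord_val -scalerA aE rowK.
Qed.

(** Finitely many spanning vectors share one exponent, so [x] is nilpotent on all of [U], and a
    nilpotent operator is onto only on the zero space. It serves to show that the image of
    [h j - lam j] is a proper subspace. *)
Lemma nilp_image0 n (b : 'I_n -> V) U x : spans b U -> (forall k, U (b k)) ->
    (forall v, U v -> exists p, x ^+ p *: v = 0) ->
    (forall v, U v -> exists2 w, U w & v = x *: w) ->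
  forall v, U v -> v = 0.
Proof.
move=> bU Ub nilx imx v Uv.
have /choice[p pb] : forall k, exists p, x ^+ p *: b k = 0 by move=> k; exact: nilx.
have {}nilx u : U u -> x ^+ (\sum_k p k) *: u = 0.
  move=> /(spansP bU)[a ->]; rewrite scaler_sumr big1 // => k _.
  rewrite scalerA -cstC -scalerA (bigD1 k) //= addnC exprD -scalerA pb.
  by rewrite !scaler0.
have {}imx q : exists2 w, U w & v = x ^+ q *: w.
  elim: q => [|q [w Uw ->]]; first by exists v; rewrite ?scale1r.
  by have [w' Uw' ->] := imx w Uw; exists w'; rewrite // scalerA -exprSr.
by have [w Uw ->] := imx (\sum_k p k)%N; exact: nilx.
Qed.

End FiniteDimension.

(** * Decomposition of locally finite modules into joint generalized eigenspaces *)

Section LocallyFinite.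
Variables (F : closedFieldType) (A : pzRingType) (cst : {rmorphism F -> A}).
Hypothesis cstC : forall c x, cst c * x = x * cst c.
Variables (J : Type) (h : J -> A).
Hypothesis hC : forall j k, h j * h k = h k * h j.
Variable V : lmodType A.
Implicit Types (U : V -> Prop) (x : A).
Local Notation hpoly := (hpoly cst h).

Lemma hpoly_prod x (s : seq F) : hpoly x -> hpoly (\prod_(a <- s) (x - cst a)).
Proof.
move=> Hx; elim/big_rec: _ => [|a y _ Hy]; first exact: hpoly1.
by apply: hpolyM => //; apply: hpolyB => //; exact: hpoly_cst.
Qed.

(** Primary decomposition of [v]. The summands are recorded as polynomial multiples of [v] so that
    they stay in every [h]-stable subspace containing [v]. *)
Lemma prod_geig x (s : seq F) (v : V) :
    hpoly x -> (\prod_(a <- s) (x - cst a)) *: v = 0 ->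
  fsum (fun y => exists a, geig cst x a y /\ exists2 z, hpoly z & y = z *: v) v.
Proof.
move=> Hx; elim: s v => [|a s IH] v.
  by rewrite big_nil scale1r => ->; exact: fsum0.
have Hxa c : hpoly (x - cst c) by apply: hpolyB => //; exact: hpoly_cst.
rewrite big_cons (hpolyC cstC hC (Hxa _) (hpoly_prod _ Hx)) -scalerA => /IH Hw.
(* Decompose [(x - a) v]. On the summands with eigenvalue other than [a] the operator [x - a] is
   invertible, and [v'] collects the preimages; what remains of [(x - a)(v - v')] has eigenvalue
   [a], hence so does [v - v']. *)
suff [v' [Qv' [z Hz v'z] Gv']] : exists v', [/\
    fsum (fun y => exists a, geig cst x a y /\ exists2 z, hpoly z & y = z *: v) v',
    exists2 z, hpoly z & v' = z *: v
    & geig cst x a ((x - cst a) *: v - (x - cst a) *: v')].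
  rewrite -[v in X in _ X](subrK v'); apply: fsumS => //.
  exists a; split; last first.
    exists (1 - z); last by rewrite v'z scalerBl scale1r.
    by apply: hpolyB => //; exact: hpoly1.
  by have [p pv] := Gv'; exists p.+1; rewrite exprSr -scalerA scalerBr.
elim: (_ *: v) / Hw => [|y w [b [Gy [z Hz yz]]] _ [v' [Qv' [t Ht v't] Gv']]].
  exists 0; split; first exact: fsum0.
  - by exists 0; rewrite ?scale0r // -(rmorph0 cst); exact: hpoly_cst.
  - by rewrite scaler0 subr0; exact: geig0.
have [ba|ba] := eqVneq b a.
  exists v'; split=> //; first by exists t.
  by rewrite -addrA; apply: geigD => //; rewrite -ba.
have [r Hr ry] := geig_inv cstC hC Hx ba Gy.
exists (r *: y + v'); split.
- apply: fsumS => //; exists b; split; first exact: (geig_hpoly cstC hC).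
  exists (r * (z * (x - cst a))); last by rewrite -!scalerA -yz.
  by apply: hpolyM => //; exact: hpolyM.
- exists (r * (z * (x - cst a)) + t); last by rewrite scalerDl -!scalerA -yz v't.
  by apply: hpolyD => //; apply: hpolyM => //; exact: hpolyM.
- by rewrite scalerDr (hpolyCA cstC hC _ (Hxa a) Hr) ry opprD addrACA subrr add0r.
Qed.

Definition hstable U := forall j v, U v -> U (h j *: v).

Lemma hstable_hpoly U z v : subspace cst U -> hstable U -> hpoly z -> U v -> U (z *: v).
Proof.
move=> sU hU Hz; elim: Hz v => [c|j|x y _ IHx _ IHy|x y _ IHx _ IHy] v Uv.
- exact: subspaceZ.
- exact: hU.
- by rewrite scalerDl; apply: (subspaceD sU); [exact: IHx | exact: IHy].
- by rewrite -scalerA; apply: IHx; exact: IHy.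
Qed.

Definition locfin := forall v : V, exists U n (b : 'I_n -> V),
  [/\ subspace cst U, hstable U, spans cst b U & U v].

(** The family [h] may be infinite, so its members cannot be treated one after another; the
    induction is on dimension. Either each [h j] has a single generalized eigenvalue on [U], and
    these form [lam], or some [h j] splits [v] into vectors lying in proper stable subspaces. *)
Lemma spans_gsum n (b : 'I_n -> V) U v :
  subspace cst U -> hstable U -> spans cst b U -> U v ->
  gsum cst h (fun=> True) v.
Proof.
elim/ltn_ind: n => n IH in b U v *; move=> sU hU bU Uv.
have [single|] := pselect (forall j, exists a, forall u, U u -> geig cst (h j) a u).
  have /choice[lam lamP] := single.
  by apply: fsum1; exists lam => // j; exact: lamP.
move/existsNP => [j] /forallNP jP.
have [p p0 pv] := spans_annihilator bU Uv (hU j).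
have [s ps] := closed_field_poly_normal p.
have {pv} : (\prod_(a <- s) (h j - cst a)) *: v = 0.
  rewrite -peval_prod //; move: pv; rewrite ps pevalZ -scalerA.
  move=> /(congr1 (fun u => cst (lead_coef p)^-1 *: u)).
  by rewrite scaler0 scalerA -rmorphM mulVf ?lead_coef_eq0 // rmorph1 scale1r.
move/(prod_geig (hpoly_h _ _ j)); apply: fsum_bind => y [a [Gy [z Hz yz]]].
pose U' u := U u /\ geig cst (h j) a u.
have sU' : subspace cst U'.
  split; first by split; [case: sU | exact: geig0].
  move=> c u u' [Uu Gu] [Uu' Gu']; split; first by case: sU => _; exact.
  apply: geigD => //; apply: (geig_hpoly cstC hC) => //; [exact: hpoly_h | exact: hpoly_cst].
have [m [b' [mn b'U' bU' full]]] := spans_sub sU' (fun v => @proj1 _ _) bU.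
have {}mn : (m < n)%N.
  rewrite ltn_neqAle mn andbT; apply/eqP => /full U'E.
  by apply: (jP a) => u /U'E[].
apply: (IH m mn b' U') => //.
- move=> k u [Uu Gu]; split; first exact: hU.
  by apply: (geig_hpoly cstC hC) => //; exact: hpoly_h.
- by split=> //; rewrite yz; exact: hstable_hpoly.
Qed.

Lemma locfin_gsum : locfin -> forall v : V, gsum cst h (fun=> True) v.
Proof. by move=> lf v; have [U [n [b [sU hU bU Uv]]]] := lf v; exact: spans_gsum bU Uv. Qed.

End LocallyFinite.

(** * Components, true eigenvectors and projections *)

Section Components.
Variables (F : fieldType) (A : pzRingType) (cst : {rmorphism F -> A}).
Hypothesis cstC : forall c x, cst c * x = x * cst c.
Variables (J : Type) (h : J -> A).
Hypothesis hC : forall j k, h j * h k = h k * h j.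
Variable V : lmodType A.
Implicit Types (v w : V) (lam : J -> F) (S : (J -> F) -> Prop).
Local Notation hpoly := (hpoly cst h).
Local Notation gws := (gws cst h).
Local Notation gsum := (gsum cst h).

Lemma gsum_split S T v : gsum S v ->
  exists w, gsum (fun lam => S lam /\ T lam) w /\ gsum (fun lam => S lam /\ ~ T lam) (v - w).
Proof.
elim=> [|x y [lam Sl lx] _ [w [Tw Tyw]]].
  by exists 0; rewrite subr0; split; exact: fsum0.
have [Tl|Tl] := pselect (T lam).
- exists (x + w); rewrite opprD addrACA subrr add0r; split=> //.
  by apply: fsumS => //; exists lam.
- by exists w; rewrite -addrA; split=> //; apply: fsumS => //; exists lam.
Qed.

Lemma gsum_eq1 lam v : gsum (eq^~ lam) v -> gws lam v.
Proof. by elim=> [|x y [_ -> lx] _ ly]; [exact: gws0 | exact: gwsD]. Qed.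

(** If no such multiple existed, the eigenvalues of a decomposition of [v] could be discarded from
    its support one by one. With [L] the discarded ones, [v] would at the end be supported both in
    [L] and off [L], hence be zero. *)
Lemma gsum_component S v : gsum S v -> v <> 0 ->
  exists lam z, [/\ S lam, hpoly z, gws lam (z *: v) & z *: v <> 0].
Proof.
move=> Sv; apply: contra_notP => /forallNP N.
have {}N lam z : S lam -> hpoly z -> gws lam (z *: v) -> z *: v = 0.
  move=> Sl Hz lz; apply: contra_notP (N lam) => zv; by exists z.
suff [L Lv SLv] : exists2 L, gsum L v & gsum (fun lam => S lam /\ ~ L lam) v.
  by apply: (gsum_disjoint cstC hC _ SLv Lv) => lam [].
(* The induction runs over a decomposition of an independent vector [y], since [v] has to stay fixed
   in the second condition. *)
suff C : forall y : V, gsum S y -> exists2 L, gsum L y & gsum (fun lam => S lam /\ ~ L lam) v.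
  exact: C.
move=> y; elim=> [|x {}y [lam Sl lx] _ [L Ly SLv]].
  exists (fun=> False); first exact: fsum0.
  by apply: gsum_sub Sv => lam Sl; split.
exists (fun mu => L mu \/ mu = lam).
  apply: fsumD; first by apply: fsum1; exists lam => //; right.
  by apply: gsum_sub Ly; left.
have [w [lw lvw]] := gsum_split (eq^~ lam) SLv.
have [z [Hz zw zvw]] : exists z, [/\ hpoly z, z *: w = w & z *: (v - w) = 0].
  by apply: gsum_sep lw lvw => // mu [_ ->] [_].
have w0 : w = 0.
  have zvE : z *: v = w by rewrite -[v in LHS](subrK w) scalerDr zvw add0r.
  rewrite -zvE; apply: (N lam) => //; rewrite zvE.
  by apply: gsum_eq1; apply: gsum_sub lw => mu [].
move: lvw; rewrite w0 subr0; apply: gsum_sub => mu [[Sm Lm] ml]; split=> //.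
by case.
Qed.

(** For each listed [j] in turn, the last power of [h j - lam j] that does not kill the vector makes
    it a true eigenvector. A finite list is enough for applications, as each defining relation
    involves finitely many [h j]. *)
Lemma gws_eigenvector lam v (s : seq J) : gws lam v -> v <> 0 ->
  exists z, [/\ hpoly z, z *: v <> 0 &
    forall j, List.In j s -> h j *: (z *: v) = cst (lam j) *: (z *: v)].
Proof.
move=> lv v0; elim: s => [|j s [z [Hz zv zs]]].
  by exists 1; rewrite scale1r; split=> //; exact: hpoly1.
have : exists p, `[< (h j - cst (lam j)) ^+ p *: (z *: v) = 0 >].
  by have [p pE] := gws_hpoly cstC hC Hz lv j; exists p; apply/asboolP.
move/ex_minnP => [[|p] /asboolP pE pmin]; first by case: zv; rewrite -pE scale1r.
have Hp : hpoly ((h j - cst (lam j)) ^+ p) by apply: hpolyX; exact: hpolyBc.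
exists ((h j - cst (lam j)) ^+ p * z); rewrite -scalerA; split.
- exact: hpolyM.
- by move=> /asboolP /pmin; rewrite ltnn.
- move=> k [ <-|ks].
    by apply/eqP; rewrite -subr_eq0 -scalerBl scalerA -exprS pE.
  rewrite (hpolyCA cstC hC _ (hpoly_h _ _ k) Hp) zs // !scalerA.
  by rewrite (hpolyC cstC hC Hp (hpoly_cst _ _ _)).
Qed.

Lemma gws_zero lam v j : gws lam v -> v <> 0 -> h j = 0 -> lam j = 0.
Proof.
move=> lv v0 hj; have [z [_ zv0 /(_ j)]] := gws_eigenvector [:: j] lv v0.
move=> /(_ (or_introl erefl)); rewrite hj scale0r => /esym.
have [->//|lj0] := eqVneq (lam j) 0.
move=> /(congr1 (fun u => cst (lam j)^-1 *: u)).
by rewrite scaler0 scalerA -rmorphM mulVf // rmorph1 scale1r.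
Qed.

Section Projection.
Hypothesis total : forall v, gsum (fun=> True) v.
Variable S : (J -> F) -> Prop.
Local Notation S' := (fun lam => ~ S lam).

(** The projection onto the part supported in [S] along the part supported off [S]. By [gprojP] the
    default value [0] is never what defines it. *)
Definition gproj v := xget 0 [set w | gsum S w /\ gsum S' (v - w)]%classic.

Lemma gprojP v : gsum S (gproj v) /\ gsum S' (v - gproj v).
Proof.
apply: (@xgetPex _ 0 [set w | gsum S w /\ gsum S' (v - w)]%classic).
have [w [Sw S'w]] := gsum_split S (total v).
by exists w; split; [move: Sw | move: S'w]; apply: gsum_sub => lam [].
Qed.

Lemma gsumN T v : gsum T v -> gsum T (- v).
Proof.
rewrite -scaleN1r -(rmorphN1 cst); apply: gsum_hpoly => //; exact: hpoly_cst.
Qed.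

Lemma gproj_uniq v w : gsum S w -> gsum S' (v - w) -> gproj v = w.
Proof.
move=> Sw S'w; have [Sv S'v] := gprojP v.
apply/eqP; rewrite -subr_eq0; apply/eqP.
apply: (@gsum_disjoint _ _ _ cstC _ _ hC _ S S') => //.
- by move=> lam Sl; apply.
- by apply: fsumD => //; exact: gsumN.
- have -> : gproj v - w = (v - w) - (v - gproj v).
    by rewrite opprB [RHS]addrC addrA subrK.
  by apply: fsumD => //; exact: gsumN.
Qed.

Lemma gprojD v w : gproj (v + w) = gproj v + gproj w.
Proof.
have [[Sv S'v] [Sw S'w]] := (gprojP v, gprojP w).
apply: gproj_uniq; first exact: fsumD.
by rewrite opprD addrACA; exact: fsumD.
Qed.

Lemma gprojZ z v : hpoly z -> gproj (z *: v) = z *: gproj v.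
Proof.
move=> Hz; have [Sv S'v] := gprojP v.
apply: gproj_uniq; first exact: gsum_hpoly.
by rewrite -scalerBr; exact: gsum_hpoly.
Qed.

Lemma gsum_gproj0 v : gproj v = 0 -> gsum S' v.
Proof. by move=> v0; have [_] := gprojP v; rewrite v0 subr0. Qed.

End Projection.
End Components.

(** * The effect of raising and lowering operators on joint eigenvalues *)

Section Shift.
Variables (F : closedFieldType) (A : pzRingType) (cst : {rmorphism F -> A}).
Hypothesis cstC : forall c x, cst c * x = x * cst c.
Variables (I : Type) (h : I * int -> A).
Hypothesis hC : forall j k, h j * h k = h k * h j.
Local Notation hpoly := (hpoly cst h).

(** With [lam_i(u)] the sum of the [lam (i, p) u^{-p}], this reads [(u - a - d_i) lam'_i(u) = (u - a
    + d_i) lam_i(u)], with one [a] common to all [i]. *)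
Definition lstep (d : I -> F) (lam lam' : I * int -> F) := exists a, forall i p,
  lam' (i, p + 1) - (a + d i) * lam' (i, p) = lam (i, p + 1) - (a - d i) * lam (i, p).

Variables (x : nat -> A) (d : I -> F) (j0 : I) (p0 : int).
Hypothesis hx : forall i p q,
  (h (i, p + 1) * x q - x q * h (i, p + 1)) - (h (i, p) * x q.+1 - x q.+1 * h (i, p))
  = cst (d i) * (h (i, p) * x q + x q * h (i, p)).
Hypothesis h_top : h (j0, p0) = 1.
Hypothesis d_neq0 : d j0 *+ 2 != 0.

Let g := h (j0, p0 + 1 + 1).
Let k := h (j0, p0 + 1).
(** Write [d] for [d j0]. As [h (j0, p0) = 1], the relation at [p0] is [[k, x_r] = 2 d x_r];
    inserted in the relation at [p0 + 1] it gives [2 d x_{q+1} = (g - d k) x_q - x_q (g + d k)]. *)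
Let t := cst (d j0 *+ 2)^-1 * (g - cst (d j0) * k).
Let s := cst (d j0 *+ 2)^-1 * (g + cst (d j0) * k).

(* The relations with [h (j0, p0 + 1)] and [h (j0, p0 + 2)] make the index shift
   [x q |-> x q.+1] an inner operation. *)
Lemma shift_inner q : x q.+1 = t * x q - x q * s.
Proof.
have kx r : k * x r - x r * k = cst (d j0 *+ 2) * x r.
  have := hx j0 p0 r; rewrite h_top !mul1r !mulr1 subrr subr0 => ->.
  by rewrite -mulr2n mulrnAr -mulrnAl rmorphMn.
have := hx j0 (p0 + 1) q; rewrite -/k -/g kx => E.
have -> : x q.+1 = cst (d j0 *+ 2)^-1 * (cst (d j0 *+ 2) * x q.+1).
  by rewrite mulrA -rmorphM mulVf // rmorph1 mul1r.
rewrite -(subKr (g * x q - x q * g) (_ * x q.+1)) E /t /s.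
set e := cst _^-1; have xc c y : x q * (cst c * y) = cst c * (x q * y).
  by rewrite !mulrA -cstC.
rewrite xc -/e -[e * _ * x q]mulrA -mulrBr; congr (_ * _).
by rewrite mulrBl [x q * (g + _)]mulrDr xc [cst _ * (_ + _)]mulrDr -mulrA !opprD addrACA.
Qed.

Variable V : lmodType A.
Hypothesis V_locfin : locfin cst h V.
Implicit Types (u v : V) (lam : I * int -> F).

Let total v : gsum cst h (fun=> True) v := locfin_gsum cstC hC V_locfin v.

Lemma shift_hpolys : hpoly t /\ hpoly s.
Proof.
have Hgk e : hpoly (cst e * (g - cst (d j0) * k)) /\ hpoly (cst e * (g + cst (d j0) * k)).
  have Hg : hpoly g := hpoly_h _ _ _; have Hk : hpoly (cst (d j0) * k).
    by apply: hpolyM; [exact: hpoly_cst | exact: hpoly_h].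
  by split; (apply: hpolyM; first exact: hpoly_cst); [exact: hpolyB | exact: hpolyD].
by split; have [] := Hgk (d j0 *+ 2)^-1.
Qed.

(** The hypothesis on [x r *: (h j *: u)] says that [u] behaves as a true eigenvector once [P] is
    applied. On the target side, a further multiple of [z *: P (x q *: u)] is a true eigenvector, so
    the defining relation collapses to an identity between scalars. *)
Lemma lstep_of_proj lam (P : V -> V) u q :
    (forall v w, P (v + w) = P v + P w) ->
    (forall z v, hpoly z -> P (z *: v) = z *: P v) ->
    (forall j r, P (x r *: (h j *: u)) = cst (lam j) *: P (x r *: u)) ->
    P (x q *: u) <> 0 ->
  forall lam' z, hpoly z -> gws cst h lam' (z *: P (x q *: u)) ->
    z *: P (x q *: u) <> 0 -> lstep d lam lam'.
Proof.
move=> PD PZ Ph w0 lam' z Hz lz zw0.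
have PN v : P (- v) = - P v.
  by rewrite -scaleN1r -(rmorphN1 cst) (PZ _ _ (hpoly_cst _ _ _)) rmorphN1 scaleN1r.
have Pc c v : P (cst c *: v) = cst c *: P v by apply: PZ; exact: hpoly_cst.
have xc c r v : x r *: (cst c *: v) = cst c *: (x r *: v) by rewrite !scalerA cstC.
pose e := d j0 *+ 2.
pose lt (mu : I * int -> F) := e^-1 * (mu (j0, p0 + 1 + 1) - d j0 * mu (j0, p0 + 1)).
pose ls (mu : I * int -> F) := e^-1 * (mu (j0, p0 + 1 + 1) + d j0 * mu (j0, p0 + 1)).
have next : P (x q.+1 *: u) = t *: P (x q *: u) - cst (ls lam) *: P (x q *: u).
  rewrite shift_inner scalerBl PD PN -(scalerA t) -(scalerA _ s) (PZ t); last by case: shift_hpolys.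
  congr (_ - _); rewrite /s -scalerA scalerDl -scalerA /g /k xc scalerDr xc.
  by rewrite Pc PD Pc !Ph !scalerA -scalerDl scalerA /ls rmorphM rmorphD rmorphM.
(* The eigenvalue of [t] on the target minus that of [s] on the source. It is fixed before [i] and
   [p], while the eigenvector chosen next depends on them. *)
exists (lt lam' - ls lam) => i p.
have [r [Hr rz0 rE]] := gws_eigenvector cstC hC
  [:: (j0, p0 + 1 + 1); (j0, p0 + 1); (i, p + 1); (i, p)] lz zw0.
set y := r *: _ in rz0 rE.
pose Y v := r *: (z *: v).
have YD v w : Y (v + w) = Y v + Y w by rewrite /Y !scalerDr.
have YZ a v : hpoly a -> Y (a *: v) = a *: Y v.
  by move=> Ha; rewrite /Y (hpolyCA cstC hC _ Hz Ha) (hpolyCA cstC hC _ Hr Ha).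
have Yc c v : Y (cst c *: v) = cst c *: Y v by apply: YZ; exact: hpoly_cst.
have YN v : Y (- v) = - Y v by rewrite /Y !scalerN.
have Yq : Y (P (x q *: u)) = y by [].
have Yq1 : Y (P (x q.+1 *: u)) = cst (lt lam' - ls lam) *: y.
  rewrite next YD YN Yc YZ ?Yq; last by case: shift_hpolys.
  rewrite rmorphB scalerBl; congr (_ - _).
  rewrite /t -scalerA scalerBl -scalerA rE ?rE /=; [|by right; left|by left].
  by rewrite scalerA -scalerBl scalerA -rmorphM -rmorphB -rmorphM.
have E : h (i, p + 1) *: (x q *: u) - x q *: (h (i, p + 1) *: u)
    - (h (i, p) *: (x q.+1 *: u) - x q.+1 *: (h (i, p) *: u))
    = cst (d i) *: (h (i, p) *: (x q *: u) + x q *: (h (i, p) *: u)).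
  by rewrite !(scalerA, =^~ scalerBl, =^~ scalerDl) hx.
pose G v := Y (P v).
have GD v w : G (v + w) = G v + G w by rewrite /G PD YD.
have GN v : G (- v) = - G v by rewrite /G PN YN.
have Gc c v : G (cst c *: v) = cst c *: G v by rewrite /G Pc Yc.
have Gh j v : G (h j *: v) = h j *: G v.
  by rewrite /G PZ ?YZ //; exact: hpoly_h.
have Gx j r' : G (x r' *: (h j *: u)) = cst (lam j) *: G (x r' *: u) by rewrite /G Ph Yc.
have Gq : G (x q *: u) = y by [].
have Gq1 : G (x q.+1 *: u) = cst (lt lam' - ls lam) *: y by [].
have {E} := congr1 G E.
rewrite Gc !(GD, GN) !Gx !Gh Gq Gq1 (hpolyCA cstC hC y (hpoly_h _ _ (i, p)) (hpoly_cst _ _ _)).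
rewrite (rE (i, p + 1)) ?(rE (i, p)) /=; [|by right; right; right; left|by right; right; left].
have cM c e' : cst c *: (cst e' *: y) = cst (c * e') *: y by rewrite scalerA rmorphM.
have cD c e' : cst c *: y + cst e' *: y = cst (c + e') *: y by rewrite rmorphD scalerDl.
have cB c e' : cst c *: y - cst e' *: y = cst (c - e') *: y by rewrite rmorphB scalerBl.
rewrite !(cM, cD, cB) => /eqP; rewrite -subr_eq0 cB.
(* The relation now says that the scalar [c] kills the nonzero vector [y]; the equation [c = 0] is
   the recurrence sought. *)
set c := (X in cst X); have [c0 _|c0 /eqP] := eqVneq c 0; last first.
  move=> /(congr1 (fun u => cst c^-1 *: u)).
  by rewrite scaler0 scalerA -rmorphM mulVf // rmorph1 scale1r => /rz0.
apply/eqP; rewrite -subr_eq0; apply/eqP; rewrite -[RHS]c0 /c.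
ring.
Qed.

(** Here [P] projects onto the eigenvalues that are not reachable by a step. By induction on
    dimension it kills [x r] applied to the image of [h j - lam j], so modulo [P] every [u] is a
    true eigenvector, and a nonzero component of [P (x q *: u)] would be reachable after all. *)
Lemma shift_proj0 lam n (b : 'I_n -> V) U (P : V -> V) :
    subspace cst U -> hstable h U -> spans cst b U -> (forall u, U u -> gws cst h lam u) ->
    (forall v w, P (v + w) = P v + P w) ->
    (forall z v, hpoly z -> P (z *: v) = z *: P v) ->
    (forall v, gsum cst h (fun lam' => ~ lstep d lam lam') (P v)) ->
  forall u q, U u -> P (x q *: u) = 0.
Proof.
elim/ltn_ind: n => n IH in b U *; move=> sU hU bU Ul PD PZ Pn.
have P0 : P 0 = 0.
  by rewrite -[0 in LHS](scale0r 0) -(rmorph0 cst) (PZ _ _ (hpoly_cst _ _ _)) rmorph0 scale0r.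
have PN v : P (- v) = - P v.
  by rewrite -scaleN1r -(rmorphN1 cst) (PZ _ _ (hpoly_cst _ _ _)) rmorphN1 scaleN1r.
(* A spanning family inside [U], as [nilp_image0] requires; [b] itself may leave [U]. *)
have [m [b1 [mn Ub1 b1U _]]] := spans_sub sU (fun _ => id) bU.
have [U0|U0] := pselect (forall u, U u -> u = 0).
  by move=> u q /U0 ->; rewrite scaler0.
(* The image of the nilpotent operator [h j - lam j] is proper because [U] is nonzero, so the
   induction hypothesis applies to it. *)
have Pnil j r u : U u -> P (x r *: ((h j - cst (lam j)) *: u)) = 0.
  pose e := h j - cst (lam j); have He : hpoly e := hpolyBc _ _ _ _.
  have Ue u' : U u' -> U (e *: u') by exact: (hstable_hpoly sU hU He).
  pose U' u' := exists2 w, U w & u' = e *: w.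
  have sU' : subspace cst U'.
    split; first by exists 0; rewrite ?scaler0 //; case: sU.
    move=> c _ _ [w Uw ->] [w' Uw' ->]; exists (cst c *: w + w'); first by case: sU => _; exact.
    by rewrite scalerDr (hpolyCA cstC hC _ He (hpoly_cst _ _ _)).
  have U'U v : U' v -> U v by case=> w Uw ->; exact: Ue.
  have [l [b' [lm _ b'U' full]]] := spans_sub sU' U'U b1U.
  have [lmE|lmE] := eqVneq l m.
    case: U0 => u' Uu'; apply: (nilp_image0 cstC b1U Ub1 (x := e)) => // v Uv.
    - by have := Ul v Uv j.
    - exact: full.
  move=> Uu; apply: (IH l _ b' U') => //; last by exists u.
  - by rewrite (leq_trans _ mn) // ltn_neqAle lmE.
  - move=> j' _ [w Uw ->]; exists (h j' *: w); first exact: hU.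
    by rewrite (hpolyCA cstC hC _ (hpoly_h _ _ _) He).
  - by move=> v /U'U; exact: Ul.
move=> u q Uu; apply: contrapT => w0.
have Ph j r : P (x r *: (h j *: u)) = cst (lam j) *: P (x r *: u).
  apply/eqP; rewrite -subr_eq0; have := Pnil j r u Uu.
  rewrite scalerBl scalerBr PD PN => <-; apply/eqP; congr (_ - _).
  by rewrite -PZ ?scalerA ?cstC //; exact: hpoly_cst.
have [lam' [z [nl Hz lz zw0]]] := gsum_component cstC hC (Pn _) w0.
by apply: nl; apply: (lstep_of_proj PD PZ Ph w0 Hz).
Qed.

Lemma shift_gsum lam q u : gws cst h lam u -> gsum cst h (lstep d lam) (x q *: u).
Proof.
move=> lu; have [U [n [b [sU hU bU Uu]]]] := V_locfin u.
pose U' v := U v /\ gws cst h lam v.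
pose S lam' := ~ lstep d lam lam'.
have : gproj cst h S (x q *: u) = 0.
  apply: (@shift_proj0 lam n b U') => //.
  - split; first by split; [case: sU | exact: gws0].
    move=> c v w [Uv lv] [Uw lw]; split; first by case: sU => _; exact.
    by apply: gwsD => //; apply: gws_hpoly => //; exact: hpoly_cst.
  - by move=> j v [Uv lv]; split; [exact: hU | apply: gws_hpoly => //; exact: hpoly_h].
  - by move=> v [Uv _]; exact: bU.
  - by move=> v [].
  - exact: gprojD.
  - move=> z v; exact: gprojZ.
  - by move=> v; have [] := gprojP total S v.
move/(gsum_gproj0 total); apply: gsum_sub => lam'; exact: contrapT.
Qed.

End Shift.

(** * Shifted Yangians and category O *)

Section CartanMatrix.
Variables (R : realType) (D : lie_datum).

Let M : 'M[rat]_#|D| := \matrix_(a, b) (cartan (enum_val a) (enum_val b))%:~R.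

Lemma cartan_unit : M \in unitmx.
Proof.
rewrite -row_free_unit -kermx_eq0; apply: contraT => /rowV0Pn[u /sub_kermxP uM u0].
pose x : {ffun D -> rat} := [ffun i => u 0 (enum_rank i)].
have /cartan_posdef : x != 0.
  apply: contra u0 => /eqP x0; apply/eqP/rowP => a.
  by have := congr1 (fun y : {ffun D -> rat} => y (enum_val a)) x0; rewrite !ffunE enum_valK mxE.
rewrite exchange_big /= big1 ?ltxx // => j _; rewrite -mulr_suml.
suff -> : \sum_i x i * (cartan i j)%:~R = 0 by rewrite mul0r.
have := congr1 (fun w : 'rV_#|D| => w 0 (enum_rank j)) uM; rewrite !mxE => uMj; rewrite -[RHS]uMj.
rewrite [RHS](reindex _ (onW_bij _ (@enum_rank_bij D))) /=.
by apply: eq_bigr => i _; rewrite !mxE !ffunE !enum_rankK.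
Qed.

(** Positive definiteness makes the Cartan matrix invertible over the rationals, and invertibility
    survives the passage to [R[i]]. Thus weights correspond bijectively to tuples of eigenvalues of
    the [h_{i,1-mu_i}]. *)
Lemma coroot_pairing_bij (l : D -> R[i]) :
  exists2 w : weight R D, (forall i, coroot_pairing i w = l i) &
    forall w' : weight R D, (forall i, coroot_pairing i w' = l i) -> w' = w.
Proof.
pose N : 'M[R[i]]_#|D| := map_mx ratr M.
have NU : N \in unitmx by rewrite map_unitmx cartan_unit.
pose col_of (w : D -> R[i]) : 'cV[R[i]]_#|D| := \col_a w (enum_val a).
have NE (w : weight R D) : N *m col_of w = col_of (fun i => coroot_pairing i w).
  apply/matrixP => a b; rewrite !mxE /coroot_pairing.
  rewrite [LHS](reindex _ (onW_bij _ (@enum_rank_bij D))) /=.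
  by apply: eq_bigr => k _; rewrite !mxE ratr_int !enum_rankK.
pose w : weight R D := [ffun i => (invmx N *m col_of l) (enum_rank i) 0].
have wE : col_of w = invmx N *m col_of l.
  by apply/colP => a; rewrite mxE ffunE enum_valK.
exists w => [i|w' w'l].
  have := congr1 (fun v : 'cV_#|D| => v (enum_rank i) 0) (NE w).
  by rewrite wE mulKVmx // !mxE enum_rankK => <-.
have : col_of w' = col_of w.
  rewrite wE -[LHS](mulKmx NU) NE; congr (_ *m _); apply/colP => a.
  by rewrite !mxE w'l.
move=> w'w; apply/ffunP => i.
have := congr1 (fun v : 'cV_#|D| => v (enum_rank i) 0) w'w.
by rewrite !mxE enum_rankK.
Qed.

End CartanMatrix.

(** * Weight spaces and closure properties of category O *)

Section Yangian.
Variables (R : realType) (D : lie_datum) (mu : coweight D).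
Local Notation C := R[i].
Local Notation Y := (yangian R mu).

Definition ycst : {rmorphism C -> Y} := pres_cst (@yangian_rel R D mu).

Definition yh (ip : D * int) : Y := y_h R mu ip.1 ip.2.

Lemma ycstC c x : ycst c * x = x * ycst c.
Proof.
move: x; apply: pres_ind => x.
rewrite -[LHS](pres_piM _ (TCst c) x) -[RHS](pres_piM _ x (TCst c)).
exact/pres_piP/pres_cstC.
Qed.

Lemma yangian_ind (P : Y -> Prop) :
    (forall c, P (ycst c)) -> (forall g, P (y_gen R mu g)) ->
    (forall x y, P x -> P y -> P (x + y)) -> (forall x y, P x -> P y -> P (x * y)) ->
  forall x, P x.
Proof.
move=> Pc Pg PD PM; apply: pres_ind; elim=> [g|c|x Px y Py|x Px y Py].
- exact: Pg.
- exact: Pc.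
- by rewrite pres_piD; exact: PD.
- by rewrite pres_piM; exact: PM.
Qed.

Local Notation pi := (pres_pi (@yangian_rel R D mu)).

Lemma ypi_bracket x y : pi [< x, y >]%AT = pi x * pi y - pi y * pi x.
Proof.
rewrite pres_piD !pres_piM; congr (_ + _).
by rewrite -[pi (TCst _)]/(ycst (-1)) rmorphN1; exact: mulN1r.
Qed.

Lemma ypiB x y : pi (x - y)%AT = pi x - pi y.
Proof.
rewrite pres_piD pres_piM; congr (_ + _).
by rewrite -[pi (TCst _)]/(ycst (-1)) rmorphN1; exact: mulN1r.
Qed.

Lemma yrel_pi x y : yangian_rel mu x y -> pi x = pi y.
Proof. by move=> xy; apply/pres_piP/pres_rel. Qed.

Lemma yhC j k : yh j * yh k = yh k * yh j.
Proof.
have := yrel_pi (yrel_hh R mu j.1 k.1 j.2 k.2); rewrite ypi_bracket.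
by rewrite -[pi (TCst 0)]/(ycst 0) rmorph0 => /eqP; rewrite subr_eq0 => /eqP.
Qed.

Lemma yhe (j i : D) p q :
  (yh (i, p + 1) * y_e R mu j q - y_e R mu j q * yh (i, p + 1))
  - (yh (i, p) * y_e R mu j q.+1 - y_e R mu j q.+1 * yh (i, p))
  = ycst (cartan i j)%:~R * (yh (i, p) * y_e R mu j q + y_e R mu j q * yh (i, p)).
Proof.
have := yrel_pi (yrel_he R mu i j p q).
by rewrite ypiB !ypi_bracket pres_piM pres_piD !pres_piM.
Qed.

Lemma yhf (j i : D) p q :
  (yh (i, p + 1) * y_f R mu j q - y_f R mu j q * yh (i, p + 1))
  - (yh (i, p) * y_f R mu j q.+1 - y_f R mu j q.+1 * yh (i, p))
  = ycst (- (cartan i j))%:~R * (yh (i, p) * y_f R mu j q + y_f R mu j q * yh (i, p)).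
Proof.
have := yrel_pi (yrel_hf R mu i j p q).
by rewrite ypiB !ypi_bracket pres_piM pres_piD !pres_piM.
Qed.

Lemma yh_low i p : p < - mu i -> yh (i, p) = 0.
Proof. by move=> pmu; rewrite -(rmorph0 ycst); exact: yrel_pi (yrel_h0 R pmu). Qed.

Lemma yh_top i : yh (i, - mu i) = 1.
Proof. by rewrite -(rmorph1 ycst); exact: yrel_pi (yrel_h1 R mu i). Qed.

Definition yhw (i : D) : Y := yh (i, 1 - mu i).

Lemma yhwC i j : yhw i * yhw j = yhw j * yhw i. Proof. exact: yhC. Qed.

Definition weight_eig (w : weight R D) (i : D) : C := 2 * coroot_pairing i w.

Lemma weight_eig_bij (l : D -> C) : exists2 w, weight_eig w = l &
  forall w', weight_eig w' = l -> w' = w.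
Proof.
have n2 : (2 : C) != 0 by rewrite pnatr_eq0.
have [w wl w_uniq] := coroot_pairing_bij (fun i => 2^-1 * l i).
exists w => [|w' w'l].
  by apply/funext => i; rewrite /weight_eig wl mulVKf.
by apply: w_uniq => i; rewrite -w'l mulKf.
Qed.

Section Modules.
Implicit Types V W : lmodType Y.

Lemma weight_spaceP V w (v : V) : weight_space w v <-> gws ycst yhw (weight_eig w) v.
Proof.
split=> [[p pv] i|]; first by exists p; exact: pv.
(* A weight space asks for one exponent valid for all vertices; the sum dominates each of them. *)
move=> /choice[p pv]; exists (\sum_i p i)%N => i.
by apply: nilp_le (pv i) _; rewrite (bigD1 i) //= leq_addr.
Qed.

Lemma weight_decompositionP V :
  weight_decomposition V <-> forall v : V, gsum ycst yhw (fun=> True) v.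
Proof.
split=> [[dec _] v|tot].
  have [s [x [wx ->]]] := dec v; apply: fsum_big => w.
  by exists (weight_eig w) => //; apply/weight_spaceP.
split=> [v|s x us wx x0 w ws].
  elim: (tot v) => [|y {}v [l _ ly] _ [s [x [wx ->]]]].
    exists [::], (fun=> 0); split; last by rewrite big_nil.
    by move=> w; apply/weight_spaceP; exact: gws0.
  have [w wl _] := weight_eig_bij l.
  (* The list [s] may repeat weights. Multiplicities are moved into the vectors, so that the new
     summand [y] can be merged with the single existing one of weight [w]. *)
  have [t [ut xt]] : exists t, uniq t /\ \sum_(w <- s) x w = \sum_(w <- t) (x w *+ count_mem w s).
    exists (undup s); split; first exact: undup_uniq.
    by rewrite -big_undup_iterop_count.
  pose x' w := x w *+ count_mem w s.
  have wx' w' : weight_space w' (x' w').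
    apply/weight_spaceP; rewrite /x'; elim: count => [|n IH]; first exact: gws0.
    by rewrite mulrS; apply: gwsD => //; apply/weight_spaceP.
  exists (w :: rem w t), (fun w' => (if w' == w then y + (x' w *+ (w \in t)) else x' w')).
  split=> [w'|].
    case: eqP => [->|_] //; apply/weight_spaceP; apply: gwsD; first by rewrite wl.
    by case: (w \in t); [apply/weight_spaceP | exact: gws0].
  rewrite big_cons eqxx xt -addrA; congr (_ + _).
  have -> : \sum_(j <- rem w t) (if j == w then y + x' w *+ (w \in t) else x' j) =
    \sum_(j <- rem w t) x' j.
    rewrite rem_filter // [LHS]big_filter [RHS]big_filter; apply: eq_bigr => j /= /negPf.
    by move->.
  have [wt|wt] := boolP (w \in t); last by rewrite rem_id // add0r.
  by rewrite (big_rem w).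
(* Independence: some polynomial in the [h_{i,1-mu_i}] fixes the summand of weight [w] and kills all
   the others. *)
have [z [Hz zw z0]] : exists z, [/\ hpoly ycst yhw z, z *: x w = x w &
    z *: (\sum_(w' <- s | w' != w) x w') = 0].
  apply: (@gsum_sep _ _ ycst ycstC _ yhw yhwC _ (eq^~ (weight_eig w)) (fun l => l <> weight_eig w)).
  - by move=> l ->.
  - by apply: fsum1; exists (weight_eig w) => //; apply/weight_spaceP.
  - rewrite -big_filter big_seq; elim/big_rec: _ => [|w' y]; first exact: fsum0.
    rewrite mem_filter => /andP[w'w _] Sy; apply: fsumS => //.
    exists (weight_eig w'); last by apply/weight_spaceP.
    have [w1 _ w1U] := weight_eig_bij (weight_eig w).
    by move=> E; case/eqP: w'w; rewrite (w1U w) // (w1U w').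
by move: x0; rewrite (bigD1_seq w) //= => /(congr1 ( *:%R z)); rewrite scalerDr zw z0 addr0 scaler0.
Qed.

Lemma weight_space_subspace V w : subspace ycst (@weight_space R D mu V w).
Proof.
split; first by apply/weight_spaceP; exact: gws0.
move=> a u v /weight_spaceP wu /weight_spaceP wv; apply/weight_spaceP.
by apply: gwsD => //; apply: (gws_hpoly ycstC yhwC) => //; exact: hpoly_cst.
Qed.

Lemma weight_space_stable V w : hstable yh (@weight_space R D mu V w).
Proof.
move=> j v /weight_spaceP wv; apply/weight_spaceP => i.
apply: (geig_hpoly ycstC yhC); [exact: (hpoly_h _ _ (i, _)) | exact: hpoly_h | exact: wv].
Qed.

(** A vector lies in a finite sum of weight spaces; these are finite-dimensional and, by
    commutativity, stable under all [h_{i,p}]. *)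
Lemma in_O_locfin V : in_O V -> locfin ycst yh V.
Proof.
case=> /weight_decompositionP tot fd _ v.
elim: (tot v) => [|x {}v [l _ lx] _ [U [n [b [sU hU bU Uv]]]]].
  exists (fun v => v = 0), 0%N, (fun=> 0); split=> //.
  - by split=> // a u v0 -> ->; rewrite scaler0 addr0.
  - by move=> j u ->; rewrite scaler0.
  - by move=> u ->; exists (fun=> 0); rewrite big_ord0.
have [w wl _] := weight_eig_bij l.
have [m [c [_ cW]]] := fd w.
exists (fun v => exists u u', [/\ weight_space w u, U u' & v = u + u']).
exists (m + n)%N, (fun k => match split k with inl k => c k | inr k => b k end); split.
- split; first by exists 0, 0; rewrite addr0; split=> //; [case: (weight_space_subspace V w) | case: sU].
  move=> a _ _ [u [u' [wu Uu ->]]] [t [t' [wt Ut ->]]].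
  exists (ycst a *: u + t), (ycst a *: u' + t'); split.
  + by case: (weight_space_subspace V w) => _; exact.
  + by case: sU => _; exact.
  + by rewrite scalerDr addrACA.
- move=> j _ [u [u' [wu Uu ->]]]; exists (yh j *: u), (yh j *: u').
  by split; [exact: weight_space_stable | exact: hU | rewrite scalerDr].
- move=> _ [u [u' [wu Uu ->]]]; have [a ->] := cW _ wu; have [a' ->] := bU _ Uu.
  exists (fun k => match split k with inl k => a k | inr k => a' k end).
  rewrite big_split_ord; congr (_ + _); apply: eq_bigr => k _.
    by rewrite (unsplitK (inl k)).
  by rewrite (unsplitK (inr k)).
- by exists x, v; split=> //; apply/weight_spaceP; rewrite wl.
Qed.

(** Local finiteness passes to a submodule because finite-dimensional stable subspaces can be pulled
    back; the weight decomposition of [V] then follows from its own local finiteness. *)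
Lemma in_O_inj V W (f : {linear V -> W}) : injective f -> in_O W -> in_O V.
Proof.
move=> fI OW; have lfW := in_O_locfin OW; case: OW => totW fdW [s sW].
have f0 v : f v = 0 -> v = 0 by move=> fv; apply: fI; rewrite fv linear0.
have spans_inj (U : V -> Prop) (U' : W -> Prop) n (b' : 'I_n -> W) :
    subspace ycst U -> spans ycst b' U' -> (forall v, U v -> U' (f v)) ->
    exists m (b : 'I_m -> V), (forall k, U (b k)) /\ spans ycst b U.
  move=> sU b'U' UU'; pose U1 w := exists2 v, U v & w = f v.
  have sU1 : subspace ycst U1.
    split; first by exists 0; rewrite ?linear0 //; case: sU.
    move=> a _ _ [u Uu ->] [v Uv ->]; exists (ycst a *: u + v); last by rewrite linearP.
    by case: sU => _; exact.
  have U1U' w : U1 w -> U' w by case=> v Uv ->; exact: UU'.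
  have [m [b1 [_ U1b1 b1U1 _]]] := spans_sub sU1 U1U' b'U'.
  have /choice[b bE] : forall k, exists v, U v /\ b1 k = f v.
    by move=> k; have [v] := U1b1 k; exists v.
  exists m, b; split=> [k|v Uv]; first by case: (bE k).
  have [|a aE] := b1U1 (f v); first by exists v.
  exists a; apply: fI; rewrite aE linear_sum; apply: eq_bigr => k _.
  by rewrite linearZ (proj2 (bE k)).
have lfV : locfin ycst yh V.
  move=> v; have [U [n [b [sU hU bU Uv]]]] := lfW (f v).
  have sU' : subspace ycst (fun v => U (f v)).
    split; first by rewrite linear0; case: sU.
    by move=> a u u'; rewrite linearP; case: sU => _ UD; exact: UD.
  have [m [b' [_ b'U]]] := spans_inj _ _ _ _ sU' bU (fun _ => id).
  exists (fun v => U (f v)), m, b'; split=> // j u; rewrite linearZ; exact: hU.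
split.
- apply/weight_decompositionP => v.
  apply: (locfin_gsum ycstC yhwC) => u; have [U [n [b [sU hU bU Uu]]]] := lfV u.
  by exists U, n, b; split=> // i u' Uu'; exact: hU.
- move=> w; have [n [b [_ bW]]] := fdW w.
  have [|m [b' [Ub' b'U]]] := spans_inj _ _ _ _ (weight_space_subspace V w) bW.
    move=> v /weight_spaceP wv; apply/weight_spaceP; exact: gws_lin.
  by exists m, b'.
- exists s => w v /weight_spaceP wv v0; apply: (sW w (f v)) => [|/f0//].
  by apply/weight_spaceP; exact: gws_lin.
Qed.

Lemma in_O_surj V W (f : {linear V -> W}) : (forall y, exists x, f x = y) -> in_O V -> in_O W.
Proof.
move=> fS [/weight_decompositionP tot fd [s sV]].
(* Keep only the component of weight [w] of a preimage: the image of the rest is both of weight [w]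
   and a sum of other weights, hence zero. *)
have lift w y : weight_space w y -> exists2 x, weight_space w x & f x = y.
  move=> /weight_spaceP wy; have [v vy] := fS y.
  have [x [wx wvx]] := gsum_split (eq^~ (weight_eig w)) (tot v).
  have {}wx : gws ycst yhw (weight_eig w) x.
    by apply: gsum_eq1; apply: gsum_sub wx => l [].
  exists x; first exact/weight_spaceP.
  apply/eqP; rewrite eq_sym -subr_eq0 -vy -linearB; apply/eqP.
  apply: (@gsum_disjoint _ _ ycst ycstC _ yhw yhwC _ (eq^~ (weight_eig w))
            (fun l => l <> weight_eig w)).
  - by move=> l ->.
  - apply: fsum1; exists (weight_eig w) => //; rewrite linearB vy.
    apply: gwsD => //; rewrite -scaleN1r -(rmorphN1 ycst).
    by apply: (gws_hpoly ycstC yhwC); [exact: hpoly_cst | exact: gws_lin].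
  - by apply: gsum_lin; apply: gsum_sub wvx => l [].
split.
- apply/weight_decompositionP => y; have [v <-] := fS y; exact: gsum_lin.
- move=> w; have [n [b [wb bW]]] := fd w; exists n, (f \o b); split=> [k|y /lift[x wx <-]].
    by apply/weight_spaceP; apply: gws_lin; apply/weight_spaceP; exact: wb.
  have [a ->] := bW x wx; exists a; rewrite linear_sum; apply: eq_bigr => k _.
  by rewrite linearZ.
- exists s => w y /lift[x wx <-] fx0; apply: (sV w x) => // x0; apply: fx0.
  by rewrite x0 linear0.
Qed.

Lemma in_O_trivial V : (forall v : V, v = 0) -> in_O V.
Proof.
move=> V0; split.
- by apply/weight_decompositionP => v; rewrite (V0 v); exact: fsum0.
- move=> w; exists 0%N, (fun=> 0); split=> [k|v _]; first by case: k.
  by exists (fun=> 0); rewrite big_ord0.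
- by exists [::] => w v _ []; exact: V0.
Qed.

Lemma in_O_biproduct V W (X : lmodType Y) (i : {linear V -> X}) (j : {linear W -> X})
    (p : {linear X -> V}) (q : {linear X -> W}) :
  (forall x, i (p x) + j (q x) = x) -> in_O V -> in_O W -> in_O X.
Proof.
move=> ipjq [/weight_decompositionP totV fdV [sV V_le]] [/weight_decompositionP totW fdW [sW W_le]].
split.
- apply/weight_decompositionP => x; rewrite -(ipjq x).
  by apply: fsumD; exact: gsum_lin.
- move=> w; have [n [b [wb bV]]] := fdV w; have [m [c [wc cW]]] := fdW w.
  exists (n + m)%N, (fun k => match split k with inl k => i (b k) | inr k => j (c k) end).
  split=> [k|x /weight_spaceP wx].
    by apply/weight_spaceP; case: split => k'; apply: gws_lin; apply/weight_spaceP.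
  have [a aE] : exists a, p x = \sum_k y_cst mu (a k) *: b k.
    by apply: bV; apply/weight_spaceP; exact: gws_lin.
  have [e eE] : exists a, q x = \sum_k y_cst mu (a k) *: c k.
    by apply: cW; apply/weight_spaceP; exact: gws_lin.
  exists (fun k => match split k with inl k => a k | inr k => e k end).
  rewrite -[LHS]ipjq aE eE !linear_sum big_split_ord.
  congr (_ + _); apply: eq_bigr => k _; rewrite linearZ /=.
    by rewrite (unsplitK (inl k)).
  by rewrite (unsplitK (inr k)).
- exists (sV ++ sW) => w x /weight_spaceP wx x0.
  have [px0|px0] := pselect (p x = 0); last first.
    have [|w' w's w'w] := V_le w _ _ px0; first by apply/weight_spaceP; exact: gws_lin.
    by exists w'; rewrite // mem_cat w's.
  have qx0 : q x <> 0 by move=> qx0; apply: x0; rewrite -(ipjq x) px0 qx0 !linear0 addr0.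
  have [|w' w's w'w] := W_le w _ _ qx0; first by apply/weight_spaceP; exact: gws_lin.
  by exists w'; rewrite // mem_cat w's orbT.
Qed.

End Modules.
End Yangian.

(** * Sets of eigenvalues that cut out submodules *)

Section Saturated.
Variables (R : realType) (D : lie_datum).
Local Notation C := R[i].
Implicit Types (lam : D * int -> C) (S : (D * int -> C) -> Prop).

Definition bounded_below lam := forall i, exists n0, forall p, p < n0 -> lam (i, p) = 0.

(** Restricting to series bounded below matters: a step multiplies such a series by a rational
    function, whereas in general the recurrence has extra geometric solutions. Eigenvalues on
    nonzero vectors are bounded below since [h_{i,p} = 0] for [p < - mu i]. *)
Definition saturated S := forall j lam lam', bounded_below lam -> bounded_below lam' ->
  lstep (fun i => (cartan i j)%:~R) lam lam' -> (S lam <-> S lam').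

Lemma lstep_opp (d : D -> C) lam lam' : lstep (fun i => - d i) lam lam' -> lstep d lam' lam.
Proof. by move=> [a st]; exists a => i p; rewrite st opprK. Qed.

Section Module.
Variables (mu : coweight D) (V : lmodType (yangian R mu)).
Hypothesis OV : in_O V.
Local Notation gsum := (gsum (ycst R mu) (@yh R D mu)).

Lemma in_O_total (v : V) : gsum (fun=> True) v.
Proof. exact (locfin_gsum (@ycstC _ _ _) (@yhC _ _ _) (in_O_locfin OV) v). Qed.

Lemma gws_bounded lam (v : V) : gws (ycst R mu) (@yh R D mu) lam v -> v <> 0 -> bounded_below lam.
Proof.
move=> lv v0 i; exists (- mu i) => p pmu.
by apply: (gws_zero (@ycstC _ _ _) (@yhC _ _ _) lv v0); exact: yh_low.
Qed.

Lemma gsum_bounded S (v : V) : gsum S v -> gsum (fun lam => S lam /\ bounded_below lam) v.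
Proof.
apply: fsum_bind => x [lam Sl lx]; have [->|/eqP x0] := eqVneq x 0; first exact: fsum0.
by apply: fsum1; exists lam => //; split=> //; exact: gws_bounded x0.
Qed.

(** Only generators need attention. The [e] generators perform steps; the [f] generators satisfy the
    relation with the opposite sign and perform steps backwards, which is why [saturated] is an
    equivalence. *)
Lemma gsum_yangian S a (v : V) : saturated S -> gsum S v -> gsum S (a *: v).
Proof.
move=> satS; elim/yangian_ind: a v => [c|g|x y IHx IHy|x y IHx IHy] v Sv.
- by apply: gsum_hpoly => //; [exact: ycstC | exact: yhC | exact: hpoly_cst].
- have shift (x : nat -> yangian R mu) (d : D -> C) j q :
      (forall lam lam', bounded_below lam -> bounded_below lam' -> S lam ->
         lstep d lam lam' -> S lam') ->
      (forall i p q, (yh R mu (i, p + 1) * x q - x q * yh R mu (i, p + 1))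
         - (yh R mu (i, p) * x q.+1 - x q.+1 * yh R mu (i, p))
         = ycst R mu (d i) * (yh R mu (i, p) * x q + x q * yh R mu (i, p))) ->
      d j *+ 2 != 0 -> gsum S (x q *: v).
    move=> stS rel dj.
    apply: (fsum_map (f := ( *:%R (x q)))) (gsum_bounded Sv) => u [lam [Sl bl] lu].
    apply: gsum_sub (gsum_bounded (shift_gsum (@ycstC _ _ _) (@yhC _ _ _) rel (yh_top R mu j) dj (in_O_locfin OV) q lu)).
    by move=> lam' [st bl']; exact: stS st.
  have cjj j : (cartan j j)%:~R *+ 2 != 0 :> C.
    by rewrite /cartan eqxx mulrn_eq0 intr_eq0.
  case: g => [j q|j q|i p].
  + apply: (shift (y_e R mu j) (fun i => (cartan i j)%:~R) j q) => //; last exact: yhe.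
    by move=> lam lam' bl bl' Sl st; apply/(satS _ _ _ bl bl' st).
  + apply: (shift (y_f R mu j) (fun i => - (cartan i j)%:~R) j q).
    * by move=> lam lam' bl bl' Sl /lstep_opp st; apply/(satS _ _ _ bl' bl st).
    * by move=> i p r; rewrite -rmorphN; exact: yhf.
    * by rewrite mulNrn oppr_eq0.
  + apply: (gsum_hpoly (@ycstC _ _ _) (@yhC _ _ _) _ Sv); exact: (hpoly_h _ _ (i, p)).
- by rewrite scalerDl; apply: fsumD; [exact: IHx | exact: IHy].
- by rewrite -scalerA; apply: IHx; exact: IHy.
Qed.

End Module.

Section Support.
Variables (mu : coweight D).
Implicit Types V W X : lmodType (yangian R mu).
Local Notation gsum := (gsum (ycst R mu) (@yh R D mu)).

Definition supported S V := forall v : V, gsum S v.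

Lemma gsum_disj S S' V (v : V) : (forall lam, S lam -> ~ S' lam) -> gsum S v -> gsum S' v -> v = 0.
Proof. by apply: gsum_disjoint; [exact: ycstC | exact: yhC]. Qed.

Lemma supported_split S V (v : V) : in_O V ->
  exists a r, [/\ gsum S a, gsum (fun lam => ~ S lam) r & v = a + r].
Proof.
move=> OV; have [a [Sa Sva]] := gsum_split S (in_O_total OV v).
exists a, (v - a); split; last by rewrite addrC subrK.
  by apply: gsum_sub Sa => lam [].
by apply: gsum_sub Sva => lam [].
Qed.

Lemma supported_inj S V W (f : {linear V -> W}) :
  injective f -> in_O V -> supported S W -> supported S V.
Proof.
move=> fI OV SW v; have [a [r [Sa Sr ->]]] := supported_split S v OV.
suff -> : r = 0 by rewrite addr0.
apply: fI; rewrite linear0; apply: (gsum_disj (S := S) (S' := fun lam => ~ S lam)) => //.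
  by move=> lam Sl; apply.
exact: gsum_lin.
Qed.

Lemma supported_surj S V W (f : {linear V -> W}) :
  (forall y, exists x, f x = y) -> supported S V -> supported S W.
Proof. by move=> fS SV y; have [x <-] := fS y; exact: gsum_lin. Qed.

(** The part of [w] off [S] dies in [X], hence comes from [V], where everything is supported in
    [S]. *)
Lemma supported_ext S V W X (f : {linear V -> W}) (g : {linear W -> X}) :
  (forall y, g y = 0 -> exists x, f x = y) -> in_O W ->
  supported S V -> supported S X -> supported S W.
Proof.
move=> fg OW SV SX w; have [a [r [Sa Sr ->]]] := supported_split S w OW.
have /fg[x xr] : g r = 0.
  apply: (gsum_disj (S := S) (S' := fun lam => ~ S lam)) => //; last exact: gsum_lin.
  by move=> lam Sl; apply.
by apply: fsumD => //; rewrite -xr; exact: gsum_lin.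
Qed.

End Support.
End Saturated.

(** * Categories of families of modules *)

Lemma dependent_choice (I : Type) (B : I -> Type) (Q : forall i, B i -> Prop) :
  (forall i, exists b, Q i b) -> exists f : forall i, B i, forall i, Q i (f i).
Proof. by move=> BQ; exists (fun i => sval (cid (BQ i))) => i; case: cid. Qed.

Section LinearFactor.
Variable A : pzRingType.
Implicit Types V W X : lmodType A.

Definition submodule V (U : V -> Prop) :=
  U 0 /\ forall a u v, U u -> U v -> U (a *: u + v).

Lemma linear_of_fun V W (f : V -> W) :
  (forall a u v, f (a *: u + v) = a *: f u + f v) ->
  exists g : {linear V -> W}, forall v, g v = f v.
Proof.
move=> fl; pose B := GRing.isLinear.Build A V W *:%R f fl.
by exists (HB.pack_for {linear V -> W} f B).
Qed.

Lemma linear_factor_inj V W X (f : {linear V -> W}) (g : {linear X -> W}) :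
  injective f -> (forall x, exists v, f v = g x) ->
  exists h : {linear X -> V}, forall x, f (h x) = g x.
Proof.
move=> fI /choice[h fh]; have [|h' h'E] := @linear_of_fun X V h.
  by move=> a u v; apply: fI; rewrite linearP !fh linearP.
by exists h' => x; rewrite h'E.
Qed.

Lemma linear_factor_surj V W X (f : {linear V -> W}) (g : {linear V -> X}) :
  (forall w, exists v, f v = w) -> (forall v, f v = 0 -> g v = 0) ->
  exists h : {linear W -> X}, forall v, h (f v) = g v.
Proof.
move=> /choice[s fs] fg.
have gE u v : f u = f v -> g u = g v.
  move=> /eqP; rewrite -subr_eq0 -linearB => /eqP/fg/eqP.
  by rewrite linearB subr_eq0 => /eqP.
have [|h hE] := @linear_of_fun W X (g \o s).
  by move=> a u v; rewrite /= -linearP; apply: gE; rewrite linearP !fs.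
by exists h => v; rewrite hE; apply: gE; rewrite fs.
Qed.

End LinearFactor.

(** * Categorical notions read off from elements *)

Section Realization.
Variables (K : Type) (A : K -> pzRingType).

(* A fully faithful functor to families of modules, which allows to work with
   elements. *)
Record realization (C : category) := Realization {
  car : C -> forall k, lmodType (A k);
  act : forall X Y : C, hom X Y -> forall k, {linear car X k -> car Y k};
  act_inj : forall X Y (f g : hom X Y), (forall k x, act f k x = act g k x) -> f = g;
  act_surj : forall X Y (f : forall k, {linear car X k -> car Y k}),
    exists g : hom X Y, forall k x, act g k x = f k x;
  act_id : forall X k x, act (idc X) k x = x;
  act_comp : forall X Y Z (g : hom Y Z) (f : hom X Y) k x,
    act (g \oc f) k x = act g k (act f k x) }.

Section Elements.
Variables (C : category) (T : realization C).
Implicit Types X Y Z : C.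

Definition trivial X := forall k (x : car T X k), x = 0.
Definition hom_inj X Y (f : hom X Y) := forall k, injective (act T f k).
Definition hom_surj X Y (f : hom X Y) := forall k y, exists x, act T f k x = y.
Definition hom_zero X Y (f : hom X Y) := forall k x, act T f k x = 0.
Definition hom_exact X Y Z (f : hom X Y) (g : hom Y Z) :=
  forall k y, act T g k y = 0 <-> exists x, act T f k x = y.

(* The essential image of the functor is closed under submodules, quotients and
   finite direct sums. *)
Record thick := Thick {
  thick_zero : exists Z, trivial Z;
  thick_sub : forall X (U : forall k, car T X k -> Prop), (forall k, submodule (U k)) ->
    exists Y (f : hom Y X), hom_inj f /\ forall k x, U k x <-> exists y, act T f k y = x;
  thick_quot : forall X (U : forall k, car T X k -> Prop), (forall k, submodule (U k)) ->
    exists Y (f : hom X Y), hom_surj f /\ forall k x, U k x <-> act T f k x = 0;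
  thick_prod : forall X Y, exists Z (i : hom X Z) (j : hom Y Z) (p : hom Z X) (q : hom Z Y),
    [/\ p \oc i = idc X, q \oc j = idc Y, hom_zero (q \oc i), hom_zero (p \oc j)
      & forall k z, act T i k (act T p k z) + act T j k (act T q k z) = z] }.

Lemma hom_inj0 X Y (f : hom X Y) : (forall k x, act T f k x = 0 -> x = 0) -> hom_inj f.
Proof.
move=> f0 k x y /eqP; rewrite -subr_eq0 -linearB => /eqP/f0/eqP.
by rewrite subr_eq0 => /eqP.
Qed.

Lemma factor_inj X Y Z (f : hom Y X) (g : hom Z X) :
  hom_inj f -> (forall k z, exists y, act T f k y = act T g k z) ->
  exists h : hom Z Y, f \oc h = g.
Proof.
move=> fI fg.
have /dependent_choice[h fh] : forall k, exists h : {linear car T Z k -> car T Y k},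
    forall z, act T f k (h z) = act T g k z.
  by move=> k; apply: linear_factor_inj; [exact: fI | exact: fg].
have [h' h'E] := act_surj h.
by exists h'; apply: (act_inj (r := T)) => k z; rewrite act_comp h'E fh.
Qed.

Lemma factor_surj X Y Z (f : hom X Y) (g : hom X Z) :
  hom_surj f -> (forall k x, act T f k x = 0 -> act T g k x = 0) ->
  exists h : hom Y Z, h \oc f = g.
Proof.
move=> fS fg.
have /dependent_choice[h fh] : forall k, exists h : {linear car T Y k -> car T Z k},
    forall x, h (act T f k x) = act T g k x.
  by move=> k; apply: linear_factor_surj; [exact: fS | exact: fg].
have [h' h'E] := act_surj h.
by exists h'; apply: (act_inj (r := T)) => k z; rewrite act_comp h'E fh.
Qed.

Lemma hom_inj_mono X Y Z (f : hom Y X) (g h : hom Z Y) :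
  hom_inj f -> f \oc g = f \oc h -> g = h.
Proof.
move=> fI fgh; apply: (act_inj (r := T)) => k z; apply: fI.
by rewrite -!act_comp fgh.
Qed.

Lemma hom_surj_epi X Y Z (f : hom X Y) (g h : hom Y Z) :
  hom_surj f -> g \oc f = h \oc f -> g = h.
Proof.
move=> fS gfh; apply: (act_inj (r := T)) => k y; have [x <-] := fS k y.
by rewrite -!act_comp gfh.
Qed.

Lemma zero_hom_ex X Y : exists f : hom X Y, hom_zero f.
Proof.
have [f fE] := act_surj (r := T) (fun k => \0 : {linear car T X k -> car T Y k}).
by exists f => k x; rewrite fE.
Qed.

Lemma zero_objectP X : zero_object X <-> trivial X.
Proof.
split=> [/(_ X)[[i [_ iU]] _] k x|X0 Y].
  have [z z0] := zero_hom_ex X X.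
  by rewrite -[LHS](act_id (r := T)) -(iU (idc X) I) (iU z I) z0.
have [[f f0] [g g0]] := (zero_hom_ex Y X, zero_hom_ex X Y).
split; [exists f | exists g]; split=> // f' _; apply: (act_inj (r := T)) => k x.
  by rewrite f0 [RHS]X0.
by rewrite (X0 _ x) !linear0.
Qed.

Lemma hom_iso X Y (f : hom X Y) : hom_inj f -> hom_surj f ->
  exists g : hom Y X, g \oc f = idc X /\ f \oc g = idc Y.
Proof.
move=> fI fS; have [|g fg] := factor_inj (g := idc Y) fI.
  by move=> k z; exact: fS.
exists g; split=> //; apply: (hom_inj_mono fI).
by rewrite compA fg comp1l comp1r.
Qed.

Lemma isomorphismP X Y (f : hom X Y) : isomorphism f <-> hom_inj f /\ hom_surj f.
Proof.
split=> [[g [gf fg]]|[]]; last exact: hom_iso.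
split=> [k x y fxy|k y].
  by rewrite -[x](act_id (r := T)) -[y](act_id (r := T)) -gf !act_comp fxy.
by exists (act T g k y); rewrite -act_comp fg act_id.
Qed.

Lemma submodule_ker X Y (f : hom X Y) k : submodule (fun x => act T f k x = 0).
Proof. by split=> [|a u v u0 v0]; rewrite ?linear0 // linearP u0 v0 scaler0 addr0. Qed.

Lemma submodule_im X Y (f : hom X Y) k : submodule (fun y => exists x, act T f k x = y).
Proof.
split=> [|a _ _ [u <-] [v <-]]; first by exists 0; rewrite linear0.
by exists (a *: u + v); rewrite linearP.
Qed.

Lemma submodule_preim X Y (f : hom X Y) k (U : car T Y k -> Prop) :
  submodule U -> submodule (fun x => U (act T f k x)).
Proof. by case=> U0 UD; split=> [|a u v Uu Uv]; rewrite ?linear0 // linearP; exact: UD. Qed.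

Section ThickTheory.
Hypothesis thT : thick.

Lemma zero_morphismP X Y (f : hom X Y) : zero_morphism f <-> hom_zero f.
Proof.
split=> [[Z [g [h [/zero_objectP Z0 ->]]]] k x|f0].
  by rewrite act_comp (Z0 k (act T g k x)) linear0.
have [Z Z0] := thick_zero thT.
have [[g g0] [h h0]] := (zero_hom_ex X Z, zero_hom_ex Z Y).
exists Z, g, h; split; first exact/zero_objectP.
by apply: (act_inj (r := T)) => k x; rewrite act_comp f0 h0.
Qed.

(** Thickness turns the kernel into an object; a monomorphism cannot distinguish its inclusion from
    the zero morphism. *)
Lemma monomorphismP X Y (f : hom X Y) : monomorphism f <-> hom_inj f.
Proof.
split=> [fM|fI Z g h]; last exact: hom_inj_mono.
have [Z [i [iI iP]]] := thick_sub thT (submodule_ker f).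
have [z z0] := zero_hom_ex Z X.
have iz : i = z.
  apply: fM; apply: (act_inj (r := T)) => k x; rewrite !act_comp z0 linear0.
  by apply/iP; exists x.
by apply: hom_inj0 => k x /iP[y <-]; rewrite iz z0.
Qed.

Lemma epimorphismP X Y (f : hom X Y) : epimorphism f <-> hom_surj f.
Proof.
split=> [fE|fS Z g h]; last exact: hom_surj_epi.
have [Z [p [pS pP]]] := thick_quot thT (submodule_im f).
have [z z0] := zero_hom_ex Y Z.
have pz : p = z.
  apply: fE; apply: (act_inj (r := T)) => k x; rewrite !act_comp z0.
  by apply/pP; exists x.
by move=> k y; apply/pP; rewrite pz z0.
Qed.

Lemma is_kernelP X Y (f : hom X Y) Z (i : hom Z X) :
  is_kernel f i <-> hom_inj i /\ hom_exact i f.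
Proof.
split=> [[/zero_morphismP fi0 iU]|[iI ifE]].
  have iI : hom_inj i.
    apply/monomorphismP => W g h igh.
    have : zero_morphism (f \oc (i \oc h)).
      by apply/zero_morphismP => k x; rewrite compA act_comp fi0.
    by move=> /iU[u [_ uU]]; rewrite -(uU g igh) (uU h erefl).
  split=> // k y; split=> [fy|[x <-]]; last by rewrite -act_comp fi0.
  have [W [j [jI jP]]] := thick_sub thT (submodule_ker f).
  have /iU[h [ih _]] : zero_morphism (f \oc j).
    by apply/zero_morphismP => k' x; rewrite act_comp; apply/jP; exists x.
  by case/jP: fy => x <-; exists (act T h k x); rewrite -act_comp ih.
split.
  by apply/zero_morphismP => k x; rewrite act_comp; apply/ifE; exists x.
move=> W g /zero_morphismP fg.
have [|h ih] := factor_inj (g := g) iI.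
  by move=> k z; apply/ifE; rewrite -act_comp fg.
by exists h; split=> // h' ih'; apply: (hom_inj_mono iI); rewrite ih.
Qed.

Lemma is_cokernelP X Y (f : hom X Y) Z (p : hom Y Z) :
  is_cokernel f p <-> hom_surj p /\ hom_exact f p.
Proof.
split=> [[/zero_morphismP pf0 pU]|[pS fpE]].
  have pS : hom_surj p.
    apply/epimorphismP => W g h gph.
    have : zero_morphism ((h \oc p) \oc f).
      by apply/zero_morphismP => k x; rewrite -compA act_comp pf0 linear0.
    by move=> /pU[u [_ uU]]; rewrite -(uU g gph) (uU h erefl).
  split=> // k y; split=> [py|[x <-]]; last by rewrite -act_comp pf0.
  have [W [q [qS qP]]] := thick_quot thT (submodule_im f).
  have /pU[h [hp _]] : zero_morphism (q \oc f).
    by apply/zero_morphismP => k' x; rewrite act_comp; apply/qP; exists x.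
  by apply/qP; rewrite -hp act_comp py linear0.
split.
  by apply/zero_morphismP => k x; rewrite act_comp; apply/fpE; exists x.
move=> W g /zero_morphismP gf.
have [|h hp] := factor_surj (g := g) pS.
  by move=> k y /fpE[x <-]; rewrite -act_comp gf.
by exists h; split=> // h' hp'; apply: (hom_surj_epi pS); rewrite hp.
Qed.

Lemma short_exactP X Y Z (f : hom X Y) (g : hom Y Z) :
  short_exact f g <-> [/\ hom_inj f, hom_surj g & hom_exact f g].
Proof.
split=> [[/is_kernelP[fI fg] /is_cokernelP[gS _]]|[fI gS fg]] //.
by split; [apply/is_kernelP | apply/is_cokernelP].
Qed.

Lemma inj_short_exact X Y (f : hom X Y) : hom_inj f -> exists Z (g : hom Y Z), short_exact f g.
Proof.
move=> fI; have [Z [g [gS gU]]] := thick_quot thT (submodule_im f).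
by exists Z, g; apply/short_exactP; split=> // k y; rewrite -gU.
Qed.

Lemma surj_short_exact X Y (g : hom X Y) : hom_surj g -> exists Z (f : hom Z X), short_exact f g.
Proof.
move=> gS; have [Z [f [fI fU]]] := thick_sub thT (submodule_ker g).
by exists Z, f; apply/short_exactP; split=> // k y; rewrite -fU.
Qed.

Lemma simpleP X : simple X <-> ~ trivial X /\
  forall U : forall k, car T X k -> Prop, (forall k, submodule (U k)) ->
    (forall k x, U k x -> x = 0) \/ (forall k x, U k x).
Proof.
split=> [[nX sX]|[nX sX]]; split.
- by move/zero_objectP.
- move=> U sU; have [Y [f [fI fU]]] := thick_sub thT sU.
  have [/zero_objectP Y0|/isomorphismP[_ fS]] := sX Y f (proj2 (monomorphismP f) fI).
    by left=> k x /fU[y <-]; rewrite (Y0 k y) linear0.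
  by right=> k x; apply/fU.
- by move/zero_objectP.
- move=> Y f /monomorphismP fI; have [f0|fS] := sX _ (submodule_im f).
    left; apply/zero_objectP => k y; apply: fI; rewrite linear0; apply: f0.
    by exists y.
  by right; apply/isomorphismP.
Qed.

Lemma thick_abelian : abelian C.
Proof.
split.
- by have [Z Z0] := thick_zero thT; exists Z; apply/zero_objectP.
- move=> X Y; have [Z [i [j [p [q [pi qj qi pj ipjq]]]]]] := thick_prod thT X Y.
  exists Z, p, q => W f g.
  have [h hE] := act_surj (r := T) (fun k =>
    (act T i k \o act T f k) \+ (act T j k \o act T g k) : {linear car T W k -> car T Z k}).
  exists h; split.
    split; apply: (act_inj (r := T)) => k x; rewrite act_comp hE linearD /= -?(act_comp p) -?(act_comp q) -?(act_comp p) -?(act_comp q).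
      by rewrite pi act_id pj addr0.
    by rewrite qi add0r qj act_id.
  move=> h' [ph' qh']; apply: (act_inj (r := T)) => k x.
  by rewrite hE /= -ph' -qh' !act_comp ipjq.
- move=> F; have [Z [i [j [p [q [pi qj qi pj ipjq]]]]]] := thick_prod thT (F true) (F false).
  exists Z, (fun b => if b as b return hom (F b) Z then i else j) => W g.
  have [h hE] := act_surj (r := T) (fun k =>
    (act T (g true) k \o act T p k) \+ (act T (g false) k \o act T q k)
    : {linear car T Z k -> car T W k}).
  exists h; split.
    case; apply: (act_inj (r := T)) => k x; rewrite act_comp hE /= -?(act_comp p) -?(act_comp q) -?(act_comp p) -?(act_comp q).
      by rewrite pi act_id qi linear0 addr0.
    by rewrite qj act_id pj linear0 add0r.
  move=> h' h'g; apply: (act_inj (r := T)) => k x.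
  rewrite hE /= -(h'g true) -(h'g false) !act_comp -linearD; congr (act T h' k _).
  by rewrite ipjq.
- move=> X Y f; split.
    have [Z [i [iI iP]]] := thick_sub thT (submodule_ker f).
    by exists Z, i; apply/is_kernelP; split=> // k x; rewrite -iP.
  have [Z [i [iI iP]]] := thick_quot thT (submodule_im f).
  by exists Z, i; apply/is_cokernelP; split=> // k x; rewrite -iP.
- move=> X Y f; split=> [/monomorphismP/inj_short_exact[Z [g [gk _]]]|].
    by exists Z, g.
  by move=> /epimorphismP/surj_short_exact[Z [g [_ gk]]]; exists Z, g.
Qed.

End ThickTheory.
End Elements.
End Realization.

(** * Composition series and extensions *)

Section CompositionSeries.
Variables (K : Type) (A : K -> pzRingType) (C : category) (T : realization A C).
Hypothesis thT : thick T.
Implicit Types X Y Z S : C.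

Lemma composition_series_iso X Y s (f : hom X Y) : hom_inj T f -> hom_surj T f ->
  composition_series X s -> composition_series Y s.
Proof.
move=> fI fS csX; elim: csX Y f fI fS => [Z /(zero_objectP T) Z0|Z W S t i p ip sS csZ _] Y f fI fS.
  apply: composition_series_nil; apply/(zero_objectP T) => k y.
  by have [x <-] := fS k y; rewrite (Z0 k x) linear0.
have [g [gf fg]] := hom_iso fI fS.
have [iI pS ipE] := proj1 (short_exactP thT _ _) ip.
apply: (composition_series_cons (f := f \oc i) (g := p \oc g)) => //.
have gE k x : act T g k (act T f k x) = x by rewrite -act_comp gf act_id.
apply/(short_exactP thT); split.
- by move=> k x y; rewrite !act_comp => /fI/iI.
- by move=> k y; have [x <-] := pS k y; exists (act T f k x); rewrite act_comp gE.
- move=> k y; have [x <-] := fS k y; rewrite act_comp gE ipE.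
  by split=> -[z]; [move=> <-; exists z; rewrite act_comp | rewrite act_comp => /fI; exists z].
Qed.

Lemma composition_series_zero X s : zero_object X -> composition_series X s -> s = [::].
Proof.
move=> /(zero_objectP T) X0 csX; case: csX X0 => // Z W S t i p.
move=> /(short_exactP thT)[_ pS _] [nS _] _ W0; case: nS; apply/(zero_objectP T) => k x.
by have [w <-] := pS k x; rewrite (W0 k w) linear0.
Qed.

(** Induction along the series of [Y]: its next term [Y0] meets [X] in [X'] and has image [Z'] in
    [Z], and [Y0] is an extension of [Z'] by [X']. The simple quotient [S] is then to be attributed
    to [X] or to [Z]. *)
Lemma composition_series_split Y s X Z (f : hom X Y) (g : hom Y Z) :
  composition_series Y s -> short_exact f g ->
  exists s1 s2, [/\ composition_series X s1, composition_series Z s2 &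
    forall S, List.In S s -> List.In S s1 \/ List.In S s2].
Proof.
move=> csY; elim: csY X Z f g => {Y s}[Y /(zero_objectP T) Y0|Y0 Y S s i p ip sS csY0 IH] X Z f g
  /(short_exactP thT)[fI gS fg].
  exists [::], [::]; split=> [||S []]; apply: composition_series_nil; apply/(zero_objectP T) => k z.
    by apply: fI; rewrite linear0 (Y0 k (act T f k z)).
  by have [y <-] := gS k z; rewrite (Y0 k y) linear0.
have [iI pS ipE] := proj1 (short_exactP thT _ _) ip.
have [X' [a [aI aP]]] := thick_sub thT (fun k => submodule_preim i (submodule_im T f k)).
have [Z' [b [bI bP]]] := thick_sub thT (fun k => submodule_im T (g \oc i) k).
have [|d bd] := factor_inj (g := g \oc i) bI.
  by move=> k z; apply/bP; exists z.
have bdE k x : act T b k (act T d k x) = act T g k (act T i k x) by rewrite -!act_comp bd.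
have ad : short_exact a d.
  apply/(short_exactP thT); split=> //.
    move=> k z; have /bP[x xz] : exists y, act T b k y = act T b k z by exists z.
    by exists x; apply: bI; rewrite bdE -act_comp.
  move=> k y; rewrite -aP -fg -bdE; split=> [->|dy]; first by rewrite linear0.
  by apply: (bI k); rewrite dy linear0.
have [s1 [s2 [csX' csZ' s12]]] := IH _ _ _ _ ad.
have [|a' fa'] := factor_inj (g := i \oc a) fI.
  move=> k x; rewrite act_comp; apply/aP; by exists x.
have fa'E k x : act T f k (act T a' k x) = act T i k (act T a k x) by rewrite -!act_comp fa'.
have a'I : hom_inj T a'.
  by move=> k x y xy; apply: aI; apply: iI; rewrite -!fa'E xy.
pose t := p \oc f.
have a'P k x : act T t k x = 0 <-> exists y, act T a' k y = x.
  rewrite act_comp ipE; split=> [[y yx]|[y <-]]; last by exists (act T a k y); rewrite fa'E.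
  have /aP[z zy] : exists x, act T f k x = act T i k y by exists x.
  by exists z; apply: fI; rewrite fa'E zy yx.
have [nS sS'] := proj1 (simpleP thT S) sS.
(* By simplicity the map from [X] to [S] is zero or onto. If zero, [X'] is all of [X] and [S] is the
   quotient of [Z] by [Z']; if onto, [S] is the quotient of [X] by [X'] and [Z'] is all of [Z]. *)
have [t0|tS] := sS' _ (submodule_im T t).
- have [|r rg] := factor_surj (f := g) (g := p) gS.
    by move=> k y /fg[x <-]; rewrite -act_comp; apply: t0; exists x.
  have rgE k y : act T r k (act T g k y) = act T p k y by rewrite -act_comp rg.
  exists s1, (S :: s2); split.
  + apply: (composition_series_iso (f := a')) => // k x; apply/a'P; apply: t0; by exists x.
  + apply: (composition_series_cons (f := b) (g := r)) => //.
    apply/(short_exactP thT); split=> // k z.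
      by have [y <-] := pS k z; exists (act T g k y).
    apply: iff_trans (bP k z); have [y <-] := gS k z; rewrite rgE; split=> [/ipE[x <-]|[x]].
      by exists x; rewrite act_comp.
    rewrite act_comp => xy.
    have /fg[x' xE] : act T g k (y - act T i k x) = 0 by rewrite linearB xy subrr.
    have -> : y = act T f k x' + act T i k x by rewrite xE subrK.
    have tx : act T p k (act T f k x') = 0 by rewrite -act_comp; apply: t0; exists x'.
    rewrite linearD tx add0r.
    by apply/ipE; exists x.
  + by move=> S' [ <-|/s12[]]; [right; left | left | right; right].
- exists (S :: s1), s2; split.
  + apply: (composition_series_cons (f := a') (g := t)) => //.
    by apply/(short_exactP thT); split=> // k x; exact: a'P.
  + apply: (composition_series_iso (f := b)) => // k z; apply/bP.
    have [y <-] := gS k z; have [x xy] := tS k (act T p k y).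
    have /ipE[x' xE] : act T p k (y - act T f k x) = 0.
      by rewrite linearB -act_comp xy subrr.
    exists x'; rewrite act_comp xE linearB; have -> : act T g k (act T f k x) = 0.
      by apply/fg; exists x.
    by rewrite subr0.
  + by move=> S' [ <-|/s12[]]; [left; left | left; right | right].
Qed.

(** The series of [Z] is pulled back along [g]; its zero term pulls back to [X]. *)
Lemma composition_series_ext X Y Z (f : hom X Y) (g : hom Y Z) s1 s2 :
  short_exact f g -> composition_series X s1 -> composition_series Z s2 ->
  composition_series Y (s2 ++ s1).
Proof.
move=> fg csX csZ; elim: csZ Y f g fg => [{}Z /(zero_objectP T) Z0|Z0 {}Z S s i p ip sS csZ0 IH] Y f g
  /(short_exactP thT)[fI gS fgE].
  apply: (composition_series_iso (f := f)) => // k y; apply/fgE; exact: Z0.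
have [iI pS ipE] := proj1 (short_exactP thT _ _) ip.
have [Y0 [j [jI jP]]] := thick_sub thT (fun k => submodule_preim g (submodule_im T i k)).
have [|f0 jf0] := factor_inj (g := f) jI.
  move=> k x; apply/jP; exists 0; rewrite linear0; apply/esym/fgE; by exists x.
have [|g0 ig0] := factor_inj (g := g \oc j) iI.
  by move=> k y; rewrite act_comp; apply/jP; exists y.
have jf0E k x : act T j k (act T f0 k x) = act T f k x by rewrite -act_comp jf0.
have ig0E k x : act T i k (act T g0 k x) = act T g k (act T j k x) by rewrite -!act_comp ig0.
have fg0 : short_exact f0 g0.
  apply/(short_exactP thT); split.
  - by move=> k x y xy; apply: fI; rewrite -!jf0E xy.
  - move=> k z; have [y yz] := gS k (act T i k z).
    have /jP[y' y'y] : exists x, act T i k x = act T g k y by exists z.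
    by exists y'; apply: iI; rewrite ig0E y'y.
  - move=> k y; split=> [gy|[x <-]].
      have /fgE[x xy] : act T g k (act T j k y) = 0 by rewrite -ig0E gy linear0.
      by exists x; apply: jI; rewrite jf0E.
    by apply: iI; rewrite ig0E jf0E linear0; apply/fgE; exists x.
have csY0 := IH _ _ _ fg0.
apply: (composition_series_cons (f := j) (g := p \oc g)) => //.
apply/(short_exactP thT); split=> // k z.
  by have [x <-] := pS k z; have [y <-] := gS k x; exists y; rewrite act_comp.
by rewrite act_comp ipE jP.
Qed.

Definition good (Q : C -> Prop) X := finite_length X /\ forall S, simple_constituent X S -> Q S.

Lemma simple_constituentP X S :
  simple_constituent X S <-> exists2 s, composition_series X s & List.In S s.
Proof.
split=> [[s [t cs]]|[s cs Ss]]; last first.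
  by have [s1 [s2 sE]] := List.in_split _ _ Ss; exists s1, s2; rewrite sE in cs.
by exists (s ++ S :: t) => //; apply/List.in_or_app; right; left.
Qed.

(** A constituent is one occurring in some series. Series of [X] and [Z] concatenate to a series of
    [Y], and every series of [Y] distributes its members over series of [X] and [Z]. *)
Lemma good_serre Q : serre (good Q).
Proof.
split=> [Z Z0|X Y Z f g fg].
  split; first by exists [::]; exact: composition_series_nil.
  by move=> S [s [t /(composition_series_zero Z0)]]; case: s.
split=> [[[s csY] QY]|[[[s1 csX] QX] [[s2 csZ] QZ]]].
  have [s1 [s2 [csX csZ _]]] := composition_series_split csY fg.
  split; (split; first by [exists s1 | exists s2]) => S /simple_constituentP[s' cs' Ss'].
    apply: QY; apply/simple_constituentP; exists (s2 ++ s'); first exact: composition_series_ext fg cs' csZ.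
    by apply/List.in_or_app; right.
  apply: QY; apply/simple_constituentP; exists (s' ++ s1); first exact: composition_series_ext fg csX cs'.
  by apply/List.in_or_app; left.
split; first by exists (s2 ++ s1); exact: composition_series_ext fg csX csZ.
move=> S /simple_constituentP[s csY Ss].
have [t1 [t2 [csX' csZ' tP]]] := composition_series_split csY fg.
by have [St|St] := tP _ Ss; [apply: QX | apply: QZ]; apply/simple_constituentP; [exists t1 | exists t2].
Qed.

End CompositionSeries.

(** * Serre subcategories inherit thickness *)

Section FullSubcategory.
Variables (K : Type) (A : K -> pzRingType) (C : category) (T : realization A C).
Variable P : C -> Prop.

Definition full_realization : realization A (full_subcategory P) :=
  @Realization K A (full_subcategory P) (fun X => car T (sval X))
    (fun X Y f => act T (f : hom (sval X) (sval Y)))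
    (fun X Y f g => act_inj (r := T) (f := f) (g := g))
    (fun X Y f => act_surj (r := T) f)
    (fun X => act_id (r := T) (X := sval X))
    (fun X Y Z g f => act_comp (r := T) g f).

Hypothesis thT : thick T.
Hypothesis serreP : serre P.

Let P_ext X Y Z (f : hom X Y) (g : hom Y Z) : short_exact f g -> P Y <-> P X /\ P Z.
Proof. exact: (proj2 serreP). Qed.

Lemma serre_inj X Y (f : hom X Y) : hom_inj T f -> P Y -> P X.
Proof. by move=> /(inj_short_exact thT)[Z [g /P_ext fg]] /fg[]. Qed.

Lemma serre_surj X Y (f : hom X Y) : hom_surj T f -> P X -> P Y.
Proof. by move=> /(surj_short_exact thT)[Z [g /P_ext fg]] /fg[]. Qed.

Lemma full_thick : thick full_realization.
Proof.
split.
- have [Z Z0] := thick_zero thT.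
  have PZ : P Z by apply: (proj1 serreP); apply/(zero_objectP T).
  by exists (exist _ Z PZ).
- move=> [X PX] U sU; have [Y [f [fI fU]]] := thick_sub thT sU.
  by exists (exist _ Y (serre_inj fI PX)), f.
- move=> [X PX] U sU; have [Y [f [fS fU]]] := thick_quot thT sU.
  by exists (exist _ Y (serre_surj fS PX)), f.
- move=> [X PX] [Y PY]; have [Z [i [j [p [q [pi qj qi pj ipjq]]]]]] := thick_prod thT X Y.
  (* A direct sum is an extension of its summands, so the Serre property covers it. *)
  suff /P_ext iq : short_exact i q.
    by exists (exist _ Z (proj2 iq (conj PX PY))), i, j, p, q.
  have piE k x : act T p k (act T i k x) = x by rewrite -act_comp pi act_id.
  have qjE k x : act T q k (act T j k x) = x by rewrite -act_comp qj act_id.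
  apply/(short_exactP thT); split=> [k x y xy|k y|k z].
  + by rewrite -[x]piE xy piE.
  + by exists (act T j k y).
  + split=> [qz|[x <-]]; last by rewrite -act_comp qi.
    by exists (act T p k z); rewrite -[RHS]ipjq qz linear0 addr0.
Qed.

Lemma full_short_exact (X Y Z : full_subcategory P) (f : hom X Y) (g : hom Y Z) :
  short_exact f g <-> short_exact (C := C) (f : hom (sval X) (sval Y)) (g : hom (sval Y) (sval Z)).
Proof. by rewrite (short_exactP full_thick) (short_exactP thT). Qed.

Lemma full_zero_object (X : full_subcategory P) : zero_object X <-> zero_object (sval X).
Proof. by rewrite (zero_objectP full_realization) (zero_objectP T). Qed.

End FullSubcategory.

Lemma serre_generated_serre (C : category) (G : C -> Prop) : serre (serre_generated G).
Proof.
split=> [Z Z0 P sP _|X Y Z f g fg]; first exact: (proj1 sP).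
have E P : serre P -> P Y <-> P X /\ P Z by move=> sP; exact: (proj2 sP) fg.
split=> [GY|[GX GZ] P sP GP].
  by split=> P sP GP; have [/(_ (GY P sP GP))[]] := E P sP.
by have [_] := E P sP; apply; split; [exact: GX | exact: GZ].
Qed.

(** * Highest l-weights and the group of Laurent monomials *)

Section Convolution.
Variable F : fieldType.
Implicit Types (p q : {poly F}) (s : int -> F).

(* The action of [p(u)] on Laurent series in [u^{-1}], given by their
   coefficients. *)
Definition conv p s (m : int) : F := \sum_(k < size p) p`_k * s (m + k%:Z).

Lemma conv_widen n p s m : (size p <= n)%N -> conv p s m = \sum_(k < n) p`_k * s (m + k%:Z).
Proof.
move=> pn; rewrite /conv -(big_mkord xpredT (fun k => p`_k * s (m + k%:Z))).
rewrite -(big_mkord xpredT (fun k => p`_k * s (m + k%:Z))).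
rewrite (big_cat_nat (n := size p) (p := n)) //= [X in _ + X]big1_seq ?addr0 // => i.
rewrite mem_index_iota => /andP[_ /andP[pi _]].
by rewrite nth_default // mul0r.
Qed.

Lemma convDl p q s m : conv (p + q) s m = conv p s m + conv q s m.
Proof.
have h := size_polyD p q; have [hp hq] := (leq_maxl (size p) (size q), leq_maxr (size p) (size q)).
rewrite (conv_widen _ _ h) (conv_widen _ _ hp) (conv_widen _ _ hq) -big_split /=.
by apply: eq_bigr => i _; rewrite coefD mulrDl.
Qed.

Lemma convZl c p s m : conv (c *: p) s m = c * conv p s m.
Proof.
rewrite (conv_widen _ _ (size_scale_leq c p)) mulr_sumr.
by apply: eq_bigr => i _; rewrite coefZ mulrA.
Qed.

Lemma convC c s m : conv c%:P s m = c * s m.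
Proof.
rewrite (@conv_widen 1) ?size_polyC; last by case: (c != 0).
by rewrite big_ord1 coefC /= addr0.
Qed.

Lemma convMX p s m : conv (p * 'X) s m = conv p s (m + 1).
Proof.
have h : (size (p * 'X)%R <= (size p).+1)%N.
  by rewrite (leq_trans (size_polyMleq _ _)) // size_polyX addn2.
rewrite (conv_widen _ _ h) big_ord_recl coefMX /= mul0r add0r.
apply: eq_bigr => i _; rewrite coefMX /=; congr (_ * s _).
by rewrite -addrA; congr (_ + _); rewrite /bump /=; lia.
Qed.

Lemma conv_ext p s t : s =1 t -> conv p s =1 conv p t.
Proof. by move=> st m; apply: eq_bigr => i _; rewrite st. Qed.

Lemma convM p q s m : conv (p * q) s m = conv p (conv q s) m.
Proof.
elim/poly_ind: p m => [|p c IH] m.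
  by rewrite mul0r -polyC0 !convC !mul0r.
rewrite mulrDl convDl mulrAC convMX IH mul_polyC convZl.
by rewrite [RHS]convDl convMX convC.
Qed.

Lemma convXsubC a s m : conv ('X - a%:P) s m = s (m + 1) - a * s m.
Proof.
have -> : 'X - a%:P = 1%:P * 'X + (- a)%:P by rewrite mul1r polyCN.
by rewrite convDl convMX !convC mul1r mulNr.
Qed.

Definition series_below s := exists n0, forall n : int, n < n0 -> s n = 0.

(** The constant series 1, on which a polynomial acts to give itself as a series. *)
Definition delta0 (m : int) : F := (m == 0)%:R.

Lemma conv_delta p m : conv p delta0 m = if m <= 0 then p`_(`|m|%N) else 0.
Proof.
rewrite /conv; case: ifP => m0; last first.
  rewrite big1 // => k _; rewrite /delta0 (_ : _ == 0 = false) ?mulr0 //.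
  by apply/negP => /eqP; lia.
have [mp|mp] := ltnP `|m|%N (size p).
  rewrite (bigD1 (Ordinal mp)) //= big1 ?addr0 => [|k kp].
    by rewrite /delta0 (_ : _ == 0) ?mulr1 //; apply/eqP; lia.
  rewrite /delta0 (_ : _ == 0 = false) ?mulr0 //.
  apply/negP => /eqP mk; case/eqP: kp; apply: val_inj => /=; lia.
rewrite nth_default // big1 // => k _; rewrite /delta0 (_ : _ == 0 = false) ?mulr0 //.
by apply/negP => /eqP mk; have := ltn_ord k; lia.
Qed.

Lemma conv_delta_inj p q : conv p delta0 =1 conv q delta0 -> p = q.
Proof.
move=> pq; apply/polyP => k; have := pq (- k%:Z).
by rewrite !conv_delta oppr_le0 lez_nat /= abszN.
Qed.

End Convolution.

Section Expansion.
Variable R : realType.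
Local Notation C := R[i].
Local Notation "x %:F" := (@FracField.tofrac {poly R[i]} x).
Implicit Types (r : {fraction {poly C}}) (s : int -> C) (P Q : {poly C}).

Lemma frac_eq P Q P' Q' : Q != 0 -> Q' != 0 -> (P%:F / Q%:F == P'%:F / Q'%:F) = (P * Q' == P' * Q).
Proof. by move=> Q0 Q'0; rewrite eqr_div ?tofrac_eq0 // -!tofracM tofrac_eq. Qed.

Lemma expansionP r s : expansion_at_infinity r s <->
  series_below s /\ exists P Q, monic_ratio r P Q /\ conv Q s =1 conv P (@delta0 _).
Proof.
by split=> -[sb [P [Q [rPQ QP]]]]; split=> //; exists P, Q; split=> // m;
  have := QP m; rewrite conv_delta.
Qed.

(** Applied to the series 1, both [P Q'] and [P' Q] give [Q Q'] applied to [s]. *)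
Lemma expansion_uniq r r' s :
  expansion_at_infinity r s -> expansion_at_infinity r' s -> r = r'.
Proof.
move=> /expansionP[sb [P [Q [[_ /monic_neq0 nQ ->] QP]]]].
move=> /expansionP[_ [P' [Q' [[_ /monic_neq0 nQ' ->] QP']]]].
apply/eqP; rewrite frac_eq //; apply/eqP; apply: conv_delta_inj => m.
rewrite [P * _]mulrC [P' * _]mulrC !convM.
rewrite -(conv_ext _ QP) -(conv_ext _ QP') -!convM mulrC //.
Qed.

(** The recurrence is the identity [(u - x) s' = (u - y) s] of Laurent series. *)
Lemma expansion_step r s s' (x y : C) :
  expansion_at_infinity r s -> series_below s' ->
  (forall p, s' (p + 1) - x * s' p = s (p + 1) - y * s p) ->
  expansion_at_infinity (r * (('X - y%:P)%:F / ('X - x%:P)%:F)) s'.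
Proof.
move=> /expansionP[sb [P [Q [[mP mQ ->] QP]]]] sb' st; apply/expansionP; split=> //.
exists (P * ('X - y%:P)), (Q * ('X - x%:P)); split.
  split; rewrite ?monicMl ?monicXsubC //.
  by rewrite mulrACA -invfM -!tofracM.
move=> m; have -> : conv (Q * ('X - x%:P)) s' m = conv (Q * ('X - y%:P)) s m.
  by rewrite !convM; apply: conv_ext => k; rewrite !convXsubC.
by rewrite mulrC convM [P * _]mulrC convM; apply: conv_ext => k; rewrite QP.
Qed.

End Expansion.

(** * Orders of vanishing of rational functions *)

Section OrderOfVanishing.
Variable F : fieldType.
Local Notation "x %:F" := (@FracField.tofrac {poly F} x).
Implicit Types (r : {fraction {poly F}}) (b : F) (n : int).

Definition has_ord b r n := exists P Q : {poly F},
  [/\ P.[b] != 0, Q.[b] != 0 & r = ('X - b%:P)%:F ^ n * (P%:F / Q%:F)].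

Lemma horner_neq0 b (P : {poly F}) : P.[b] != 0 -> P%:F != 0.
Proof. by rewrite tofrac_eq0; apply: contraNneq => ->; rewrite horner0. Qed.

Lemma XsubF_neq0 b : ('X - b%:P)%:F != 0.
Proof. by rewrite tofrac_eq0 polyXsubC_eq0. Qed.

Lemma has_ord_uniq b r n n' : has_ord b r n -> has_ord b r n' -> n = n'.
Proof.
wlog nn' : n n' / n <= n'.
  by move=> W; case: (leP n n') => [/W|/ltW/W] E Hn Hn'; [|symmetry]; exact: E.
move=> [P [Q [Pb Qb rE]]] [P' [Q' [Pb' Qb' rE']]].
have [k nk] : exists k : nat, n' = n + k%:Z by exists `|n' - n|%N; lia.
have X0 := expfz_neq0 n (XsubF_neq0 b).
move: rE'; rewrite rE nk expfzDr ?XsubF_neq0 // -mulrA => /(mulfI X0).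
rewrite -exprnP -tofracXn mulrA -tofracM => /eqP.
rewrite (eqr_div _ _ (horner_neq0 Qb) (horner_neq0 Qb')) -!tofracM tofrac_eq => /eqP E.
(* If the orders differed, the side keeping a factor ['X - b] would vanish at [b] and the other
   would not. *)
case: k nk E => [|k] nk E; first by rewrite addr0.
have := congr1 (fun P : {poly F} => P.[b]) E; rewrite !hornerE subrr expr0n !mul0r.
by move/eqP; rewrite mulf_eq0 (negPf Pb) (negPf Qb').
Qed.

Lemma has_ordM b r r' n n' : has_ord b r n -> has_ord b r' n' -> has_ord b (r * r') (n + n').
Proof.
move=> [P [Q [Pb Qb ->]]] [P' [Q' [Pb' Qb' ->]]]; exists (P * P'), (Q * Q').
rewrite !hornerM !mulf_neq0 //; split=> //.
rewrite mulrACA -expfzDr ?XsubF_neq0 //; congr (_ * _).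
by rewrite !tofracM invfM mulrACA.
Qed.

Lemma has_ord1 b : has_ord b 1 0.
Proof. by exists 1, 1; rewrite hornerE oner_eq0 tofrac1 divr1 mulr1 expr0z. Qed.

Lemma has_ordV b r n : has_ord b r n -> has_ord b r^-1 (- n).
Proof.
move=> [P [Q [Pb Qb ->]]]; exists Q, P; split=> //.
by rewrite !invfM invrK -invr_expz [Q%:F * _]mulrC.
Qed.

Lemma has_ordX b r n k : has_ord b r n -> has_ord b (r ^ k) (n * k).
Proof.
move=> rn; have pos (m : nat) : has_ord b (r ^+ m) (n * m%:Z).
  elim: m => [|m IH]; first by rewrite mulr0; exact: has_ord1.
  by rewrite exprS intS mulrDr mulr1; exact: has_ordM.
case: k => m; first exact: pos.
by rewrite NegzE -invr_expz mulrN; apply: has_ordV; exact: pos.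
Qed.

Lemma has_ordXsub b a : has_ord b ('X - a%:P)%:F (b == a)%:R.
Proof.
have [->|ba] := eqVneq b a.
  by exists 1, 1; rewrite hornerE oner_eq0 expr1z tofrac1 divr1 mulr1.
exists ('X - a%:P), 1; rewrite !hornerE subr_eq0 ba oner_eq0.
by rewrite tofrac1 divr1.
Qed.

Lemma has_ord_prod b I (s : seq I) (p : pred I) (r : I -> {fraction {poly F}}) (n : I -> int) :
  (forall i, p i -> has_ord b (r i) (n i)) ->
  has_ord b (\prod_(i <- s | p i) r i) (\sum_(i <- s | p i) n i).
Proof.
move=> rn; apply: (big_rec2 (fun x y => has_ord b x y)) => [|i x y pi]; first exact: has_ord1.
by apply: has_ordM; exact: rn.
Qed.

End OrderOfVanishing.

(** * The subgroup of the [z] monomials and its cosets *)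

Section Gamma.
Variable D : lie_datum.
Implicit Types (x y : ivertex D) (m n : monomial D).

(** The homomorphism sending each free generator [x] to [z_mono x]. Its image is [Gamma], so the
    subgroup properties follow from additivity. *)
Definition zlift (n : {freeg (ivertex D) / int}) : monomial D := fglift (@z_mono D) n.

HB.instance Definition _ := GRing.isZmodMorphism.Build {freeg (ivertex D) / int} (monomial D)
  zlift (lift_is_additive (@z_mono D)).

Lemma GammaP m : Gamma m <-> exists n, m = zlift n.
Proof.
suff E n : \sum_(x <- dom n) z_mono x *~ coeff x n = zlift n.
  by split=> -[n ->]; exists n; rewrite E.
rewrite -[in RHS](freeg_sumE n) raddf_sum; apply: eq_bigr => x _.
by apply: etrans (esym (liftU _ _ _)); rewrite -scaler_int intz.
Qed.

Lemma Gamma0 : Gamma (0 : monomial D).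
Proof. by apply/GammaP; exists 0; rewrite raddf0. Qed.

Lemma GammaB m m' : Gamma m -> Gamma m' -> Gamma (m - m').
Proof. by move=> /GammaP[n ->] /GammaP[n' ->]; apply/GammaP; exists (n - n'); rewrite raddfB. Qed.

Lemma GammaN m : Gamma m -> Gamma (- m).
Proof. by move=> Gm; rewrite -sub0r; apply: GammaB => //; exact: Gamma0. Qed.

Lemma GammaD m m' : Gamma m -> Gamma m' -> Gamma (m + m').
Proof. by move=> Gm Gm'; rewrite -[m']opprK; apply: GammaB => //; exact: GammaN. Qed.

Lemma GammaMz m k : Gamma m -> Gamma (m *~ k).
Proof. by move=> /GammaP[n ->]; apply/GammaP; exists (n *~ k); rewrite raddfMz. Qed.

Lemma Gamma_z x : Gamma (z_mono x).
Proof. by apply/GammaP; exists << x >>; apply: etrans (esym (liftU _ _ _)); rewrite scale1r. Qed.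

Lemma coset_eq (tau tau' : coset D) m m' :
  sval tau m -> sval tau' m' -> Gamma (m' - m) -> tau = tau'.
Proof.
case: tau tau' => [U [u uE]] [U' [u' u'E]] /= Um U'm' Gmm'.
apply: eq_exist; rewrite uE u'E in Um U'm' *; rewrite /= in Um U'm'.
apply/seteqP; split=> v /= Gv.
  have -> : v - u' = (v - u) - (m - u) - (m' - m) + (m' - u').
    by rewrite !opprB !addrA !subrK.
  by apply: GammaD => //; apply: GammaB => //; exact: GammaB.
have -> : v - u = (v - u') - (m' - u') + (m' - m) + (m - u).
  by rewrite !opprB !addrA !subrK.
by apply: GammaD => //; apply: GammaD => //; exact: GammaB.
Qed.

End Gamma.

(** * Integral l-weights and the eigenvalues attached to a coset *)

Section Psi.
Variables (R : realType) (D : lie_datum).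
Local Notation C := R[i].
Local Notation "x %:F" := (@FracField.tofrac {poly R[i]} x).
Implicit Types (x y : ivertex D) (m n : monomial D) (i j : D).

Lemma Psi_widen m (s : seq (ivertex D)) i : uniq s -> {subset dom m <= s} ->
  Psi R m i = \prod_(x <- s | (val x).1 == i) ('X - ((val x).2%:~R)%:P)%:F ^ coeff x m.
Proof.
move=> us ms; rewrite /Psi [RHS](bigID (mem (dom m))) /= [X in _ * X]big1 ?mulr1; last first.
  by move=> x /andP[_ /coeff_outdom ->]; rewrite expr0z.
have pd : perm_eq (dom m) [seq x <- s | x \in dom m].
  apply: uniq_perm; rewrite ?filter_uniq ?uniq_dom // => x; rewrite mem_filter.
  by case: (boolP (x \in dom m)) => //= /ms ->.
by rewrite (perm_big _ pd) big_filter_cond; apply: eq_bigl => x; rewrite andbC.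
Qed.

Lemma PsiD m m' i : Psi R (m + m') i = Psi R m i * Psi R m' i.
Proof.
pose s := undup (dom m ++ dom m').
have us : uniq s by exact: undup_uniq.
rewrite (Psi_widen _ us) => [|x]; last by rewrite mem_undup; exact: domD_subset.
rewrite (Psi_widen _ us) => [|x]; last by rewrite mem_undup mem_cat => ->.
rewrite (Psi_widen _ us) => [|x]; last by rewrite mem_undup mem_cat => ->; rewrite orbT.
rewrite -big_split; apply: eq_bigr => x _.
by rewrite coeffD expfzDr // XsubF_neq0.
Qed.

Lemma Psi0 i : Psi R (0 : monomial D) i = 1.
Proof. by rewrite /Psi dom0 big_nil. Qed.

Lemma PsiN m i : Psi R (- m) i = (Psi R m i)^-1.
Proof.
have := PsiD m (- m) i; rewrite subrr Psi0 => /esym E.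
have m0 : Psi R m i != 0 by apply: contra_eq_neq E => ->; rewrite mul0r eq_sym oner_neq0.
by apply: (mulfI m0); rewrite E divff.
Qed.

Lemma Psi_y x i : Psi R << x >> i = if (val x).1 == i then ('X - ((val x).2%:~R)%:P)%:F else 1.
Proof.
rewrite /Psi domU1 big_mkcond big_seq1; case: eqP => // _.
by rewrite coeffU mul1r eqxx expr1z.
Qed.

Lemma Psi_sum I (s : seq I) (m : I -> monomial D) i :
  Psi R (\sum_(k <- s) m k) i = \prod_(k <- s) Psi R (m k) i.
Proof.
elim: s => [|k s IH]; first by rewrite !big_nil Psi0.
by rewrite !big_cons PsiD IH.
Qed.

Lemma Psi_ord m y : has_ord ((val y).2%:~R : C) (Psi R m (val y).1) (coeff y m).
Proof.
have -> : coeff y m = \sum_(x <- dom m | (val x).1 == (val y).1)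
    (((val y).2%:~R : C) == (val x).2%:~R)%:R * coeff x m.
  have E x : (if (val x).1 == (val y).1
      then (((val y).2%:~R : C) == (val x).2%:~R)%:R * coeff x m else 0) =
      if x == y then coeff x m else 0.
    rewrite -val_eqE /= -pair_eqE /= /pair_eq eqr_int eq_sym [(val y).2 == _]eq_sym.
    by case: eqP => //= _; case: eqP; rewrite ?mul1r ?mul0r.
  rewrite big_mkcond (eq_bigr _ (fun x _ => E x)) -big_mkcond.
  have [ym|ym] := boolP (y \in dom m); first by rewrite -big_filter filter_pred1_uniq ?uniq_dom // big_seq1.
  rewrite coeff_outdom // big_seq_cond big1 // => x /andP[xm /eqP xy].
  by rewrite xy (negPf ym) in xm.
by apply: has_ord_prod => x _; apply: has_ordX; exact: has_ordXsub.
Qed.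

Definition Afac (j : D) (a : C) (i : D) : {fraction {poly C}} :=
  ('X - (a - (cartan i j)%:~R)%:P)%:F / ('X - (a + (cartan i j)%:~R)%:P)%:F.

Definition Aprod (L : seq (D * C * int)) (i : D) :=
  \prod_(t <- L) Afac t.1.1 t.1.2 i ^ t.2.

(** The order at [b] of the component [Afac j a i]. *)
Definition Aord (b : C) (i : D) (j : D) (a : C) : int :=
  (b == a - (cartan i j)%:~R)%:R - (b == a + (cartan i j)%:~R)%:R.

Lemma Aprod_ord b L i : has_ord b (Aprod L i) (\sum_(t <- L) Aord b i t.1.1 t.1.2 * t.2).
Proof.
apply: has_ord_prod => t _; apply: has_ordX.
by apply: has_ordM; [|apply: has_ordV]; exact: has_ordXsub.
Qed.

Lemma coeff_z x y : coeff y (z_mono x) = (x == y)%:R + (shift2 x == y)%:R -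
  (adj (val x).1 (val y).1 && ((val x).2 + 1 == (val y).2))%:R.
Proof.
rewrite /z_mono coeffB coeffD /y_mono !coeffU !mul1r; congr (_ - _).
rewrite raddf_sum /=.
under eq_bigr do rewrite coeffU mul1r.
have [xy|xy] := boolP (adj (val x).1 (val y).1); last first.
  rewrite big1 // => k _; case: eqP => // ky.
  by have := valP k; rewrite /= -[val k]/((val (shift1 k)).1) ky (negPf xy).
rewrite (bigD1 (exist _ (val y).1 xy)) //= big1 ?addr0 => [|k kxy].
  by rewrite -val_eqE /= -pair_eqE /= /pair_eq /= eqxx.
case: eqP => // ky; case/eqP: kxy; apply: val_inj => /=.
by rewrite -ky.
Qed.

(* [A_{j,a}] is [z_{j,a-2} / z_{j,a}] when [(j,a)] is integral, and otherwise
   has no integral zero or pole. *)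
Lemma Aord_Gamma j a : exists2 g : monomial D, Gamma g &
  forall y, coeff y g = Aord (val y).2%:~R (val y).1 j a.
Proof.
have [[k jk ak]|nk] := pselect (exists2 k : int, (k == (parity j : nat)%:Z %[mod 2])%Z & a = k%:~R).
  have jk2 : (k - 2 == (parity j : nat)%:Z %[mod 2])%Z.
    by rewrite -(eqP jk) -[in X in _ == X](subrK 2 k) modzDr.
  pose x : ivertex D := exist _ (j, k) jk; pose x' : ivertex D := exist _ (j, k - 2) jk2.
  exists (z_mono x' - z_mono x); first by apply: GammaB; exact: Gamma_z.
  move=> y; rewrite coeffB !coeff_z /Aord ak -!val_eqE /= -!pair_eqE /= /pair_eq /=.
  rewrite -!intrB -!intrD !eqr_int; move: (val y) => [i b] /=; rewrite /cartan [i == j]eq_sym.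
  have [->|ij] := eqVneq j i; first by rewrite adj_irr /=; lia.
  by rewrite adj_sym; case: (adj i j) => /=; lia.
exists 0; first exact: Gamma0.
move=> y; rewrite coeff0 /Aord; case: y => -[i b] /= ib.
have [cij|cij] := eqVneq (cartan i j) 0; first by rewrite cij subr0 addr0 subrr.
have F (c : int) : (((b + c) == (parity j : nat)%:Z %[mod 2])%Z) -> a <> (b + c)%:~R.
  by move=> bc ac; apply: nk; exists (b + c).
(* A nonzero [c_ij] is even when [i = j] and odd between neighbours, exactly as the parities of [i]
   and [j] differ. So a zero or pole of the [i]-th component at some [b] with the parity of [i]
   would make [(j, a)] integral. *)
have par c : c = cartan i j \/ c = - cartan i j -> (((b + c) == (parity j : nat)%:Z %[mod 2])%Z).
  move=> cE; move: cij cE ib; rewrite /cartan; case: (eqVneq i j) => [->|ij].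
    by move=> _ [] -> ib; lia.
  case aij: (adj i j) => //; have pij := parity_adj aij.
  by move=> _ [] -> ib; lia.
have -> : ((b%:~R : C) == a - (cartan i j)%:~R) = false.
  apply/negP => /eqP E; apply: (F (cartan i j)); first by apply: par; left.
  by rewrite intrD E subrK.
have -> // : ((b%:~R : C) == a + (cartan i j)%:~R) = false.
apply/negP => /eqP E; apply: (F (- cartan i j)); first by apply: par; right.
by rewrite intrD E rmorphN addrK.
Qed.

Lemma Aprod_Gamma L : exists2 g : monomial D, Gamma g &
  forall y, coeff y g = \sum_(t <- L) Aord (val y).2%:~R (val y).1 t.1.1 t.1.2 * t.2.
Proof.
elim: L => [|t L [g Gg gE]].
  by exists 0; [exact: Gamma0 | move=> y; rewrite big_nil coeff0].
have [g' Gg' gE'] := Aord_Gamma t.1.1 t.1.2.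
exists (g' *~ t.2 + g); first by apply: GammaD => //; exact: GammaMz.
by move=> y; rewrite big_cons coeffD gE raddfMz /= gE' mulrzz.
Qed.

(** At integral points the orders of the two products are the exponents of elements [g] and [g'] of
    [Gamma], and those of [Psi] are the exponents of the monomial; equality of orders gives
    [m + g = m' + g']. *)
Lemma Psi_Aprod_Gamma m m' L L' :
  (forall i, Psi R m i * Aprod L i = Psi R m' i * Aprod L' i) -> Gamma (m' - m).
Proof.
move=> E; have [g Gg gE] := Aprod_Gamma L; have [g' Gg' gE'] := Aprod_Gamma L'.
suff -> : m' - m = g - g' by exact: GammaB.
apply/eqP/freeg_eqP => y; rewrite !coeffB gE gE'.
have H := has_ordM (Psi_ord m y) (Aprod_ord _ L (val y).1).
rewrite E in H; have := has_ord_uniq H (has_ordM (Psi_ord m' y) (Aprod_ord _ L' (val y).1)).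
set p := \sum_(t <- L) _; set p' := \sum_(t <- L') _.
by move: (coeff y m) (coeff y m') p p' => c c' p p'; lia.
Qed.

(** The eigenvalues reachable from an l-weight in [tau] by steps and inverse steps. The list [L]
    records the factors [A_{j,a}], for arbitrary complex [a], with their exponents. *)
Definition Sigma (tau : coset D) (lam : D * int -> C) := exists m L, sval tau m /\
  forall i, expansion_at_infinity (Psi R m i * Aprod L i) (fun p => lam (i, p)).

Lemma Sigma_saturated tau : saturated (Sigma tau).
Proof.
move=> j lam lam' bl bl' [a st]; split=> -[m [L [taum E]]].
  exists m, ((j, a, 1) :: L); split=> // i.
  rewrite /Aprod big_cons /= expr1z mulrCA mulrC.
  exact: expansion_step (E i) (bl' i) (st i).
exists m, ((j, a, -1) :: L); split=> // i.
rewrite /Aprod big_cons /= -invr_expz expr1z mulrCA mulrC /Afac invf_div.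
by apply: expansion_step (E i) (bl i) _ => p; rewrite st.
Qed.

Lemma Sigma_disjoint tau tau' lam : Sigma tau lam -> Sigma tau' lam -> tau = tau'.
Proof.
move=> [m [L [taum E]]] [m' [L' [taum' E']]].
apply: (coset_eq taum taum'); apply: (@Psi_Aprod_Gamma _ _ L L') => i.
exact: expansion_uniq (E i) (E' i).
Qed.

Lemma Sigma_Psi tau m lam : sval tau m ->
  (forall i, expansion_at_infinity (Psi R m i) (fun p => lam (i, p))) -> Sigma tau lam.
Proof.
by move=> taum E; exists m, [::]; split=> // i; rewrite /Aprod big_nil mulr1.
Qed.

Definition coset_of (m : monomial D) : coset D :=
  exist _ [set m' | Gamma (m' - m)]%classic (ex_intro _ m erefl).

Lemma coset_of_mem m : sval (coset_of m) m.
Proof. by rewrite /= subrr; exact: Gamma0. Qed.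

Lemma integral_Psi (psi : l_weight R D) : integral_l_weight psi ->
  (forall i, exists P Q, monic_ratio (psi i) P Q) -> exists m, psi = Psi R m.
Proof.
move=> psiZ psi_monic.
have roots i (s : seq C) : (forall a, a \in s -> exists k : int, a = ((parity i : nat)%:Z + 2 * k)%:~R) ->
    exists m, forall j, Psi R m j = if i == j then (\prod_(a <- s) ('X - a%:P))%:F else 1.
  elim: s => [|a s IH] sZ.
    by exists 0 => j; rewrite Psi0 big_nil tofrac1; case: ifP.
  have [b bs|m mE] := IH; first by apply: sZ; rewrite inE bs orbT.
  have [k ak] := sZ a (mem_head _ _).
  have ik : ((parity i : nat)%:Z + 2 * k == (parity i : nat)%:Z %[mod 2])%Z by lia.
  exists (<< exist _ (i, (parity i : nat)%:Z + 2 * k) ik >> + m) => j.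
  rewrite PsiD Psi_y mE /= ak big_cons tofracM.
  by case: eqP; rewrite ?mulr1.
have /choice[m mE] : forall i, exists m, forall j, Psi R m j = if i == j then psi i else 1.
  move=> i; have [P0 [Q0 [mP0 mQ0 r]]] := psi_monic i.
  (* Zeros and poles are defined through a coprime representation; dividing by the monic gcd reaches
     one and keeps both polynomials monic. *)
  pose g := (lead_coef (gcdp P0 Q0))^-1 *: gcdp P0 Q0.
  have g0 : gcdp P0 Q0 != 0 by rewrite gcdp_eq0 negb_and monic_neq0.
  have mg : g \is monic by rewrite monicE lead_coefZ mulVf ?lead_coef_eq0.
  have gP : g %| P0 by rewrite dvdpZl ?invr_eq0 ?lead_coef_eq0 ?dvdp_gcdl.
  have gQ : g %| Q0 by rewrite dvdpZl ?invr_eq0 ?lead_coef_eq0 ?dvdp_gcdr.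
  pose P := P0 %/ g; pose Q := Q0 %/ g.
  have PE : P0 = P * g by rewrite divpK.
  have QE : Q0 = Q * g by rewrite divpK.
  have mP : P \is monic by move: mP0; rewrite PE monicMr.
  have mQ : Q \is monic by move: mQ0; rewrite QE monicMr.
  have nQ := monic_neq0 mQ; have ng := monic_neq0 mg.
  have PQ : coprimep P Q.
    have := coprimep_div_gcd (p := P0) (q := Q0); rewrite monic_neq0 //= => /(_ isT).
    by rewrite /P /Q /g !divpZr ?invr_eq0 ?lead_coef_eq0 // coprimepZl ?coprimepZr ?invr_eq0 ?lead_coef_eq0.
  have rPQ : monic_ratio (psi i) P Q.
    split=> //; rewrite r PE QE !tofracM -mulf_div divff ?mulr1 // tofrac_eq0 //.
  have [sP PsP] := closed_field_poly_normal P.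
  have [sQ QsQ] := closed_field_poly_normal Q.
  rewrite (monicP mP) scale1r in PsP; rewrite (monicP mQ) scale1r in QsQ.
  have [a aP|mp mpE] := roots i sP.
    apply: (psiZ i a); left; exists P, Q; split=> //.
    by rewrite PsP root_prod_XsubC.
  have [a aQ|mq mqE] := roots i sQ.
    apply: (psiZ i a); right; exists P, Q; split=> //.
    by rewrite QsQ root_prod_XsubC.
  exists (mp - mq) => j; rewrite PsiD PsiN mpE mqE -PsP -QsQ.
  by case: eqP; rewrite ?divr1 //; case: rPQ.
exists (\sum_i m i); apply/funext => j; rewrite Psi_sum.
rewrite (bigD1 j) //= mE eqxx big1 ?mulr1 // => i ij.
by rewrite mE (negPf ij).
Qed.

End Psi.

(** * The decomposition *)

Section SubQuotient.
Variables (A : pzRingType) (V : lmodType A) (U : V -> Prop).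
Hypothesis sU : submodule U.

Let U0 : U 0. Proof. by case: sU. Qed.
Let UD u v : U u -> U v -> U (u + v).
Proof. by move=> Uu Uv; rewrite -[u]scale1r; case: sU => _; exact. Qed.
Let UZ a u : U u -> U (a *: u).
Proof. by move=> Uu; rewrite -[_ *: _]addr0; case: sU => _; exact. Qed.
Let UN u : U u -> U (- u).
Proof. by rewrite -scaleN1r; exact: UZ. Qed.

Lemma submodule_ex : exists (W : lmodType A) (f : {linear W -> V}),
  injective f /\ forall x, U x <-> exists w, f w = x.
Proof.
pose T := {x : V | `[< U x >]}.
have TU (t : T) : U (val t) by apply/asboolP; case: t.
pose mk x (Ux : U x) : T := exist _ x (asboolT Ux).
pose add (t u : T) := mk _ (UD (TU t) (TU u)).
pose opp (t : T) := mk _ (UN (TU t)).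
pose scale a (t : T) := mk _ (UZ a (TU t)).
have addA : associative add by move=> t u v; apply: val_inj; exact: addrA.
have addC : commutative add by move=> t u; apply: val_inj; exact: addrC.
have add0 : left_id (mk _ U0) add by move=> t; apply: val_inj; exact: add0r.
have addN : left_inverse (mk _ U0) opp add by move=> t; apply: val_inj; exact: addNr.
pose Z : zmodType := HB.pack_for zmodType T (GRing.isZmodule.Build T addA addC add0 addN).
have sA a b (t : Z) : scale a (scale b t) = scale (a * b) t.
  by apply: val_inj; exact: scalerA.
have s1 : left_id 1 (scale : A -> Z -> Z) by move=> t; apply: val_inj; exact: scale1r.
have sDr : right_distributive (scale : A -> Z -> Z) +%R.
  by move=> a t u; apply: val_inj; exact: scalerDr.
have sDl (t : Z) : {morph (scale : A -> Z -> Z)^~ t : a b / a + b}.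
  by move=> a b; apply: val_inj; exact: scalerDl.
pose L : lmodType A := HB.pack_for (lmodType A) Z
  (GRing.Zmodule_isLmodule.Build A Z sA s1 sDr sDl).
have [f fE] := @linear_of_fun A L V (fun t : T => val t) (fun _ _ _ => erefl).
exists L, f; split=> [t u|x]; first by rewrite !fE => /val_inj.
by split=> [Ux|[w <-]]; [exists (mk x Ux); rewrite fE | rewrite fE; exact: TU].
Qed.

(** The quotient is modelled on the vectors that are the chosen representatives of their classes;
    operations are performed in [V] and followed by [rep]. *)
Lemma quotient_ex : exists (W : lmodType A) (f : {linear V -> W}),
  (forall w, exists x, f x = w) /\ forall x, U x <-> f x = 0.
Proof.
pose cls v : pred V := fun w => `[< U (v - w) >].
pose rep v := choose (cls v) v.
have repP v : U (v - rep v).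
  by apply/asboolP; apply: (@chooseP _ (cls v)); rewrite /cls subrr; apply/asboolP.
have repE v w : U (v - w) -> rep v = rep w.
  move=> Uvw; rewrite /rep (@eq_choose _ _ (cls w)) => [|x].
    apply: choose_id; rewrite /cls; apply/asboolP; last by rewrite subrr.
    by rewrite -opprB; exact: UN.
  apply/asboolP/asboolP => Ux.
    by rewrite -(subrK v w) -addrA -opprB; apply: UD => //; exact: UN.
  by rewrite -(subrK w v) -addrA; exact: UD.
have repK v : rep (rep v) == rep v.
  by rewrite (repE (rep v) v) // -opprB; exact: UN.
pose T := {v : V | rep v == v}.
pose mk v : T := exist _ (rep v) (repK v).
have mkK (t : T) : mk (val t) = t by apply: val_inj => /=; apply/eqP; case: t.
have mkE v w : U (v - w) -> mk v = mk w by move=> Uvw; apply: val_inj; exact: repE.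
have mkP v w : mk v = mk w -> U (v - w).
  move=> /(congr1 val) /= E; rewrite -(subrK (rep v) v) -addrA; apply: UD => //.
  by rewrite E -opprB; exact: UN.
pose add (t u : T) := mk (val t + val u).
pose opp (t : T) := mk (- val t).
pose scale a (t : T) := mk (a *: val t).
have mkD v w : add (mk v) (mk w) = mk (v + w).
  apply: mkE; rewrite /=.
  have -> : rep v + rep w - (v + w) = - ((v - rep v) + (w - rep w)).
    by rewrite [RHS]opprD !opprB addrACA -opprD.
  by apply: UN; exact: UD.
have mkZ a v : scale a (mk v) = mk (a *: v).
  by apply: mkE; rewrite /= -scalerBr -opprB; apply/UZ/UN.
have mkN v : opp (mk v) = mk (- v).
  by apply: mkE; rewrite /= opprK addrC.
have mkW (P : T -> Prop) : (forall v, P (mk v)) -> forall t, P t.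
  by move=> Pmk t; rewrite -(mkK t).
have addA : associative add.
  by elim/mkW => t; elim/mkW => u; elim/mkW => v; rewrite !mkD addrA.
have addC : commutative add by elim/mkW => t; elim/mkW => u; rewrite !mkD addrC.
have add0 : left_id (mk 0) add by elim/mkW => t; rewrite mkD add0r.
have addN : left_inverse (mk 0) opp add by elim/mkW => t; rewrite mkN mkD addNr.
pose Z : zmodType := HB.pack_for zmodType T (GRing.isZmodule.Build T addA addC add0 addN).
have sA a b (t : Z) : scale a (scale b t) = scale (a * b) t.
  by move: t; elim/mkW => t; rewrite !mkZ scalerA.
have s1 : left_id 1 (scale : A -> Z -> Z) by elim/mkW => t; rewrite mkZ scale1r.
have sDr : right_distributive (scale : A -> Z -> Z) +%R.
  move=> a; elim/mkW => t; elim/mkW => u.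
  by apply: etrans (_ : scale a (add (mk t) (mk u)) = add (scale a (mk t)) (scale a (mk u))) _ => //;
     rewrite !(mkD, mkZ) scalerDr.
have sDl (t : Z) : {morph (scale : A -> Z -> Z)^~ t : a b / a + b}.
  move: t; elim/mkW => t a b.
  by apply: etrans (_ : scale (a + b) (mk t) = add (scale a (mk t)) (scale b (mk t))) _ => //;
     rewrite !mkZ mkD scalerDl.
pose L : lmodType A := HB.pack_for (lmodType A) Z
  (GRing.Zmodule_isLmodule.Build A Z sA s1 sDr sDl).
have mk_lin a u v : (mk (a *: u + v) : L) = a *: (mk u : L) + (mk v : L).
  have E : add (scale a (mk u)) (mk v) = mk (a *: u + v) by rewrite mkZ mkD.
  exact: esym E.
have [f fE] := @linear_of_fun A V L (fun v => mk v) mk_lin.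
exists L, f; split=> [w|x]; first by exists (val (w : T)); rewrite fE; exact: mkK.
split=> [Ux|]; first by rewrite fE; apply: mkE; rewrite subr0.
by rewrite fE => /mkP; rewrite subr0.
Qed.

End SubQuotient.

(** * Thickness of the category of families of modules in O *)

Section OshRealization.
Variables (R : realType) (D : lie_datum).

Definition module_realization (A : pzRingType) :
    realization (fun _ : unit => A) (module_category A).
Proof.
refine (@Realization unit (fun=> A) (module_category A) (fun V _ => V) (fun V W f _ => f) _ _ _ _) => //.
- by move=> V W f g fg; apply: linear_ext => x; exact: fg tt x.
- by move=> V W f; exists (f tt) => -[].
Defined.

Lemma O_cat_zero (mu : coweight D) (X : O_cat R mu) : zero_object X <-> forall x : sval X, x = 0.
Proof.
apply: iff_trans (zero_objectP (full_realization (module_realization _) (@in_O R D mu)) X) _.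
by split=> [X0 x|X0 k x]; [exact: X0 tt x | exact: X0].
Qed.

Definition Osh_realization : realization (@yangian R D) (O_sh R D).
Proof.
refine (@Realization _ _ (O_sh R D) (fun X mu => component X mu) (fun X Y f mu => f mu) _ _ _ _) => //.
- move=> X Y f g fg; apply: functional_extensionality_dep => mu.
  by apply: linear_ext => x; exact: fg.
- by move=> X Y f; exists f.
Defined.

Lemma component_in_O (X : O_sh R D) mu : in_O (component X mu).
Proof. exact: svalP (sval X mu). Qed.

Lemma component_finite (X : O_sh R D) :
  finite_set [set mu | ~ forall x : component X mu, x = 0]%classic.
Proof.
apply: sub_finite_set (svalP X) => mu /= nX /O_cat_zero; exact: nX.
Qed.

(** The result is an equation between families, so that a construction made with modules can be
    rewritten into one made with the components of an object. *)
Lemma mk_Osh (V : forall mu : coweight D, lmodType (yangian R mu)) :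
  (forall mu, in_O (V mu)) -> finite_set [set mu | ~ forall x : V mu, x = 0]%classic ->
  exists X : O_sh R D, component X = V.
Proof.
move=> OV finV; pose X mu : O_cat R mu := exist _ (V mu) (OV mu).
have finX : finite_set [set mu | ~ zero_object (X mu)]%classic.
  by apply: sub_finite_set finV => mu /= nX V0; apply: nX; apply/O_cat_zero.
by exists (exist _ X finX).
Qed.

Lemma Osh_thick : thick Osh_realization.
Proof.
split.
- have [||X XE] := @mk_Osh (fun mu => 'rV[yangian R mu]_0).
  + by move=> mu; apply: in_O_trivial => v; apply/rowP => -[].
  + apply: sub_finite_set (finite_set0 _) => mu /=; apply => v; by apply/rowP => -[].
  exists X; rewrite /trivial /=; rewrite XE => mu v; by apply/rowP => -[].
- move=> X U sU.
  have /dependent_choice[W] := fun mu => submodule_ex (sU mu).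
  move=> /dependent_choice[f fP].
  have OW mu : in_O (W mu) by apply: in_O_inj (proj1 (fP mu)) _; exact: component_in_O.
  have [|Y YE] := mk_Osh OW.
    apply: sub_finite_set (component_finite X) => mu /= nW X0; apply: nW => w.
    by apply: (proj1 (fP mu)); rewrite [LHS]X0 [RHS]X0.
  (* The family [W] is replaced by the components of [Y], which makes [f] a morphism of the
     category. *)
  clear OW; move: W YE f fP => _ <- f fP.
  by exists Y, f; split=> mu; case: (fP mu).
- move=> X U sU.
  have /dependent_choice[W] := fun mu => quotient_ex (sU mu).
  move=> /dependent_choice[f fP].
  have OW mu : in_O (W mu) by apply: in_O_surj (proj1 (fP mu)) _; exact: component_in_O.
  have [|Y YE] := mk_Osh OW.
    apply: sub_finite_set (component_finite X) => mu /= nW X0; apply: nW => w.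
    by have [x <-] := proj1 (fP mu) w; rewrite (X0 x) linear0.
  clear OW; move: W YE f fP => _ <- f fP.
  by exists Y, f; split=> mu; case: (fP mu).
- move=> X Y; pose V mu : lmodType (yangian R mu) := (component X mu * component Y mu)%type.
  have li mu : exists f : {linear component X mu -> V mu}, forall x, f x = (x, 0).
    apply: linear_of_fun => a u v.
    by apply: etrans (_ : (a *: u + v, a *: 0 + 0) = _); first by rewrite scaler0 addr0.
  have lj mu : exists f : {linear component Y mu -> V mu}, forall x, f x = (0, x).
    apply: linear_of_fun => a u v.
    by apply: etrans (_ : (a *: 0 + 0, a *: u + v) = _); first by rewrite scaler0 addr0.
  have lp mu : exists f : {linear V mu -> component X mu}, forall x, f x = x.1.
    exact: linear_of_fun.
  have lq mu : exists f : {linear V mu -> component Y mu}, forall x, f x = x.2.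
    exact: linear_of_fun.
  have [[i iE] [j jE]] := (dependent_choice li, dependent_choice lj).
  have [[p pE] [q qE]] := (dependent_choice lp, dependent_choice lq).
  have ipjq mu (x : V mu) : i mu (p mu x) + j mu (q mu x) = x.
    by rewrite iE jE pE qE; case: x => a b; congr (_, _); rewrite ?addr0 ?add0r.
  have OV mu : in_O (V mu).
    by apply: in_O_biproduct (ipjq mu) _ _; exact: component_in_O.
  have [|Z ZE] := mk_Osh OV.
    have /sub_finite_set : ([set mu | ~ forall x : V mu, x = 0] `<=`
      [set mu | ~ forall x : component X mu, x = 0] `|` [set mu | ~ forall x : component Y mu, x = 0])%classic.
      move=> mu /= nV; apply: contrapT => /not_orP[/contrapT X0 /contrapT Y0].
      by apply: nV => -[x y]; rewrite (X0 x) (Y0 y).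
    by apply; rewrite finite_setU; split; exact: component_finite.
  have pi mu x : p mu (i mu x) = x by rewrite pE iE.
  have qj mu x : q mu (j mu x) = x by rewrite qE jE.
  have qi mu x : q mu (i mu x) = 0 by rewrite qE iE.
  have pj mu x : p mu (j mu x) = 0 by rewrite pE jE.
  clear iE jE pE qE OV li lj lp lq.
  move: V ZE i j p q ipjq pi qj qi pj => V <- i j p q ipjq pi qj qi pj.
  exists Z, i, j, p, q; split=> //.
  + by apply: (act_inj (r := Osh_realization)) => mu x; exact: pi.
  + by apply: (act_inj (r := Osh_realization)) => mu x; exact: qj.
Qed.

End OshRealization.

(** * Gluing linear maps along the parts of a module *)

Section Glue.
Variables (R : realType) (D : lie_datum) (mu : coweight D) (I : Type).
Variable S : I -> (D * int -> R[i]) -> Prop.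
Hypothesis S_disj : forall t t' lam, S t lam -> S t' lam -> t = t'.
Local Notation gsum := (gsum (ycst R mu) (@yh R D mu)).
Variables (V Z : lmodType (yangian R mu)) (W : I -> lmodType (yangian R mu)).
Variables (f : forall t, {linear W t -> V}) (g : forall t, {linear W t -> Z}).
Hypothesis f_inj : forall t, injective (f t).
Hypothesis f_im : forall t v, gsum (S t) v <-> exists w, f t w = v.
Hypothesis W_supp : forall t, supported (S t) (W t).
Hypothesis V_supp : supported (fun lam => exists t, S t lam) V.

(* The graph of the map out of [V] glued from the [g t]. *)
Inductive glue : V -> Z -> Prop :=
| glue0 : glue 0 0
| glueS t w v z : glue v z -> glue (f t w + v) (g t w + z).

Let glue_total v : exists z, glue v z.
Proof.
elim: (V_supp v) => [|x {}v [lam [t Stl] lx] _ [z vz]]; first by exists 0; exact: glue0.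
have /f_im[w <-] : gsum (S t) x by apply: fsum1; exists lam.
by exists (g t w + z); exact: glueS.
Qed.

Let glueD v z v' z' : glue v z -> glue v' z' -> glue (v + v') (z + z').
Proof.
by move=> vz vz'; elim: vz => [|t w {}v {}z _ IH]; rewrite ?add0r // -!addrA; exact: glueS.
Qed.

Let glueZ a v z : glue v z -> glue (a *: v) (a *: z).
Proof.
elim=> [|t w {}v {}z _ IH]; first by rewrite !scaler0; exact: glue0.
by rewrite !scalerDr -!linearZ; exact: glueS.
Qed.

(** All terms of index [t] are gathered in one [w]. The same [w] gives the [t]-component on both
    sides, which is what makes the graph single-valued. *)
Let glue_component v z t : glue v z -> exists w,
  gsum (fun lam => ~ S t lam) (v - f t w) /\ gsum (fun lam => ~ S t lam) (z - g t w).
Proof.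
elim=> [|t' w' {}v {}z _ [w [vw zw]]].
  by exists 0; rewrite (linear0 (f t)) (linear0 (g t)) !subr0; split; exact: fsum0.
have [tt'|tt'] := pselect (t = t').
  case: t' / tt' in w' *; exists (w' + w).
  have addKB (M : zmodType) (a b c : M) : a + b - (a + c) = b - c.
    by rewrite opprD addrACA subrr add0r.
  by rewrite (linearD (f t)) (linearD (g t)) !addKB.
have n lam : S t' lam -> ~ S t lam by move=> St' St; apply: tt'; exact: S_disj St St'.
exists w; rewrite -!addrA; split; apply: fsumD => //; apply: gsum_lin.
  exact (gsum_sub n (W_supp w')).
exact (gsum_sub n (W_supp w')).
Qed.

Let glue_supp v z : glue v z -> gsum (fun lam => exists t, S t lam) z.
Proof.
elim=> [|t w {}v {}z _ IH]; first exact: fsum0.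
by apply: fsumD => //; apply: gsum_lin; apply: gsum_sub (W_supp w) => lam; exists t.
Qed.

Let nS t lam : S t lam -> ~ ~ S t lam. Proof. by move=> Sl; apply. Qed.

(** A nonzero [z] has a nonzero multiple supported in some [S t]. The [t]-component of [0] is zero,
    so by injectivity of [f t] the gathered [w] is zero, and [z] has no part in [S t]. *)
Let glue_0 z : glue 0 z -> z = 0.
Proof.
move=> oz; apply: contrapT => /(gsum_component (@ycstC _ _ _) (@yhC _ _ _) (glue_supp oz)).
move=> [lam [a [[t Stl] Ha lz]]]; apply.
have [w [vw zw]] := glue_component t oz.
have w0 : f t w = 0.
  apply: (gsum_disj (@nS t)); first by apply/f_im; exists w.
  rewrite -[f t w]opprK -[X in - X]add0r -scaleN1r -(rmorphN1 (ycst R mu)).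
  by apply: gsum_hpoly => //; [exact: ycstC | exact: yhC | exact: hpoly_cst].
move: zw; have -> : w = 0 by apply: (f_inj (t := t)); rewrite linear0.
rewrite (linear0 (g t)) subr0 => zw; apply: (gsum_disj (@nS t)).
  by apply: fsum1; exists lam.
by apply: gsum_hpoly => //; [exact: ycstC | exact: yhC].
Qed.

Lemma glue_ex : exists h : {linear V -> Z}, (forall t w, h (f t w) = g t w) /\
  forall h' : {linear V -> Z}, (forall t w, h' (f t w) = g t w) -> forall v, h v = h' v.
Proof.
have /choice[h hP] := glue_total.
have glue_fun v z z' : glue v z -> glue v z' -> z = z'.
  move=> vz /(glueZ (-1)) /(glueD vz); rewrite !scaleN1r subrr => /glue_0/eqP.
  by rewrite subr_eq0 => /eqP.
have [|h' h'E] := @linear_of_fun _ V Z h.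
  by move=> a u v; apply: glue_fun (hP _) _; apply: glueD => //; exact: glueZ.
exists h'; split=> [t w|h'' h''g v].
  rewrite h'E; apply: glue_fun (hP _) _.
  by have := glueS w glue0; rewrite !addr0.
rewrite h'E; elim: (hP v) => [|t w {}v z _ ->]; first by rewrite linear0.
by rewrite linearD h''g.
Qed.

End Glue.

(** * Supports of objects and the summands *)

Section Decomposition.
Variables (R : realType) (D : lie_datum).
Local Notation C := R[i].
Local Notation O := (O_sh R D).
Local Notation OZ := (O_shZ R D).
Local Notation T := (Osh_realization R D).
Implicit Types (S : (D * int -> C) -> Prop) (tau : coset D).

Let thO : thick T := Osh_thick R D.

Let is_integral (X : O) := exists psi, integral_l_weight psi /\ is_L psi X.

Let goodO : serre (good is_integral) := good_serre thO is_integral.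

Definition OshZ_realization : realization (@yangian R D) OZ :=
  full_realization T (good is_integral).
Local Notation TZ := OshZ_realization.

Let thZ : thick TZ := full_thick thO goodO.

Definition supp S (X : O) := forall mu, supported S (component X mu).

Lemma supp_inj S (X Y : O) (f : hom X Y) : hom_inj T f -> supp S Y -> supp S X.
Proof. by move=> fI SY mu; apply: supported_inj (fI mu) _ (SY mu); exact: component_in_O. Qed.

Lemma supp_surj S (X Y : O) (f : hom X Y) : hom_surj T f -> supp S X -> supp S Y.
Proof. by move=> fS SX mu; exact: supported_surj (fS mu) (SX mu). Qed.

Lemma supp_ext S (X Y Z : O) (f : hom X Y) (g : hom Y Z) :
  hom_exact T f g -> supp S X -> supp S Z -> supp S Y.
Proof.
move=> fg SX SZ mu.
apply: (supported_ext (f := act T f mu) (g := act T g mu) _ (component_in_O Y mu) (SX mu) (SZ mu)).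
by move=> y /fg.
Qed.

Lemma submodule_gsum S mu (V : lmodType (yangian R mu)) : in_O V -> saturated S ->
  submodule (gsum (ycst R mu) (@yh R D mu) S : V -> Prop).
Proof.
move=> OV satS; split=> [|a u v Su Sv]; first exact: fsum0.
by apply: fsumD => //; exact: gsum_yangian.
Qed.

(** The parts supported in [Sigma tau] form a subobject by saturation. It contains the generating
    highest l-weight vector, so it is not zero, and simplicity makes it everything. *)
Lemma L_supp tau m (X : O) : sval tau m -> is_L (Psi R m) X -> supp (Sigma tau) X.
Proof.
move=> taum [_ [/(simpleP thO)[nX sX] [mu [_ nu0 [v [vgen _ /choice[s sP]]]]]]].
pose lam (ip : D * int) := s ip.1 ip.2.
have Sv : gsum (ycst R mu) (@yh R D mu) (Sigma tau) v.
  apply: fsum1; exists lam.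
    by apply: Sigma_Psi taum _ => i; case: (sP i).
  move=> [i p]; exists 1%N; rewrite expr1 scalerBl; apply/eqP; rewrite subr_eq0; apply/eqP.
  by have [_] := sP i; apply.
have [U0|//] := sX (fun nu => gsum (ycst R nu) (@yh R D nu) (Sigma tau))
  (fun nu => submodule_gsum (component_in_O X nu) (@Sigma_saturated R D tau)).
case: nX => nu x; have [numu|/nu0 //] := pselect (nu = mu).
by move: x; rewrite numu => x; have [y ->] := vgen x; rewrite (U0 mu v Sv) scaler0.
Qed.

Lemma supp_uniq tau tau' (X : O) : ~ trivial T X ->
  supp (Sigma tau) X -> supp (Sigma tau') X -> tau = tau'.
Proof.
move=> nX SX SX'; apply: contrapT => ne; apply: nX => mu x.
apply: (gsum_disj _ (SX mu x) (SX' mu x)) => lam Sl Sl'; apply: ne.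
exact: Sigma_disjoint Sl Sl'.
Qed.

Lemma integral_supp (X : O) : is_integral X ->
  exists tau, supp (Sigma tau) X /\ exists2 m, sval tau m & is_L (Psi R m) X.
Proof.
move=> [psi [psiZ LX]]; have [m psiE] := integral_Psi psiZ (proj1 LX).
rewrite psiE in LX; exists (coset_of m); split.
  exact: L_supp (coset_of_mem m) LX.
by exists m => //; exact: coset_of_mem.
Qed.

(** Being supported in [Sigma tau] is itself a Serre class containing the generators. *)
Lemma tau_O_supp tau (X : OZ) : tau_O_shZ tau X -> supp (Sigma tau) (sval X).
Proof.
move=> /(_ (fun X : OZ => supp (Sigma tau) (sval X))); apply=> [|Y [m taum LY]]; last exact: L_supp taum LY.
split=> [Z /(zero_objectP TZ) Z0 mu x|X0 Y Z f g /(short_exactP thZ)[fI gS fg]].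
  by rewrite [x]Z0; exact: fsum0.
split=> [SY|[SX SZ]]; last exact: (@supp_ext _ (sval X0) (sval Y) (sval Z) f g fg).
split; first exact: (@supp_inj _ (sval X0) (sval Y) f fI).
exact: (@supp_surj _ (sval Y) (sval Z) g gS).
Qed.

(** Each simple constituent inherits the support of [X] and is also supported in the set of its own
    coset; being nonzero it determines the coset, so it is one of the generators. Extensions along a
    composition series do the rest. *)
Lemma supp_tau_O tau (X : OZ) : supp (Sigma tau) (sval X) -> tau_O_shZ tau X.
Proof.
move=> SX P serreP GP; case: X SX => X goodX /=.
have [[s csX] _] := goodX.
elim: csX goodX => {X s}[X X0 goodX _|X0 X S s f g fg sS csX0 IH goodX SX].
  by apply: (proj1 serreP); apply/(full_zero_object T).
have [goodX0 goodS] := proj1 (proj2 goodO _ _ _ _ _ fg) goodX.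
have [fI gS fgE] := proj1 (short_exactP thO _ _) fg.
have fgZ : @short_exact OZ (exist _ X0 goodX0) (exist _ X goodX) (exist _ S goodS) f g.
  by apply/(full_short_exact thO goodO).
apply: (proj2 (proj2 serreP _ _ _ _ _ fgZ)); split.
  by apply: IH; exact: supp_inj SX.
apply: GP => /=.
have [tau' [S'S [m taum LS]]] : exists tau', supp (Sigma tau') S /\ exists2 m, sval tau' m & is_L (Psi R m) S.
  apply: integral_supp; apply: (proj2 goodX); exists [::], s.
  exact: composition_series_cons fg sS csX0.
exists m => //; suff -> : tau = tau' by [].
apply: supp_uniq S'S; last exact: supp_surj SX.
by move/(simpleP thO): sS => [].
Qed.

Lemma good_supp (X : O) : good is_integral X ->
  exists ts : seq (coset D), supp (fun lam => exists2 tau, List.In tau ts & Sigma tau lam) X.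
Proof.
move=> goodX; have [[s csX] _] := goodX.
elim: csX goodX => {X s}[X /(zero_objectP T) X0 _|X0 X S s f g fg sS csX0 IH goodX].
  by exists [::] => mu x; rewrite [x]X0; exact: fsum0.
have [goodX0 goodS] := proj1 (proj2 goodO _ _ _ _ _ fg) goodX.
have [fI gS fgE] := proj1 (short_exactP thO _ _) fg.
have [ts tsX0] := IH goodX0.
have [tau [tauS _]] : exists tau, supp (Sigma tau) S /\ exists2 m, sval tau m & is_L (Psi R m) S.
  apply: integral_supp; apply: (proj2 goodX); exists [::], s.
  exact: composition_series_cons fg sS csX0.
exists (tau :: ts); apply: supp_ext fgE _ _ => mu x.
  by apply: gsum_sub (tsX0 mu x) => lam [t tin tl]; exists t => //; right.
by apply: gsum_sub (tauS mu x) => lam tl; exists tau => //; left.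
Qed.

Lemma finite_set_In (I : Type) (s : seq I) : finite_set [set x | List.In x s]%classic.
Proof.
elim: s => [|x s IH]; first by apply: sub_finite_set (finite_set0 _).
by apply: sub_finite_set (_ : _ `<=` [set x] `|` [set y | List.In y s])%classic _;
  [move=> y [->|]; [left | right] | rewrite finite_setU; split].
Qed.

Lemma tau_O_thick tau : thick (full_realization TZ (@tau_O_shZ R D tau)).
Proof. by apply: full_thick thZ _; exact: serre_generated_serre. Qed.

Lemma tau_O_orthogonal tau tau' (X Y : OZ) (f : hom X Y) :
  tau <> tau' -> tau_O_shZ tau X -> tau_O_shZ tau' Y -> zero_morphism f.
Proof.
move=> ne /tau_O_supp SX /tau_O_supp SY; apply/(zero_morphismP thZ) => mu x.
apply: (gsum_disj _ _ (SY mu _)); last exact: gsum_lin (SX mu x).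
by move=> lam Sl Sl'; apply: ne; exact: Sigma_disjoint Sl Sl'.
Qed.

(** The summand of [X] for [tau]. It is supported in [Sigma tau] on its own, since a component of it
    outside would inject into a part of [X] that is both inside and outside. *)
Lemma tau_O_part tau (X : OZ) : exists (Y : OZ) (f : hom Y X),
  [/\ supp (Sigma tau) (sval Y), hom_inj TZ f &
     forall mu x, gsum (ycst R mu) (@yh R D mu) (Sigma tau) x <-> exists y, act TZ f mu y = x].
Proof.
have [|Y [f [fI fU]]] := thick_sub thZ (X := X) (U := fun mu => gsum (ycst R mu) (@yh R D mu) (Sigma tau)).
  by move=> mu; apply: submodule_gsum (@Sigma_saturated R D tau); exact: component_in_O.
exists Y, f; split=> // mu y.
have [a [r [Sa Sr yE]]] := supported_split (Sigma tau) y (component_in_O (sval Y) mu).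
suff r0 : r = 0 by rewrite yE r0 addr0.
apply: (fI mu); rewrite linear0.
apply: (gsum_disj (S := Sigma tau) (S' := fun lam => ~ Sigma tau lam)).
- by move=> lam Sl; apply.
- apply/fU; exists r; by [].
- exact: gsum_lin.
Qed.

Lemma OshZ_coproduct (X : OZ) :
  exists (F : dsum_category (fun tau => full_subcategory (@tau_O_shZ R D tau)))
    (i : forall tau, hom (sval (sval F tau)) X), is_coproduct i.
Proof.
have /dependent_choice[Y] := fun tau => tau_O_part tau X.
move=> /dependent_choice[f fP].
have SY tau : supp (Sigma tau) (sval (Y tau)) by case: (fP tau).
have fI tau : hom_inj TZ (f tau) by case: (fP tau).
have fU tau mu x : gsum (ycst R mu) (@yh R D mu) (Sigma tau) x <-> exists y, act TZ (f tau) mu y = x.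
  by case: (fP tau).
have [ts tsX] := good_supp (svalP X).
pose F0 tau : full_subcategory (@tau_O_shZ R D tau) := exist _ (Y tau) (supp_tau_O (SY tau)).
have F0fin : finite_set [set tau | ~ zero_object (F0 tau)]%classic.
  (* For [tau] outside [ts], the part of [X] is supported in disjoint sets of eigenvalues, hence
     zero. *)
  apply: sub_finite_set (finite_set_In ts) => tau /= nF; apply: contrapT => ntau; apply: nF.
  apply/(zero_objectP (full_realization TZ (@tau_O_shZ R D tau))) => mu y.
  apply: (fI tau mu); rewrite linear0.
  apply: (gsum_disj _ _ (tsX mu _)); last by apply/fU; exists y.
  by move=> lam Sl [tau' tin Sl']; apply: ntau; rewrite (Sigma_disjoint Sl Sl').
exists (exist _ F0 F0fin), f => Z g.
(* The universal property is checked separately in each component [mu], where the map out of [X] is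
   glued from its restrictions to the parts. *)
have /dependent_choice[h hP] : forall mu, exists h : {linear car TZ X mu -> car TZ Z mu},
    (forall tau w, h (act TZ (f tau) mu w) = act TZ (g tau) mu w) /\
    forall h' : {linear car TZ X mu -> car TZ Z mu},
      (forall tau w, h' (act TZ (f tau) mu w) = act TZ (g tau) mu w) -> forall v, h v = h' v.
  move=> mu; apply: (@glue_ex R D mu (coset D) (@Sigma R D)) => //.
  - exact: Sigma_disjoint.
  - by move=> tau; exact: fI.
  - by move=> tau; exact: SY.
  - by move=> v; apply: gsum_sub (tsX mu v) => lam [tau _ Sl]; exists tau.
have [h' h'E] := act_surj (r := TZ) h.
exists h'; split.
  by move=> tau; apply: (act_inj (r := TZ)) => mu w; rewrite act_comp h'E (proj1 (hP mu)).
move=> h'' h''g; apply: (act_inj (r := TZ)) => mu v; rewrite h'E; apply: (proj2 (hP mu)) => tau w.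
by rewrite -act_comp h''g.
Qed.

End Decomposition.

Theorem theorem12 (R : realType) (D : lie_datum) :
  [/\ abelian (O_shZ R D),
      forall tau : coset D, abelian (full_subcategory (@tau_O_shZ R D tau))
    & direct_sum_decomposition (@tau_O_shZ R D)].
Proof.
split.
- apply: (@thick_abelian _ _ _ (OshZ_realization R D)).
  by apply: full_thick; [exact: Osh_thick | apply: good_serre; exact: Osh_thick].
- move=> tau; apply: thick_abelian; exact: tau_O_thick.
- split; last exact: OshZ_coproduct.
  by move=> tau tau' X Y f; exact: tau_O_orthogonal.
Qed.
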